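(* Let $(X_t)_{t\ge0}$ be a L\'evy process on $\mathbb{R}^d$ with $X_0=0$, with L\'evy measure $\nu\not\equiv0$ and transition probabilities $P_t(x,\cdot)$. The following statements are equivalent: (1) The L\'evy process $(X_t)_{t\ge0}$ has the coupling property. (2) There exists $t_0>0$ such that for any $t\ge t_0$ (and any $x\in\mathbb{R}^d$), the transition probability $P_t(x,\cdot)$ has, with respect to Lebesgue measure, an absolutely continuous component. In either case (that is, if (1) or equivalently (2) holds), for every $x,y\in\mathbb{R}^d$ there exists a constant $C(x,y)>0$ such that $$\|P_t(x,\cdot)-P_t(y,\cdot)\|_{\mathrm{Var}}\le\frac{C(x,y)}{\sqrt t},\qquad t>0.$$
   Context: A L\'evy process on $\mathbb{R}^d$ is a process with stationary and independent increments and c\`adl\`ag paths; its L\'evy measure is its jump measure $\nu$, satisfying $\int(1\wedge|z|^2)\,\nu(dz)<\infty$. The transition probability is $P_t(x,A)=\mathbb{P}(x+X_t\in A)$. A measure has an absolutely continuous component if it is not singular with respect to Lebesgue measure (its Lebesgue decomposition has a nonzero absolutely continuous part). $\|\cdot\|_{\mathrm{Var}}$ is the total variation norm, $\|\mu\|_{\mathrm{Var}}=\sup_{\|f\|_\infty\le1}|\int f\,d\mu|$. Coupling: a coupling of a Markov process with transition functions $P_t(x,\cdot)$ is an $\mathbb{R}^{2d}$-valued process $(X'_t,X''_t)_{t\ge0}$ such that both $X'$ and $X''$ are Markov processes with transition functions $P_t(x,\cdot)$, but possibly different initial distributions. Its coupling time is $T=\inf\{t\ge0:X'_t=X''_t\}$,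 and the coupling is successful if $T<\infty$ a.s. The Markov process has the coupling property (admits a successful coupling) if for any two initial distributions $\mu_1,\mu_2$ there is a successful coupling whose marginal processes start from $\mu_1$ and $\mu_2$, respectively. The paper uses as known that this is equivalent to $\lim_{t\to\infty}\|\mu_1P_t-\mu_2P_t\|_{\mathrm{Var}}=0$ for all probability measures $\mu_1,\mu_2$ on $\mathbb{R}^d$, where $\mu P_t(A)=\int P_t(x,A)\,\mu(dx)$.
   Formalization: Both marginal processes of a coupling are required to have càdlàg paths; without path regularity, changing one process at an independent random time would make every coupling successful and the equivalence false (e.g. for a Poisson process). *)

(* Defs.v *)
From HB Require Import structures.
From mathcomp Require Import all_boot all_order all_algebra.
From mathcomp Require Import all_classical all_reals all_analysis.
From mathcomp Require Import measurable_realfun.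
Import Order.TTheory GRing.Theory Num.Theory.
Import numFieldTopology.Exports numFieldNormedType.Exports.

Set Implicit Arguments.
Unset Strict Implicit.
Unset Printing Implicit Defensive.

Local Open Scope classical_set_scope.
Local Open Scope ring_scope.

(** ** The Borel space and Lebesgue measure on R^d ['rV[R]_d] *)

(* Borel sigma-algebra; the library topology on matrices is the product
   (sup-norm) topology. *)
HB.instance Definition _ (R : realType) (d : nat) :=
  @isMeasurable.Build (sigma_display (@open 'rV[R]_d)) 'rV[R]_d
    <<s @open 'rV[R]_d >> (@sigma_algebra0 _ setT _) (@sigma_algebraC _ _)
    (@sigma_algebra_bigcup _ setT _).

Definition rV_cons (R : realType) (d : nat) (p : R * 'rV[R]_d) : 'rV[R]_d.+1 :=
  row_mx (p.1)%:M p.2.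

Fixpoint lebesgue_rV (R : realType) (d : nat) : set 'rV[R]_d -> \bar R :=
  match d with
  | 0 => \d_(0 : 'rV[R]_0)
  | d'.+1 => pushforward (lebesgue_measure \x lebesgue_rV (d := d'))%E
                         (@rV_cons R d')
  end.
Arguments lebesgue_rV {R d}.

Section borel_lebesgue_facts.
Context {R : realType}.

Lemma rV_coord_measurable d (i : 'I_d) :
  measurable_fun [set: 'rV[R]_d] (fun v : 'rV[R]_d => v ord0 i).
Proof.
apply: (measurability (@RGenOInfty.G R)) => [|_ [_ [x ->] <-]].
  exact: RGenOInfty.measurableE.
rewrite setTI; apply: sub_sigma_algebra.
by apply: open_comp => [v _|]; [exact: coord_continuous|exact: rray_open].
Qed.

Lemma rV_measurable_funP d1 (T : measurableType d1) d (f : T -> 'rV[R]_d) :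
  measurable_fun [set: T] f <->
  forall i, measurable_fun [set: T] (fun x => f x ord0 i).
Proof.
split=> [mf i|mf].
  exact: (measurableT_comp (rV_coord_measurable i) mf).
apply: (@measurability _ _ _ _ _ _ (@open 'rV[R]_d)) => //.
move=> _ [U oU <-]; rewrite setTI.
pose Q := ('rV[rat]_d * nat)%type.
pose V (q : Q) : set 'rV[R]_d :=
  [set v | forall i, `|ratr (q.1 ord0 i) - v ord0 i| < q.2.+1%:R^-1].
pose F (q : Q) : set T := if `[< V q `<=` U >] then f @^-1` V q else set0.
have -> : f @^-1` U = \bigcup_q F q.
  apply/seteqP; split=> [x /= Ux|x [q _]]; last first.
    by rewrite /F; case: asboolP => // VU /VU.
  have /nbhs_ballP[e /= e0 eU] := open_nbhs_nbhs (conj oU Ux).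
  have [n ne] : exists n : nat, n.+1%:R^-1 + n.+1%:R^-1 < e.
    have e20 : 0 < e / 2 by rewrite divr_gt0.
    near \oo => n; exists n; rewrite [ltRHS]splitr ltrD//; near: n;
      exact: near_infty_natSinv_lt (PosNum e20).
  have n0 : 0 < n.+1%:R^-1 :> R by rewrite invr_gt0.
  have qE i : exists q : rat, `|ratr q - f x ord0 i| < n.+1%:R^-1.
    have [q] := @rat_in_itvoo R (f x ord0 i - n.+1%:R^-1)
      (f x ord0 i + n.+1%:R^-1) ltac:(by rewrite ltrD2l gtrN).
    by rewrite in_itv/= -ltr_distl; exists q.
  have [g gE] := choice qE.
  exists (\row_i g i, n) => //; rewrite /F asboolT.
    by move=> i /=; rewrite mxE.
  move=> v vV; apply: eU; split=> // i j; rewrite !ord1.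
  rewrite /ball/=; apply: lt_trans ne.
  rewrite (le_lt_trans (ler_distD (ratr (g j)) _ _))// ltrD//.
    by rewrite distrC; exact: gE.
  by have := vV j; rewrite /= mxE.
apply: countable_bigcupT_measurable; first exact: countableP.
move=> q; rewrite /F; case: asboolP => // _.
rewrite (_ : f @^-1` V q = \bigcap_i
  [set x | `|ratr (q.1 ord0 i) - f x ord0 i| < q.2.+1%:R^-1]).
  apply: fin_bigcap_measurable => // i _.
  rewrite -[X in measurable X]setTI.
  have mh : measurable_fun [set: T]
      (fun x => `|ratr (q.1 ord0 i) - f x ord0 i| < q.2.+1%:R^-1).
    apply: measurable_fun_ltr => //; apply: measurableT_comp => //.
    by apply: measurable_funB => //; exact: mf.
  exact: (mh measurableT [set true]).
by apply/seteqP; split=> x //= h i; [move=> _|]; exact: h.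
Unshelve. all: by end_near. Qed.

Lemma rV_cons0 d (p : R * 'rV[R]_d) : rV_cons p ord0 ord0 = p.1.
Proof.
rewrite /rV_cons (_ : ord0 = lshift d ord0 :> 'I_(1 + d)); last exact: val_inj.
by rewrite (row_mxEl (p.1)%:M p.2) mxE eqxx mulr1n.
Qed.

Lemma rV_cons_lift d (p : R * 'rV[R]_d) i :
  rV_cons p ord0 (lift ord0 i) = p.2 ord0 i.
Proof.
rewrite /rV_cons (_ : lift ord0 i = rshift 1 i :> 'I_(1 + d)); last exact: val_inj.
exact: (row_mxEr (p.1)%:M p.2).
Qed.

Lemma measurable_rV_cons d : measurable_fun [set: R * 'rV[R]_d] (@rV_cons R d).
Proof.
apply/rV_measurable_funP => i; have [j ->|->] := unliftP ord0 i.
  rewrite (_ : (fun _ => _) = (fun v : 'rV[R]_d => v ord0 j) \o snd); last first.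
    by apply/funext => p; exact: rV_cons_lift.
  exact: (measurableT_comp (rV_coord_measurable j) measurable_snd).
rewrite (_ : (fun _ => _) = fst); first exact: measurable_fst.
by apply/funext => p; exact: rV_cons0.
Qed.


Section rV_cons_measure.
Variables (d : nat) (m : {sigma_finite_measure set 'rV[R]_d -> \bar R}).

Let p := pushforward (@lebesgue_measure R \x m)%E (@rV_cons R d).

Let p_measure : {measure set 'rV[R]_d.+1 -> \bar R} :=
  measure_function_pushforward__canonical__measure_function_Measure
    (@lebesgue_measure R \x m)%E (@measurable_rV_cons d).

HB.instance Definition _ := isMeasure.Build _ _ _ p
  (measure0 p_measure) (measure_ge0 p_measure)
  (@measure_semi_sigma_additive _ _ _ p_measure).

Let p_sigma_finite : sigma_finite setT p.
Proof.
have /sigma_finiteP[F [TF ndF Foo]] := sigma_finiteT (@lebesgue_measure R).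
have /sigma_finiteP[G [TG ndG Goo]] := sigma_finiteT m.
have mH n : measurable [set v : 'rV[R]_d.+1 | F n (v ord0 ord0) /\
    G n (\row_i v ord0 (lift ord0 i))].
  have [mF _] := Foo n; have [mG _] := Goo n.
  apply: measurableI.
    rewrite -[X in measurable X]setTI.
    exact: (@rV_coord_measurable d.+1 ord0 measurableT _ mF).
  rewrite -[X in measurable X]setTI.
  suff mr : measurable_fun setT
    (fun v : 'rV[R]_d.+1 => \row_i v ord0 (lift ord0 i)) by exact: mr.
  apply/rV_measurable_funP => i.
  under eq_fun do rewrite mxE.
  exact: rV_coord_measurable.
exists (fun n => [set v : 'rV[R]_d.+1 | F n (v ord0 ord0) /\
    G n (\row_i v ord0 (lift ord0 i))]).
  apply/seteqP; split=> // v _.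
  have [i _ Fi] : (\bigcup_k F k) (v ord0 ord0) by rewrite -TF.
  have [j _ Gj] : (\bigcup_k G k) (\row_i v ord0 (lift ord0 i)) by rewrite -TG.
  exists (maxn i j) => //; split.
  - by move: Fi; exact/subsetPset/ndF/leq_maxl.
  - by move: Gj; exact/subsetPset/ndG/leq_maxr.
move=> n; split=> //; have [mF Fn] := Foo n; have [mG Gn] := Goo n.
rewrite /p/= /pushforward (_ : _ @^-1` _ = F n `*` G n).
  by rewrite product_measure1E// lte_mul_pinfty// ge0_fin_numE.
have rE q : \row_i rV_cons q ord0 (lift ord0 i) = q.2 :> 'rV[R]_d.
  by apply/rowP => i; rewrite mxE rV_cons_lift.
by apply/seteqP; split=> q /=; rewrite rV_cons0 rE.
Qed.

HB.instance Definition _ := Measure_isSigmaFinite.Build _ _ _ p p_sigma_finite.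

Let p_sigma_finite_measure : {sigma_finite_measure set 'rV[R]_d.+1 -> \bar R} :=
  p.

Lemma rV_cons_sigma_finite_measure :
  exists q : {sigma_finite_measure set 'rV[R]_d.+1 -> \bar R},
    q = pushforward (lebesgue_measure \x m)%E (@rV_cons R d)
      :> (set 'rV[R]_d.+1 -> \bar R).
Proof. by exists p_sigma_finite_measure. Qed.

End rV_cons_measure.

Lemma lebesgue_rV_is_sigma_finite_measure d :
  exists m : {sigma_finite_measure set 'rV[R]_d -> \bar R},
    m = lebesgue_rV :> (set 'rV[R]_d -> \bar R).
Proof.
elim: d => [|d [m mE]] /=; first by exists (\d_(0 : 'rV[R]_0)).
by rewrite -mE; exact: rV_cons_sigma_finite_measure.
Qed.

Let lebesgue_rV0 d : @lebesgue_rV R d set0 = 0%E.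
Proof.
by have [m <-] := lebesgue_rV_is_sigma_finite_measure d; rewrite measure0.
Qed.

Let lebesgue_rV_ge0 d (A : set 'rV[R]_d) : (0 <= lebesgue_rV A)%E.
Proof.
by have [m <-] := lebesgue_rV_is_sigma_finite_measure d; rewrite measure_ge0.
Qed.

Let lebesgue_rV_sigma_additive d : semi_sigma_additive (@lebesgue_rV R d).
Proof.
have [m <-] := lebesgue_rV_is_sigma_finite_measure d.
exact: measure_semi_sigma_additive.
Qed.

HB.instance Definition _ d := isMeasure.Build _ _ _ (@lebesgue_rV R d)
  (@lebesgue_rV0 d) (@lebesgue_rV_ge0 d) (@lebesgue_rV_sigma_additive d).

Let lebesgue_rV_sigma_finite d : sigma_finite setT (@lebesgue_rV R d).
Proof.
have [m <-] := lebesgue_rV_is_sigma_finite_measure d; exact: sigma_finiteT.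
Qed.

HB.instance Definition _ d := Measure_isSigmaFinite.Build _ _ _
  (@lebesgue_rV R d) (@lebesgue_rV_sigma_finite d).

Lemma lebesgue_rV_rectangle d (A : 'I_d -> set (measurableTypeR R)) :
  (forall i, measurable (A i)) ->
  lebesgue_rV [set v : 'rV[R]_d | forall i, A i (v ord0 i)] =
  (\prod_(i < d) lebesgue_measure (A i))%E.
Proof.
elim: d A => [|d IH] A mA /=.
  by rewrite big_ord0 diracE mem_set// => -[].
rewrite big_ord_recl -IH//.
rewrite /pushforward (_ : _ @^-1` _ = A ord0 `*`
  [set v : 'rV[R]_d | forall i, A (lift ord0 i) (v ord0 i)]).
  rewrite product_measure1E//.
  rewrite (_ : mkset _ = \bigcap_i
    [set v : 'rV[R]_d | A (lift ord0 i) (v ord0 i)]); last first.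
    by apply/seteqP; split=> v /= h i; [move=> _|]; exact: h.
  apply: fin_bigcap_measurable => // i _; rewrite -[X in measurable X]setTI.
  exact: (@rV_coord_measurable d i measurableT _ (mA _)).
apply/seteqP; split=> p /=.
  move=> h; split; first by have := h ord0; rewrite rV_cons0.
  by move=> i; have := h (lift ord0 i); rewrite rV_cons_lift.
move=> [h0 h] i; have [j ->|->] := unliftP ord0 i.
  by rewrite rV_cons_lift; exact: h.
by rewrite rV_cons0.
Qed.

End borel_lebesgue_facts.

Local Open Scope ereal_scope.

(** ** Measures on R^d *)

Definition mutually_singular d (T : measurableType d) (R : realType)
    (mu nu : set T -> \bar R) : Prop :=
  exists N : set T, [/\ measurable N, mu (~` N) = 0 & nu N = 0].

Definition has_ac_component (R : realType) (d : nat)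
    (mu : set 'rV[R]_d -> \bar R) : Prop :=
  ~ mutually_singular mu lebesgue_rV.

(* [\| mu1 - mu2 \|_Var], with [\int f d(mu1 - mu2)] written as the difference
   of the two integrals; used for probability measures only, for which both
   integrals are finite. *)
Definition var_dist d (T : measurableType d) (R : realType)
    (mu1 mu2 : set T -> \bar R) : \bar R :=
  ereal_sup [set `| \int[mu1]_z (f z)%:E - \int[mu2]_z (f z)%:E | |
             f in [set f : {mfun T >-> R} | forall z, (`|f z| <= 1)%R]].

(** ** Paths *)

(* Time is indexed by [R]; beyond measurability, processes are unconstrained at
   times [t < 0]. *)
Definition cadlag (R : realType) (d : nat) (x : R -> 'rV[R]_d) : Prop :=
  (forall t : R, (0 <= t)%R -> x u @[u --> t^'+] --> x t) /\
  (forall t : R, (0 < t)%R -> cvg (x u @[u --> t^'-])).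

Definition path_jump (R : realType) (d : nat) (x : R -> 'rV[R]_d) (t : R) :
    'rV[R]_d :=
  (x t - lim (x u @[u --> t^'-]))%R.

(** ** Lévy processes *)

Section levy.
Context (R : realType) (d : nat) {d0 : measure_display} {Om : measurableType d0}
  (P : probability Om R).
Implicit Type X : R -> {RV P >-> 'rV[R]_d}.

Definition increment X (s t : R) (w : Om) : 'rV[R]_d := (X t w - X s w)%R.

(* The events [A i] may be the whole space, so the product rule over all [n]
   increments yields the one over any subfamily. *)
Definition independent_increments X : Prop :=
  forall (n : nat) (t : nat -> R) (A : nat -> set 'rV[R]_d),
    (0 <= t 0%N)%R -> (forall i, (i < n)%N -> (t i <= t i.+1)%R) ->
    (forall i, measurable (A i)) ->
    P (\bigcap_(i < n) (increment X (t i) (t i.+1) @^-1` A i)) =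
    \prod_(i < n) P (increment X (t i) (t i.+1) @^-1` A i).

Definition stationary_increments X : Prop :=
  forall (s t : R) (A : set 'rV[R]_d), (0 <= s)%R -> (0 <= t)%R ->
    measurable A ->
    P (increment X s (s + t)%R @^-1` A) = P (increment X 0 t @^-1` A).

Record levy_process X : Prop := {
  levy_independent : independent_increments X ;
  levy_stationary : stationary_increments X ;
  levy_cadlag : forall w : Om, cadlag (X ^~ w) }.

(* [nu A] is the expected number of jumps with (nonzero) size in [A] during
   the time interval ]0, 1]. *)
Record levy_measure X (nu : {measure set 'rV[R]_d -> \bar R}) : Prop := {
  levy_measure_jumps : forall A : set 'rV[R]_d, measurable A ->
    nu A = \int[P]_w counting [set s : R | [/\ (0 < s <= 1)%R,
              path_jump (X ^~ w) s != 0%R & A (path_jump (X ^~ w) s)]] ;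
  levy_measure_integrable :
    \int[nu]_z (Num.min 1 (\sum_(i < d) z ord0 i ^+ 2))%R%:E < +oo }.

Definition levy_transition X (t : R) (x : 'rV[R]_d) : set 'rV[R]_d -> \bar R :=
  pushforward P (fun w => x + X t w)%R.

End levy.

(** ** Couplings of Markov processes *)

Section coupling.
Context (R : realType) (d : nat).
Variable Q : R -> 'rV[R]_d -> set 'rV[R]_d -> \bar R.

Definition past_events d0 (Om : measurableType d0) (P : probability Om R)
    (Y : R -> {RV P >-> 'rV[R]_d}) (s : R) : set (set Om) :=
  <<s \bigcup_(u in `[0%R, s]) preimage_set_system setT (Y u) measurable >>.

(* [P (Y (s + t) \in A | past_events Y s) = Q t (Y s) A] almost surely, the
   conditional probability being spelt out. *)
Definition markov_process d0 (Om : measurableType d0) (P : probability Om R)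
    (Y : R -> {RV P >-> 'rV[R]_d}) : Prop :=
  forall (s t : R) (A : set 'rV[R]_d) (B : set Om),
    (0 <= s)%R -> (0 <= t)%R -> measurable A -> past_events Y s B ->
    P (B `&` (Y (s + t)%R @^-1` A)) = \int[P]_(w in B) Q t (Y s w) A.

Definition initial_distribution d0 (Om : measurableType d0)
    (P : probability Om R) (Y : R -> {RV P >-> 'rV[R]_d})
    (mu : probability 'rV[R]_d R) : Prop :=
  forall A, measurable A -> distribution P (Y 0%R) A = mu A.

(* Each marginal is Markov for its own filtration. Path regularity is needed
   for the coupling time to be meaningful: otherwise one marginal could be
   modified at a random time without altering its finite-dimensional laws. *)
Record coupling d0 (Om : measurableType d0) (P : probability Om R)
    (Y Z : R -> {RV P >-> 'rV[R]_d}) : Prop := {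
  coupling_markov_l : markov_process Y ;
  coupling_markov_r : markov_process Z ;
  coupling_cadlag_l : forall w, cadlag (Y ^~ w) ;
  coupling_cadlag_r : forall w, cadlag (Z ^~ w) }.

Definition coupling_time (Om : Type) (Y Z : R -> Om -> 'rV[R]_d) (w : Om) :
    \bar R :=
  ereal_inf [set t%:E | t in [set t : R | (0 <= t)%R /\ Y t w = Z t w]].

Definition successful d0 (Om : measurableType d0) (P : probability Om R)
    (Y Z : R -> {RV P >-> 'rV[R]_d}) : Prop :=
  {ae P, forall w, coupling_time Y Z w < +oo}.

Definition coupling_property : Prop :=
  forall mu1 mu2 : probability 'rV[R]_d R,
  exists (d0 : measure_display) (Om : measurableType d0)
         (P : probability Om R) (Y Z : R -> {RV P >-> 'rV[R]_d}),
    [/\ coupling Y Z, initial_distribution Y mu1, initial_distribution Z mu2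
      & successful Y Z].

End coupling.

(* Main.v *)
Require Import Defs.
From HB Require Import structures.
From mathcomp Require Import all_boot all_order all_algebra.
From mathcomp Require Import all_classical all_reals all_analysis.
From mathcomp Require Import measurable_realfun.
From mathcomp Require Import zify ring lra.
Import Order.TTheory GRing.Theory Num.Theory.
Import numFieldTopology.Exports numFieldNormedType.Exports.
Set Implicit Arguments.
Unset Strict Implicit.
Unset Printing Implicit Defensive.
Local Open Scope classical_set_scope.
Local Open Scope ring_scope.

(** Three arguments carry the theorem.

    Rate of decay.  If the law m of X_t0 is not singular, it dominates e times
    Lebesgue measure on some bounded set E of positive measure, with e > 0
    ([ac_component_minorized]).  When E overlaps a translate of itself by h, m
    dominates a + a', where a is a nonzero measure and a' its translate by h;
    hence a step of the random walk with step law m contains, with a fixed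
    positive probability, a fair choice between staying and moving by h.  The
    difference between the walks started at x and at x + h is then controlled
    by differences of consecutive binomial coefficients, that is by 1 / sqrt n
    ([walk_decay]).  The translations h that admit such a bound form a group;
    a pigeonhole argument on the translates of E by v / q ^ i puts enough
    multiples of an arbitrary v into this group to reach v itself
    ([decays_all]).  Splitting the time as t = n t0 + r gives the bound
    C / sqrt t ([levy_var_decay]).

    From a coupling to an absolutely continuous component.  Suppose that the
    law of X_K is singular for every K > 0, and couple a process Y started at
    0 with a process Z started uniformly in a cube.  At time K the law of Y is
    carried by a Lebesgue-null set N, to which the law of Z, being absolutely
    continuous, gives no mass.  Take F closed in N and U open around N, with
    the laws of Y_K and Z_K giving little mass to the complement of F and to U
    respectively.  The martingale Q_(K-t)(Y_t, complement of F) has a small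
    mean, so it rarely exceeds 1/3, and the same holds for Q_(K-t)(Z_t, U).
    Where neither does, Y_t = Z_t would leave the whole space, covered by U
    and the complement of F, with probability at most 2/3.  So Y and Z almost
    surely do not meet before K ([no_hitting]), and a successful coupling
    cannot exist ([ac_component_of_coupling]).

    From an absolutely continuous component to a coupling.  Let Y and Z be
    Markov processes with the two given initial laws, on two probability
    spaces.  By the rate of decay and dominated convergence, the laws of Y_t
    and Z_t are uniformly close at late times ([marginals_close]).  At such a
    time, match the common part of the laws of what has not been matched yet;
    by the Markov property matched parts keep equal laws, so this can be
    repeated, and it exhausts the mass ([greedy_matching]).  To realise the
    matching on one space, keep Y and add an independent uniform variable,
    which first selects a stage of the matching, then samples the whole path
    of Z from its conditional law given its place at that stage.  For the
    sampling, a path is coded by a real number ([path_code]) whose conditional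
    distribution functions are inverted ([randomized_code]).  Every real
    decodes to a cadlag path ([decoded_path_cadlag]), and the decoded process
    has the law of Z and is at the place of Y at the time of the stage
    ([successful_coupling]). *)

Local Notation image_measure :=
  measure_function_pushforward__canonical__measure_function_Measure.

(** * Independence of the past and of increments *)

Lemma measurable_preimageT {d1 : measure_display} {T : measurableType d1}
    {d2 : measure_display} {T' : measurableType d2}
    (f : T -> T') (A : set T') :
  measurable_fun [set: T] f -> measurable A -> measurable (f @^-1` A).
Proof. by move=> mf mA; have := mf measurableT _ mA; rewrite setTI. Qed.

Section rV_measurability.
Context {R : realType} {n : nat} {d1 : measure_display} {T : measurableType d1}.
Implicit Types f g : T -> 'rV[R]_n.

Lemma measurable_rVD f g : measurable_fun [set: T] f ->
  measurable_fun [set: T] g -> measurable_fun [set: T] (fun x => f x + g x).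
Proof.
move=> /rV_measurable_funP mf /rV_measurable_funP mg.
apply/rV_measurable_funP => i; under eq_fun do rewrite mxE.
exact: measurable_funD.
Qed.

Lemma measurable_rVN f : measurable_fun [set: T] f ->
  measurable_fun [set: T] (fun x => - f x).
Proof.
move=> /rV_measurable_funP mf; apply/rV_measurable_funP => i.
under eq_fun do rewrite mxE.
exact: measurableT_comp (mf i).
Qed.

Lemma measurable_rVB f g : measurable_fun [set: T] f ->
  measurable_fun [set: T] g -> measurable_fun [set: T] (fun x => f x - g x).
Proof. by move=> mf mg; apply: measurable_rVD => //; exact: measurable_rVN. Qed.

End rV_measurability.

Lemma open_measurable_rV {R : realType} {n : nat} (U : set 'rV[R]_n) :
  open U -> measurable U.
Proof. by move=> oU; exact: sub_sigma_algebra. Qed.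

(** The pi-lambda theorem; the constant sequence [setT] serves as exhaustion. *)
Lemma finite_measure_eq {R : realType} {d} {T : measurableType d}
    (G : set (set T)) (m1 m2 : {measure set T -> \bar R}) :
  G `<=` measurable -> setI_closed G -> G setT -> (m1 setT < +oo)%E ->
  (forall A, G A -> m1 A = m2 A) -> forall A, <<s G >> A -> m1 A = m2 A.
Proof.
move=> Gm GI GT m1T m12.
apply: (g_sigma_algebra_measure_unique _ Gm (fun=> setT)) => //.
by rewrite bigcup_const//; exists 0%N.
Qed.

Section independence.
Context {R : realType} {d} {T : measurableType d} (P : probability T R).

(** Both A -> P (A & C) and A -> P A * P C are finite measures, to which the
    pi-lambda theorem applies. *)
Lemma indep_event_sigma (G : set (set T)) (C : set T) :
  G `<=` measurable -> setI_closed G -> G setT -> measurable C ->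
  (forall A, G A -> P (A `&` C) = P A * P C)%E ->
  forall A, <<s G >> A -> P (A `&` C) = (P A * P C)%E.
Proof.
move=> Gm GI GT mC PG A sA.
have Cf : P C \is a fin_num by exact: fin_num_measure.
have c0 : 0 <= fine (P C) by exact: fine_ge0.
pose m2 : {measure set T -> \bar R} := mscale (NngNum c0) P.
have m2E B : m2 B = (P B * P C)%E.
  by rewrite /m2/= /mscale/= fineK// muleC.
have := @finite_measure_eq _ _ _ G (mrestr P mC) m2 Gm GI GT.
move=> /(_ _ _ A sA); rewrite m2E; apply.
  by change (P (setT `&` C) < +oo)%E; rewrite setTI ltey_eq Cf.
by move=> B GB; rewrite m2E; exact: PG.
Qed.

End independence.

Section levy_basics.
Context {R : realType} {d : nat} {d0 : measure_display} {Om : measurableType d0}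
  {P : probability Om R}.
Variable X : R -> {RV P >-> 'rV[R]_d}.

Lemma measurable_increment s t : measurable_fun setT (increment X s t).
Proof. exact: measurable_rVB. Qed.

(** The position X 0 vanishes only almost surely, whereas a coupling constrains
    every path; the increments from time 0 are used in place of X. *)
Definition centered (t : R) : Om -> 'rV[R]_d := increment X 0 t.

HB.instance Definition _ t :=
  isMeasurableFun.Build _ _ _ _ (centered t) (measurable_increment 0 t).

Definition centered_RV (t : R) : {RV P >-> 'rV[R]_d} := centered t.

Hypothesis hX : levy_process X.

(** Independence of increments concerns finitely many times, so the past is
    first replaced by the past at finitely many times. *)
Definition finite_past (us : seq R) : set (set Om) :=
  \bigcup_(u in [set` us]) preimage_set_system setT (centered u) measurable.

(** The events in the product rule for consecutive increments form a pi-system,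
    and the position at each of the times is measurable for the sigma-algebra
    that they generate. *)
Definition increment_events (n : nat) (t : nat -> R) : set (set Om) :=
  [set \bigcap_(i < n) (increment X (t i) (t i.+1) @^-1` A i) |
    A in [set A : nat -> set 'rV[R]_d | forall i, measurable (A i)]].

Lemma increment_eventsI n t : setI_closed (increment_events n t).
Proof.
move=> _ _ [A mA <-] [B mB <-]; exists (fun i => A i `&` B i).
  by move=> i; exact: measurableI.
by apply/seteqP; split=> w /= h; [split=> i ni; have [] := h i ni|
  move=> i ni; split; [exact: h.1|exact: h.2]].
Qed.

Lemma increment_events_measurable n t : increment_events n t `<=` measurable.
Proof.
move=> _ [A mA <-]; apply: fin_bigcap_measurable; first exact: finite_II.
by move=> i _; apply: measurable_preimageT; [exact: measurable_increment|].
Qed.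

Lemma increment_eventsT n t : increment_events n t setT.
Proof.
exists (fun=> setT) => //.
by apply/seteqP; split.
Qed.

Lemma increment_events_indep n (t : nat -> R) (A : set 'rV[R]_d) :
  0 <= t 0%N -> (forall i, (i <= n)%N -> t i <= t i.+1) -> measurable A ->
  forall B, <<s increment_events n t >> B ->
  (P (B `&` increment X (t n) (t n.+1) @^-1` A) =
   P B * P (increment X (t n) (t n.+1) @^-1` A))%E.
Proof.
move=> t0 tmono mA; apply: indep_event_sigma.
- exact: increment_events_measurable.
- exact: increment_eventsI.
- exact: increment_eventsT.
- by apply: measurable_preimageT => //; exact: measurable_increment.
move=> _ [C mC <-]; pose D i := if (i < n)%N then C i else A.
have mD i : measurable (D i) by rewrite /D; case: ifP.
have Dn : D n = A by rewrite /D ltnn.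
have DC i : (i < n)%N -> D i = C i by rewrite /D => ->.
have := levy_independent hX (n := n.+1) t0 (fun i ni => tmono i ni) mD.
rewrite big_ord_recr/= Dn.
rewrite (_ : \bigcap_(i < n.+1) _ = (\bigcap_(i < n)
    (increment X (t i) (t i.+1) @^-1` D i)) `&`
    increment X (t n) (t n.+1) @^-1` D n); last first.
  apply/seteqP; split=> w /= h; first by split=> [i /= ni|]; apply: h => /=; lia.
  move=> i /=; rewrite ltnS leq_eqVlt => /predU1P[->|]; first exact: h.2.
  exact: h.1.
rewrite Dn.
rewrite (_ : \bigcap_(i < n) _ =
    \bigcap_(i < n) (increment X (t i) (t i.+1) @^-1` C i)).
  move=> ->; congr (_ * _)%E.
  rewrite (levy_independent hX t0 (fun i ni => tmono i (ltnW ni)) mC).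
  by apply: eq_bigr => -[i ni] _; rewrite DC.
by apply: eq_bigcapr => i /= ni; rewrite DC.
Qed.

Lemma measurable_centered_increments n (t : nat -> R) : t 0%N = 0 ->
  forall j, (j <= n)%N ->
  @measurable_fun _ _ (g_sigma_algebraType (increment_events n t)) 'rV[R]_d
    setT (centered (t j)).
Proof.
move=> t0; elim=> [_|j IH jn].
  rewrite (_ : centered (t 0%N) = cst 0); first exact: measurable_cst.
  by apply/funext => w; rewrite /centered/increment t0 subrr.
rewrite (_ : centered (t j.+1) =
    fun w => centered (t j) w + increment X (t j) (t j.+1) w).
  apply: (@measurable_rVD _ _ _ (g_sigma_algebraType (increment_events n t))).
    exact: (IH (ltnW jn)).
  move=> _ A mA; rewrite setTI; apply: sub_sigma_algebra.
  exists (fun i => if i == j then A else setT); first by move=> i; case: ifP.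
  apply/seteqP; split=> w /=; first by move=> /(_ j jn); rewrite eqxx.
  by move=> Aw i ni; case: eqP => // ->.
by apply/funext => w; rewrite /centered /increment [RHS]addrC subrKA.
Qed.

(** Once sorted, the times and 0 start a partition that ends with s and s + t;
    the past positions are sums of its earlier increments. *)
Lemma finite_past_indep (us : seq R) s t A B :
  (forall u, u \in us -> 0 <= u <= s) -> 0 <= s -> 0 <= t -> measurable A ->
  <<s finite_past us >> B ->
  (P (B `&` increment X s (s + t) @^-1` A) =
   P B * P (increment X s (s + t) @^-1` A))%E.
Proof.
move=> us0 s0 t0 mA sB.
pose S := sort <=%R us; pose ts := 0 :: rcons S s.
pose tt i := nth (s + t) ts i; pose N := (size us).+1.
have szts : size ts = N.+1 by rewrite /= size_rcons size_sort.
have usS u : (u \in S) = (u \in us) by rewrite mem_sort.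
have sts : sorted <=%R ts.
  rewrite /= rcons_path path_sortedE; last exact: le_trans.
  rewrite (sort_sorted le_total) andbT; apply/andP; split.
    by apply/allP => u; rewrite usS => /us0/andP[].
  have := mem_last 0 S; rewrite inE => /predU1P[->//|].
  by rewrite usS => /us0/andP[].
have ttN : tt N = s by rewrite /tt/= nth_rcons size_sort ltnn eqxx.
have ttN1 : tt N.+1 = s + t by rewrite /tt nth_default ?szts.
have := @increment_events_indep N tt A _ _ mA B; rewrite ttN ttN1; apply => //.
  move=> i; rewrite leq_eqVlt => /predU1P[->|iN].
    by rewrite ttN ttN1 lerDl.
  by move/sortedP : sts; apply; rewrite szts ltnS.
move: sB; apply: smallest_sub; first exact: smallest_sigma_algebra.
move=> _ [u /= uus [C mC <-]]; rewrite setTI.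
pose j := index u ts.
have uts : u \in ts by rewrite inE mem_rcons inE usS uus !orbT.
have jN : (j <= N)%N by rewrite -ltnS -szts index_mem.
have -> : u = tt j by rewrite /tt nth_index.
have := @measurable_centered_increments N tt erefl j jN measurableT C mC.
by rewrite setTI.
Qed.

Lemma finite_past_measurable us : <<s finite_past us >> `<=` measurable.
Proof.
apply: smallest_sub; first exact: sigma_algebra_measurable.
move=> _ [u _ [C mC <-]]; rewrite setTI.
by apply: measurable_preimageT.
Qed.

(** The sigma-algebras of the pasts at finitely many times are directed, so
    their union is a pi-system; it generates the past. *)
Lemma past_increment_indep s t A B : 0 <= s -> 0 <= t -> measurable A ->
  past_events centered_RV s B ->
  (P (B `&` increment X s (s + t) @^-1` A) =
   P B * P (increment X s (s + t) @^-1` A))%E.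
Proof.
move=> s0 t0 mA pB.
pose G := [set B | exists2 us : seq R, (forall u, u \in us -> 0 <= u <= s) &
  <<s finite_past us >> B].
have finS us vs : {subset us <= vs} -> finite_past us `<=` finite_past vs.
  by move=> uv C [u /= uus HC]; exists u => //=; exact: uv.
apply: (indep_event_sigma (G := G)).
- by move=> C [us _ /finite_past_measurable].
- move=> C D [us us0 sC] [vs vs0 sD]; exists (us ++ vs).
    by move=> u; rewrite mem_cat => /orP[/us0|/vs0].
  have := @measurableI _ (g_sigma_algebraType (finite_past (us ++ vs))).
  apply; apply: sub_sigma_algebra2; try eassumption; apply: finS => u uu.
    by rewrite mem_cat uu.
  by rewrite mem_cat uu orbT.
- exists [::] => //.
  exact: (@measurableT _ (g_sigma_algebraType (finite_past [::]))).
- by apply: measurable_preimageT => //; exact: measurable_increment.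
- by move=> C [us us0 sC]; exact: finite_past_indep sC.
move: pB; apply: sub_sigma_algebra2 => C [u /=]; rewrite in_itv/= => us HC.
exists [:: u]; first by move=> v; rewrite inE => /eqP ->.
by apply: sub_sigma_algebra; exists u => //=; rewrite inE.
Qed.

End levy_basics.

(** * Levy processes started from a given law *)

Lemma ae_measure_eq {R : realType} {d} {T : measurableType d}
    (P : {measure set T -> \bar R}) (A B : set T) :
  measurable A -> measurable B -> {ae P, forall w, A w <-> B w} -> P A = P B.
Proof.
move=> mA mB [N [mN PN0 AB]].
suff le C D : measurable C -> measurable D -> (C `<=` D `|` N) ->
    (P C <= P D)%E.
  apply/eqP; rewrite eq_le; apply/andP; split; apply: le => // w Cw.
    have [|nN] := pselect (N w); first by right.
    by left; apply/(_ : A w <-> B w).1 => //; apply: contra_notP nN => h; exact: AB.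
  have [|nN] := pselect (N w); first by right.
  by left; apply/(_ : A w <-> B w).2 => //; apply: contra_notP nN => h; exact: AB.
move=> mC mD CD; apply: (@le_trans _ _ (P (D `|` N))).
  by apply: le_measure; rewrite ?inE//; exact: measurableU.
apply: (le_trans (measureU2 _ mD mN)).
by rewrite -[leRHS]adde0; apply: leeD => //; rewrite le_eqVlt; apply/orP; left; exact/eqP.
Qed.

Section indep_markov.
Context {R : realType} {d : nat} {d0} {T : measurableType d0}
  (P : probability T R).
Variables (G : set (set T)) (V xi : T -> 'rV[R]_d).
Hypothesis Gm : G `<=` measurable.
Hypothesis mxi : measurable_fun setT xi.
Hypothesis indep : forall A B, measurable A -> <<s G >> B ->
  (P (B `&` xi @^-1` A) = P B * P (xi @^-1` A))%E.
Hypothesis mV : @measurable_fun _ _ (g_sigma_algebraType G) 'rV[R]_d setT V.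

Let TG : measurableType _ := g_sigma_algebraType G.

Let sGm : <<s G >> `<=` measurable.
Proof. by apply: smallest_sub Gm; exact: sigma_algebra_measurable. Qed.

Let idG (w : T) : TG := w.

Let midG : measurable_fun setT idG.
Proof. by move=> _ B mB; rewrite setTI; exact: sGm. Qed.

HB.instance Definition _ := isMeasurableFun.Build _ _ T TG idG midG.
HB.instance Definition _ := isMeasurableFun.Build _ _ _ _ xi mxi.

Let PG : probability TG R := distribution P idG.
Let rho : probability 'rV[R]_d R := distribution P xi.

Let pairG (w : T) : TG * 'rV[R]_d := (w : TG, xi w).

Let mpairG : measurable_fun setT pairG.
Proof. by apply: measurable_fun_pair; [exact: midG|exact: mxi]. Qed.

HB.instance Definition _ := isMeasurableFun.Build _ _ _ _ pairG mpairG.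

(** Freezing: the past and [xi] have a product joint law, so by Fubini the past
    may be held fixed while [xi] is averaged. *)
Lemma indep_markov A B : measurable A -> <<s G >> B ->
  (P (B `&` (fun w => V w + xi w)%R @^-1` A) =
   \int[P]_(w in B) P ((fun w' => V w + xi w')%R @^-1` A))%E.
Proof.
move=> mA sB.
pose S : set (TG * 'rV[R]_d) := [set p | B p.1 /\ A (V p.1 + p.2)].
have mVp : measurable_fun setT (fun p : TG * 'rV[R]_d => V p.1 + p.2).
  apply: measurable_rVD => //.
  move=> _ C mC; have mVC : <<s G >> (V @^-1` C) by rewrite -[X in <<s G >> X]setTI; exact: mV.
  exact: (@measurable_fst _ _ TG 'rV[R]_d measurableT _ mVC).
have mS : measurable S.
  apply: measurableI; last exact: measurable_preimageT.
  by apply: (measurable_preimageT measurable_fst).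
have -> : P (B `&` (fun w => V w + xi w) @^-1` A) = distribution P pairG S by [].
rewrite -(@product_measure_unique _ _ _ _ _ PG rho)//; last first.
  move=> B' A' mB' mA'; rewrite /= /pushforward/=.
  exact: indep.
rewrite /product_measure1 ge0_integral_pushforward//; last first.
  exact: measurable_fun_xsection.
rewrite [RHS]integral_mkcond; apply: eq_integral => w _.
rewrite /= patchE /pushforward; case: ifPn => [/set_mem|/negP] Bw.
  congr (P _); apply/seteqP; split=> w' /=.
    by rewrite /xsection/= inE => -[].
  by move=> Aw; rewrite /xsection/= inE.
rewrite (_ : xsection S (idG w) = set0) ?measure0//.
apply/seteqP; split=> w' //=; rewrite /xsection/= inE => -[/= Bw' _].
by apply: Bw; exact/mem_set.
Qed.

End indep_markov.

Section started_process.
Context {R : realType} {d : nat} {d0 : measure_display} {Om : measurableType d0}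
  {P : probability Om R}.
Variable X : R -> {RV P >-> 'rV[R]_d}.
Hypothesis hX : levy_process X.
Hypothesis hX0 : {ae P, forall w, X 0 w = 0}.
Local Notation Q := (levy_transition X).

Lemma measurable_shift_preimage (x : 'rV[R]_d) d1 (T : measurableType d1)
    (f : T -> 'rV[R]_d) (A : set 'rV[R]_d) :
  measurable_fun setT f -> measurable A ->
  measurable ((fun w => x + f w) @^-1` A).
Proof. by move=> mf mA; apply: measurable_preimageT => //; exact: measurable_rVD. Qed.

Lemma transition_centered t x A : measurable A ->
  P ((fun w => x + centered X t w) @^-1` A) = Q t x A.
Proof.
move=> mA; apply: ae_measure_eq; [exact: measurable_shift_preimage..|].
by apply: filterS hX0 => w; rewrite /= /centered /increment => ->; rewrite subr0.
Qed.

Lemma transition_increment s t x A : 0 <= s -> 0 <= t -> measurable A ->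
  P ((fun w => x + increment X s (s + t) w) @^-1` A) = Q t x A.
Proof.
move=> s0 t0 mA; rewrite -transition_centered//.
have mxA : measurable ((fun z : 'rV[R]_d => x + z) @^-1` A).
  by apply: measurable_shift_preimage => //; exact: measurable_id.
exact: (levy_stationary hX s0 t0 mxA).
Qed.

Lemma measurable_transition t A : measurable A ->
  measurable_fun setT (fun x => Q t x A).
Proof.
move=> mA.
pose S : set ('rV[R]_d * Om) := [set p | A (p.1 + X t p.2)].
have mS : measurable S.
  apply: measurable_preimageT => //; apply: measurable_rVD => //.
  exact: (measurableT_comp (measurable_funP (X t))).
rewrite (_ : (fun _ => _) = P \o xsection S); first exact: measurable_fun_xsection.
by apply/funext => x; congr (P _); apply/seteqP; split=> w /=;
  rewrite /xsection/= inE.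
Qed.

Definition start_prob (mu : probability 'rV[R]_d R) :
  probability ('rV[R]_d * Om)%type R := (mu \x P)%E.

Definition started (t : R) (p : 'rV[R]_d * Om) : 'rV[R]_d :=
  p.1 + centered X t p.2.

Lemma measurable_started t : measurable_fun setT (started t).
Proof.
apply: measurable_rVD => //.
exact: (measurableT_comp (measurable_increment X 0 t)).
Qed.

HB.instance Definition _ t :=
  isMeasurableFun.Build _ _ _ _ (started t) (measurable_started t).

Definition started_RV mu (t : R) : {RV (start_prob mu) >-> 'rV[R]_d} := started t.

Definition past_gen {d1} {T : measurableType d1} {P1 : probability T R}
  (Y : R -> {RV P1 >-> 'rV[R]_d}) (s : R) : set (set T) :=
  \bigcup_(u in `[0, s]) preimage_set_system setT (Y u) measurable.

Lemma past_gen_measurable {d1} {T : measurableType d1} {P1 : probability T R}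
  (Y : R -> {RV P1 >-> 'rV[R]_d}) (s : R) : past_gen Y s `<=` measurable.
Proof. by move=> _ [u _ [C mC <-]]; rewrite setTI; apply: measurable_preimageT. Qed.

(** With its starting point fixed, the started process is a translate of
    [centered_RV]. *)
Lemma past_events_section mu s B x : past_events (started_RV mu) s B ->
  past_events (centered_RV X) s (xsection B x).
Proof.
rewrite xsectionE.
suff : past_events (started_RV mu) s `<=`
    image_set_system setT (fun w : Om => (x, w)) (past_events (centered_RV X) s).
  by move=> /(_ B) h /h; rewrite /image_set_system/= setTI.
apply: smallest_sub.
  by apply: sigma_algebra_image; exact: smallest_sigma_algebra.
move=> _ [u us [C mC <-]]; rewrite /image_set_system/= !setTI.
apply: sub_sigma_algebra; exists u => //.
exists ((fun z : 'rV[R]_d => x + z) @^-1` C); last by rewrite setTI.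
by apply: measurable_shift_preimage => //; exact: measurable_id.
Qed.

(** The increment after s is independent of the past of the started process, as
    one sees on sections at a fixed starting point; then freeze the past. *)
Lemma started_markov mu : markov_process Q (started_RV mu).
Proof.
move=> s t A B s0 t0 mA pB.
pose xi (p : 'rV[R]_d * Om) := increment X s (s + t) p.2.
have mxi : measurable_fun setT xi.
  exact: (measurableT_comp (measurable_increment X s (s + t))).
have pB' : past_events (started_RV mu) s `<=` measurable.
  apply: smallest_sub; first exact: sigma_algebra_measurable.
  exact: past_gen_measurable.
have ind C D : measurable C -> <<s past_gen (started_RV mu) s >> D ->
  (start_prob mu (D `&` xi @^-1` C) = start_prob mu D * start_prob mu (xi @^-1` C))%E.
  move=> mC sD.
  have mxC : measurable (increment X s (s + t) @^-1` C).
    by apply: measurable_preimageT => //; exact: measurable_increment.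
  have mD : measurable D by exact: pB'.
  have -> : start_prob mu (xi @^-1` C) = P (increment X s (s + t) @^-1` C).
    rewrite (_ : xi @^-1` C = setT `*` increment X s (s + t) @^-1` C); last first.
      by apply/seteqP; split=> p //= -[].
    rewrite /start_prob/= product_measure1E//.
    by rewrite -[RHS]mul1e; congr (_ * _)%E; exact: probability_setT.
  rewrite /start_prob/= /product_measure1 -ge0_integralZr//; last first.
    exact: measurable_fun_xsection.
  apply: eq_integral => x _ /=.
  rewrite -(past_increment_indep hX)//; last exact: past_events_section sD.
  by congr (P _); apply/seteqP; split=> w /=; rewrite /xsection/= !inE.
have mVs : @measurable_fun _ _ (g_sigma_algebraType (past_gen (started_RV mu) s))
    'rV[R]_d setT (started s).
  move=> _ C mC; apply: sub_sigma_algebra; exists s; first by rewrite /= in_itv/= s0 lexx.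
  by exists C.
have := @indep_markov _ _ _ _ (start_prob mu) _ (started s) xi
  (@past_gen_measurable _ _ _ (started_RV mu) s) mxi ind mVs A B mA pB.
rewrite (_ : (fun w => started s w + xi w) = started (s + t)); last first.
  by apply/funext => p; rewrite /started/xi/centered/increment -addrA [X in _ + X]addrC subrKA.
move=> ->; apply: eq_integral => p _.
rewrite -(transition_increment _ s0 t0 mA).
rewrite (_ : (fun _ => _) @^-1` A = setT `*`
   ((fun w => started s p + increment X s (s + t) w) @^-1` A)); last first.
  by apply/seteqP; split=> q //= -[].
rewrite /start_prob/= product_measure1E//; last first.
  by apply: measurable_shift_preimage => //; exact: measurable_increment.
by rewrite -[RHS]mul1e; congr (_ * _)%E; exact: probability_setT.
Qed.

Lemma started_cadlag (p : 'rV[R]_d * Om) : cadlag (started ^~ p).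
Proof.
have [r l] := levy_cadlag hX p.2; split=> [t t0|t t0].
  rewrite /started/centered/increment; apply: cvgD; first exact: cvg_cst.
  by apply: cvgB; [exact: r|exact: cvg_cst].
apply/cvg_ex; have /cvg_ex[y ly] := l t t0.
exists (p.1 + (y - X 0 p.2)); rewrite /started/centered/increment.
apply: cvgD; first exact: cvg_cst.
by apply: cvgB; [exact: ly|exact: cvg_cst].
Qed.

Lemma started_initial mu : initial_distribution (started_RV mu) mu.
Proof.
move=> A mA; rewrite /distribution/pushforward/=.
rewrite (_ : started 0 @^-1` A = A `*` setT).
  rewrite /start_prob/= product_measure1E//.
  by rewrite -[RHS]mule1; congr (_ * _)%E; exact: probability_setT.
by apply/seteqP; split=> p /=; rewrite /started/centered/increment subrr addr0// => -[].
Qed.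

End started_process.

(** * Differences of binomial averages *)

Section symmetric_walk.
Context {R : realType} {V : zmodType} (h : V).
Implicit Types (f : V -> R) (x : V).

(** The binomial average of f along x, x + h, ..., x + k h, that is the sum
    over j of C(k, j) f (x + j h). *)
Fixpoint smear (k : nat) f x : R :=
  if k is k'.+1 then smear k' f x + smear k' f (x + h) else f x.

Definition smear_diff k f x := smear k f x - smear k f (x + h).

(** The same average weighted by the position of a symmetric walk started at s:
    the sum over j of C(k, j) (s + k - 2 j) f (x + j h). *)
Fixpoint drift_smear (k : nat) f (s : R) x : R :=
  if k is k'.+1 then drift_smear k' f (s + 1) x + drift_smear k' f (s - 1) (x + h)
  else s * f x.

Lemma smearS k f x : smear k (fun y => f y + f (y + h)) x = smear k.+1 f x.
Proof. by elim: k x => //= k IH x; rewrite !IH. Qed.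

Lemma smear_diffD k f g x :
  smear_diff k (fun y => f y + g y) x = smear_diff k f x + smear_diff k g x.
Proof.
rewrite /smear_diff; suff E y :
  smear k (fun y => f y + g y) y = smear k f y + smear k g y by rewrite !E; ring.
by elim: k y => //= k IH y; rewrite !IH addrACA.
Qed.

Lemma smear_diffS k f x :
  smear_diff k (fun y => f y + f (y + h)) x = smear_diff k.+1 f x.
Proof. by rewrite /smear_diff !smearS. Qed.

Lemma drift_smearE k f s x :
  drift_smear k f s x = s * smear k f x + drift_smear k f 0 x.
Proof.
elim: k s x => [|k IH] s x /=; first by rewrite mul0r addr0.
rewrite (IH (s + 1)) (IH (s - 1)) (IH (0 + 1)) (IH (0 - 1)); ring.
Qed.

(** This is (k + 1) (C(k, j) - C(k, j - 1)) = (k + 1 - 2 j) C(k + 1, j), summed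
    against f: a difference of binomial averages is an average of the position
    of the walk. *)
Lemma drift_smear_diff k f x :
  drift_smear k.+1 f 0 x = k.+1%:R * smear_diff k f x.
Proof.
elim: k x => [|k IH] x; first by rewrite /= /smear_diff /=; ring.
rewrite [LHS]/= -/(drift_smear k.+1 f (0 + 1) x).
rewrite -/(drift_smear k.+1 f (0 - 1) (x + h)).
rewrite (drift_smearE _ _ (0 + 1)) (drift_smearE _ _ (0 - 1)) !IH.
rewrite [in RHS]/smear_diff /= /smear_diff -[k.+2]addn1 natrD; ring.
Qed.

(** From 2 |u| <= u ^ 2 / th + th, the first absolute moment of the position is
    bounded by the second moment, which grows by 1 at each step. *)
Lemma drift_smear_bound k f (s : R) x (M th : R) : 0 < th -> (forall y, `|f y| <= M) ->
  `|drift_smear k f s x| <= M * 2 ^+ k * ((s ^+ 2 + k%:R) / th + th) / 2.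
Proof.
move=> th0 fM; have M0 : 0 <= M by rewrite (le_trans _ (fM x)).
elim: k s x => [|k IH] s x.
  rewrite /= expr0 mulr1 addr0 normrM mulrC -mulrA ler_pM//.
  rewrite ler_pdivlMr//; have := sqr_ge0 (`|s| - th).
  rewrite -[s ^+ 2]real_normK ?num_real//.
  rewrite -(ler_pM2r th0) mul0r => H.
  rewrite -(ler_pM2r th0) mulrDl divfK ?gt_eqF//.
  have := sqr_ge0 (`|s| - th); rewrite sqrrB => ?; lra.
rewrite [drift_smear _ _ _ _]/= (le_trans (ler_normD _ _))//.
apply: (le_trans (lerD (IH _ _) (IH _ _))).
rewrite le_eqVlt; apply/orP; left; apply/eqP.
by rewrite [2 ^+ k.+1]exprS -[k.+1]addn1 natrD; field; rewrite gt_eqF.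
Qed.

(** The threshold sqrt (k + 1), which is the standard deviation, balances the
    two terms of [drift_smear_bound]. *)
Lemma smear_diff_bound k f x (M : R) : (forall y, `|f y| <= M) ->
  `|smear_diff k f x| <= 2 * M * 2 ^+ k / Num.sqrt k.+1%:R.
Proof.
move=> fM; have k0 : 0 < k.+1%:R :> R by [].
have s0 : 0 < Num.sqrt k.+1%:R :> R by rewrite sqrtr_gt0.
have := @drift_smear_bound k.+1 f 0 x M _ s0 fM.
rewrite drift_smear_diff normrM ger0_norm// expr0n/= add0r.
rewrite -{2}[k.+1%:R]sqr_sqrtr// {1}expr2 mulfK ?gt_eqF// => H.
rewrite -(ler_pM2l k0) (le_trans H)// le_eqVlt; apply/orP; left; apply/eqP.
rewrite -{3}[k.+1%:R]sqr_sqrtr// exprS; field; by rewrite gt_eqF.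
Qed.

End symmetric_walk.

(** By convexity of the square this reduces to p / (y + 1) + (1 - p) / y <= 1 /
    (y + p / 2). It is the inductive step of [walk_decay]. *)
Lemma sqrt_convex_step {R : realType} (p y : R) : 0 <= p <= 1 -> 1 <= y ->
  p / Num.sqrt (y + 1) + (1 - p) / Num.sqrt y <= (Num.sqrt (y + p / 2))^-1.
Proof.
move=> /andP[p0 p1] y1.
set a := (Num.sqrt (y + 1))^-1; set b := (Num.sqrt y)^-1.
have y0 : 0 < y by lra.
have a2 : a ^+ 2 = (y + 1)^-1 by rewrite exprVn sqr_sqrtr//; lra.
have b2 : b ^+ 2 = y^-1 by rewrite exprVn sqr_sqrtr//; lra.
have a0 : 0 <= a by rewrite invr_ge0 sqrtr_ge0.
have b0 : 0 <= b by rewrite invr_ge0 sqrtr_ge0.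
have L0 : 0 <= p * a + (1 - p) * b by rewrite addr_ge0// mulr_ge0//; lra.
rewrite -[leLHS](ger0_norm L0) -sqrtr_sqr -sqrtrV; last lra.
rewrite ler_wsqrtr//.
apply: (@le_trans _ _ (p * a ^+ 2 + (1 - p) * b ^+ 2)).
  rewrite -subr_ge0 (_ : _ - _ = p * (1 - p) * (a - b) ^+ 2); last by ring.
  by rewrite mulr_ge0 ?sqr_ge0// mulr_ge0//; lra.
rewrite a2 b2 -subr_ge0.
rewrite (_ : _ - _ = (p * y / 2 - p * (1 - p) / 2) / (y * (y + 1) * (y + p / 2))).
  rewrite divr_ge0//; last by rewrite !mulr_ge0//; lra.
  by rewrite subr_ge0 ler_pM2r// ler_wpM2l//; lra.
by field; rewrite !gt_eqF//=; lra.
Qed.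

Import HBNNSimple.

(** * Integrals of bounded functions *)

Section measure_domination.
Context {R : realType} {d} {T : measurableType d}.
Local Open Scope ereal_scope.

Lemma ge0_le_integral_measure (m1 m2 : {measure set T -> \bar R}) (f : T -> \bar R) :
  (forall A, measurable A -> m1 A <= m2 A) -> (forall x, 0 <= f x) ->
  \int[m1]_x f x <= \int[m2]_x f x.
Proof.
move=> m12 f0; rewrite !ge0_integralTE//; apply: ge_ereal_sup => _ /= [h hf <-].
apply: (@le_trans _ _ (sintegral m2 h)).
  rewrite !sintegralE; apply: lee_fsum => // r [x _ <-].
  by apply: lee_wpmul2l; [rewrite lee_fin|exact: m12].
by apply: ereal_sup_ubound; exists h.
Qed.

End measure_domination.

Section bounded_integrals.
Context {R : realType} {d} {T : measurableType d}.
Variable m : {finite_measure set T -> \bar R}.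
Implicit Types f g : T -> R.

Lemma bounded_integrable f (M : R) : measurable_fun setT f ->
  (forall x, `|f x| <= M) -> m.-integrable setT (EFin \o f).
Proof.
move=> mf fM; apply: measurable_bounded_integrable => //.
  by rewrite ltey_eq fin_num_measure.
exists M; split; first exact: num_real.
by move=> y My x _ /=; rewrite (le_trans (fM x))// ltW.
Qed.

Lemma Rintegral_bound f (M : R) : measurable_fun setT f ->
  (forall x, `|f x| <= M) -> `|\int[m]_x f x| <= M * fine (m setT).
Proof.
move=> mf fM; apply: (le_trans (le_normr_Rintegral _ (bounded_integrable mf fM))) => //.
rewrite -Rintegral_cst//; apply: le_Rintegral => //.
- apply: (@bounded_integrable _ M); first exact: measurableT_comp.
  by move=> x; rewrite normr_id.
- by apply: (@bounded_integrable _ `|M|).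
Qed.

End bounded_integrals.

(** The defect m - a - b is only known as a nonnegative set function; testing
    it on M + f and on M - f avoids making a measure of it. *)
Lemma Rintegral_domination {R : realType} {d} {T : measurableType d}
    (m a b : {finite_measure set T -> \bar R}) (f : T -> R) (M : R) :
  (forall A, measurable A -> a A + b A <= m A)%E ->
  measurable_fun setT f -> (forall x, `|f x| <= M) ->
  `|\int[m]_x f x - \int[a]_x f x - \int[b]_x f x| <=
   M * (fine (m setT) - fine (a setT) - fine (b setT)).
Proof.
move=> abm mf fM.
have pos (g : T -> R) : measurable_fun setT g -> (forall x, 0 <= g x) ->
    (exists K, forall x, `|g x| <= K) ->
    \int[a]_x g x + \int[b]_x g x <= \int[m]_x g x.
  move=> mg g0 [K gK]; rewrite /Rintegral -fineD; last 2 first.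
  - by apply: integrable_fin_num => //; exact: bounded_integrable gK.
  - by apply: integrable_fin_num => //; exact: bounded_integrable gK.
  have mgE : measurable_fun setT (EFin \o g) by exact/measurable_EFinP.
  rewrite -ge0_integral_measure_add//; last by move=> x _; rewrite lee_fin.
  apply: fine_le.
  - rewrite ge0_integral_measure_add//; last by move=> x _; rewrite lee_fin.
    by rewrite fin_numD; apply/andP; split; apply: integrable_fin_num => //;
      exact: bounded_integrable gK.
  - by apply: integrable_fin_num => //; exact: bounded_integrable gK.
  apply: ge0_le_integral_measure; last by move=> x; rewrite lee_fin.
  by move=> A mA; rewrite /= /msum !big_ord_recl big_ord0 /= adde0; exact: abm.
have cM (mu : {finite_measure set T -> \bar R}) : mu.-integrable setT (EFin \o cst M).
  exact: (@bounded_integrable _ _ _ _ _ `|M|).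
have fi (mu : {finite_measure set T -> \bar R}) : mu.-integrable setT (EFin \o f).
  exact: (@bounded_integrable _ _ _ _ _ M).
have mM : measurable_fun setT (cst M : T -> R) by exact: measurable_cst.
have fM' x := ler_normlP _ _ (fM x).
have p1 := pos (fun x => M + f x).
have p2 := pos (fun x => M - f x).
have : \int[a]_x (M + f x) + \int[b]_x (M + f x) <= \int[m]_x (M + f x).
  apply: p1; first exact: measurable_funD.
    by move=> x; have [] := fM' x; lra.
  exists (M + M) => x; rewrite (le_trans (ler_normD _ _))// lerD//.
  by rewrite ger0_norm// (le_trans _ (fM x)).
have : \int[a]_x (M - f x) + \int[b]_x (M - f x) <= \int[m]_x (M - f x).
  apply: p2; first exact: measurable_funB.
    by move=> x; have [] := fM' x; lra.
  exists (M + M) => x; rewrite (le_trans (ler_normB _ _))// lerD//.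
  by rewrite ger0_norm// (le_trans _ (fM x)).
rewrite !(RintegralD measurableT (cM _) (fi _)) !(RintegralB measurableT (cM _) (fi _)).
rewrite !Rintegral_cst// => H1 H2.
by apply/ler_normlP; split; nra.
Qed.

(** * Random walks whose step law contains a measure and its translate *)

Section convolution_operator.
Context {R : realType} {d : nat}.
Implicit Types (m : {finite_measure set 'rV[R]_d -> \bar R}) (f g : 'rV[R]_d -> R)
  (x h : 'rV[R]_d).

Definition bounded_measurable f :=
  measurable_fun setT f /\ exists M : R, forall x, `|f x| <= M.

(** The transition operator of the random walk with step law [m]. *)
Definition conv_op m f (x : 'rV[R]_d) : R := \int[m]_z f (x + z).

Lemma measurable_shift f x : measurable_fun setT f ->
  measurable_fun setT (fun z => f (x + z)).
Proof. by move=> mf; apply: (measurableT_comp mf); exact: measurable_rVD. Qed.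

Lemma conv_op_integrable m f x : bounded_measurable f ->
  m.-integrable setT (EFin \o (fun z => f (x + z))).
Proof.
move=> [mf [M fM]]; apply: (@bounded_integrable _ _ _ _ _ M) => //.
exact: measurable_shift.
Qed.

Lemma conv_op_bound m f (M : R) x : measurable_fun setT f ->
  (forall x, `|f x| <= M) -> `|conv_op m f x| <= M * fine (m setT).
Proof. by move=> mf fM; apply: Rintegral_bound => //; exact: measurable_shift. Qed.

(** Fubini, applied on the product of two copies of [m]. *)
Lemma measurable_conv_op m f : bounded_measurable f ->
  measurable_fun setT (conv_op m f).
Proof.
move=> [mf [M fM]]; pose F (p : 'rV[R]_d * 'rV[R]_d) := (f (p.1 + p.2))%:E.
have mF : measurable_fun setT (fun p : 'rV[R]_d * 'rV[R]_d => f (p.1 + p.2)).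
  by apply: (measurableT_comp mf); exact: measurable_rVD.
have iF : (m \x m)%E.-integrable setT F.
  apply: measurable_bounded_integrable => //.
    have E : (m \x m)%E setT = (m setT * m setT)%E.
      by rewrite -setXTT; exact: product_measure1E.
    have : ((m \x m)%E setT < +oo)%E by rewrite E ltey_eq fin_numM// fin_num_measure.
    by [].
  exists M; split; first exact: num_real.
  by move=> y My x _ /=; rewrite (le_trans (fM _))// ltW.
have := measurable_fubini_F iF.
by move=> /(measurableT_comp (@fine_measurable R _ measurableT)).
Qed.

Lemma conv_op_bmf m f : bounded_measurable f -> bounded_measurable (conv_op m f).
Proof.
move=> bf; split; first exact: measurable_conv_op.
case: bf => mf [M fM]; exists (M * fine (m setT)) => x; exact: conv_op_bound.
Qed.

Lemma bmfD f g : bounded_measurable f -> bounded_measurable g ->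
  bounded_measurable (fun x => f x + g x).
Proof.
move=> [mf [M fM]] [mg [K gK]]; split; first exact: measurable_funD.
by exists (M + K) => x; rewrite (le_trans (ler_normD _ _))// lerD.
Qed.

Lemma bmfN f : bounded_measurable f -> bounded_measurable (fun x => - f x).
Proof.
move=> [mf [M fM]]; split; first exact: measurableT_comp.
by exists M => x; rewrite normrN.
Qed.

Lemma bmf_shift f h : bounded_measurable f -> bounded_measurable (fun x => f (x + h)).
Proof.
move=> [mf [M fM]]; split; last by exists M.
by under eq_fun do rewrite addrC; exact: measurable_shift.
Qed.

Lemma conv_opD m f g : bounded_measurable f -> bounded_measurable g ->
  conv_op m (fun x => f x + g x) = (fun x => conv_op m f x + conv_op m g x).
Proof.
move=> bf bg; apply/funext => x.
by rewrite /conv_op RintegralD//; exact: conv_op_integrable.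
Qed.

Lemma conv_op_shift m f h :
  conv_op m (fun x => f (x + h)) = (fun x => conv_op m f (x + h)).
Proof.
apply/funext => x; apply: eq_Rintegral => z _.
by rewrite -addrA [z + h]addrC addrA.
Qed.

Lemma iter_conv_op_bmf m n f : bounded_measurable f ->
  bounded_measurable (iter n (conv_op m) f).
Proof. by move=> bf; elim: n => //= n; exact: conv_op_bmf. Qed.

Lemma iter_conv_opD m n f g : bounded_measurable f -> bounded_measurable g ->
  iter n (conv_op m) (fun x => f x + g x) =
  (fun x => iter n (conv_op m) f x + iter n (conv_op m) g x).
Proof.
by move=> bf bg; elim: n => //= n ->; rewrite conv_opD//; exact: iter_conv_op_bmf.
Qed.

Lemma iter_conv_op_shift m n f h :
  iter n (conv_op m) (fun x => f (x + h)) = (fun x => iter n (conv_op m) f (x + h)).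
Proof. by elim: n => //= n ->; rewrite conv_op_shift. Qed.

End convolution_operator.

Section walk_decay.
Context {R : realType} {d : nat}.
Variables (m a b : {finite_measure set 'rV[R]_d -> \bar R}) (h : 'rV[R]_d).
Hypothesis m1 : m setT = 1%E.
Hypothesis bE : forall A, measurable A -> b A = a ((fun z => z + h) @^-1` A).
Hypothesis abm : forall A, measurable A -> (a A + b A <= m A)%E.
Let p : R := 2 * fine (a setT).
Local Notation T := (conv_op m).

Lemma shifted_conv_op f x : bounded_measurable f ->
  conv_op b f x = conv_op a f (x + h).
Proof.
move=> bf; rewrite /conv_op /Rintegral; congr fine.
have mh : measurable_fun setT (fun z : 'rV[R]_d => z + h) by exact: measurable_rVD.
pose ah := image_measure a mh.
rewrite (@eq_measure_integral _ _ _ _ ah); last first.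
  by move=> A mA _; exact: bE.
rewrite integral_pushforward//=.
- by apply: eq_integral => z _ /=; rewrite addrA addrAC.
- by apply/measurable_EFinP; apply: measurable_shift; case: bf.
- rewrite (_ : _ \o _ = EFin \o (fun z => f (x + h + z))).
    exact: conv_op_integrable.
  by apply/funext => z /=; rewrite addrA addrAC.
Qed.

Let a1 : fine (b setT) = fine (a setT). Proof. by rewrite bE. Qed.

Lemma overlap_mass01 : 0 <= p <= 1.
Proof.
have : fine (a setT) + fine (b setT) <= 1.
  by rewrite -lee_fin EFinD !fineK ?fin_num_measure// -m1 abm.
have : 0 <= fine (a setT) by exact: fine_ge0.
by rewrite a1 /p => *; apply/andP; split; lra.
Qed.

(** Write T = A (1 + S) + B, where A is convolution with a and S the
    translation by h. In the expansion of T ^ n the factors 1 + S turn f into a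
    binomial average. The induction on n carries k such factors: one more step
    adds a factor with weight p and leaves k unchanged with weight 1 - p, and
    [sqrt_convex_step] combines the two bounds. *)
Lemma walk_decay n k (f : 'rV[R]_d -> R) (M : R) (x : 'rV[R]_d) :
  measurable_fun setT f -> (forall x, `|f x| <= M) ->
  `|smear_diff h k (iter n T f) x| <=
  2 * M * 2 ^+ k / Num.sqrt (k.+1%:R + n%:R * (p / 2)).
Proof.
have /andP[p0 p1] := overlap_mass01.
elim: n k f M x => [|n IH] k f M x mf fM.
  by rewrite mul0r addr0; exact: smear_diff_bound.
have M0 : 0 <= M by rewrite (le_trans _ (fM x)).
have bf : bounded_measurable f by split => //; exists M.
pose Af := conv_op a f.
have bAf : bounded_measurable Af by exact: conv_op_bmf.
(* the remainder B is defined by what it does to f *)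
pose Bf y := T f y - Af y - conv_op b f y.
have bBf : bounded_measurable Bf.
  by apply: bmfD; [apply: bmfD; [|apply: bmfN]|apply: bmfN]; exact: conv_op_bmf.
have TfE : T f = fun y => (Af y + Af (y + h)) + Bf y.
  by apply/funext => y; rewrite /Bf shifted_conv_op// /Af; ring.
have bAS : bounded_measurable (fun y => Af y + Af (y + h)).
  by apply: bmfD => //; exact: bmf_shift.
rewrite iterSr TfE iter_conv_opD// smear_diffD iter_conv_opD//; last exact: bmf_shift.
rewrite iter_conv_op_shift smear_diffS.
have AfM y : `|Af y| <= M * (p / 2).
  have -> : M * (p / 2) = M * fine (a setT) by rewrite /p; field.
  exact: conv_op_bound.
have BfM y : `|Bf y| <= M * (1 - p).
  have -> : 1 - p = fine (m setT) - fine (a setT) - fine (b setT).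
    by rewrite m1/= a1 /p; ring.
  apply: Rintegral_domination => //; exact: measurable_shift.
have H1 := IH k.+1 Af _ x bAf.1 AfM.
have H2 := IH k Bf _ x bBf.1 BfM.
apply: (le_trans (ler_normD _ _)); apply: (le_trans (lerD H1 H2)).
set y : R := k.+1%:R + n%:R * (p / 2).
have y1 : 1 <= y.
  by rewrite /y -[leLHS]addr0; apply: lerD; rewrite ?ler1n// mulr_ge0// divr_ge0.
have -> : k.+2%:R + n%:R * (p / 2) = y + 1.
  by rewrite /y -[k.+2]addn1 natrD; ring.
have -> : k.+1%:R + n.+1%:R * (p / 2) = y + p / 2.
  by rewrite /y -[n.+1]addn1 natrD; ring.
have Ms : 0 <= 2 * M * 2 ^+ k by rewrite !mulr_ge0// exprn_ge0.
have := ler_wpM2l Ms (@sqrt_convex_step R p y _ y1).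
rewrite p0 p1 => /(_ isT); apply: le_trans.
rewrite exprS le_eqVlt; apply/orP; left; apply/eqP; field.
by rewrite !gt_eqF//= sqrtr_gt0; lra.
Qed.

End walk_decay.

(** * Lebesgue measure and absolutely continuous components *)

Section lebesgue_rV_facts.
Context {R : realType}.
Local Notation lam := (@lebesgue_rV R _).

Lemma lebesgue_measure_translate (a : R) (A : set (measurableTypeR R)) :
  measurable A -> lebesgue_measure ((fun x => a + x) @^-1` A) = lebesgue_measure A.
Proof.
move=> mA.
have ma : measurable_fun setT ((fun x => a + x) : measurableTypeR R -> measurableTypeR R).
  exact: measurable_funD.
pose m := image_measure
  (@lebesgue_measure R) ma.
apply/esym/(@lebesgue_measure_unique R m) => // _ [[x y]] _ <-.
rewrite /m/= /pushforward (_ : _ @^-1` _ = `]x - a, y - a]%classic); last first.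
  by apply/seteqP; split=> z /=; rewrite !in_itv/= ltrBlDl lerBrDl.
rewrite !lebesgue_measure_itv/= !lte_fin ltrD2r.
by case: ifP => // _; rewrite -!EFinB opprB addrA subrK.
Qed.

(** Induction on the dimension: the translate of a product measure is
    determined by its values on rectangles. *)
Lemma lebesgue_rV_translate n (v : 'rV[R]_n) A : measurable A ->
  lam ((fun z => v + z) @^-1` A) = lam A.
Proof.
elim: n v A => [|n IH] v A mA.
  congr (lam _); apply/seteqP; split=> z /=; rewrite (_ : v + z = z)//;
  by apply/rowP => -[].
pose v' : 'rV[R]_n := \row_i v ord0 (lift ord0 i).
pose tau (p : R * 'rV[R]_n) : measurableTypeR R * 'rV[R]_n :=
  (v ord0 ord0 + p.1, v' + p.2).
have mtau : measurable_fun setT tau.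
  apply: measurable_fun_pair; first exact: measurable_funD.
  exact: measurable_rVD.
have mcA : measurable (@rV_cons R n @^-1` A).
  by apply: measurable_preimageT => //; exact: measurable_rV_cons.
pose m := image_measure
  (@lebesgue_measure R \x @lebesgue_rV R n)%E mtau.
rewrite /= /pushforward (_ : _ @^-1` (_ @^-1` A) = tau @^-1` (@rV_cons R n @^-1` A)); last first.
  apply/seteqP; split=> p /=; rewrite (_ : v + rV_cons p = rV_cons (tau p))//;
  apply/rowP => i; rewrite mxE; have [j ->|->] := unliftP ord0 i;
  by rewrite ?rV_cons_lift ?rV_cons0 /tau/= ?mxE.
apply/esym; apply: (@product_measure_unique _ _ _ _ _ (@lebesgue_measure R)
  (@lebesgue_rV R n) m _ _ mcA) => B C mB mC.
have mv0 : measurable_fun setT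
    ((fun x => v ord0 ord0 + x) : measurableTypeR R -> measurableTypeR R).
  exact: measurable_funD.
have mv' : measurable_fun setT (fun z : 'rV[R]_n => v' + z) by exact: measurable_rVD.
rewrite /m/= /pushforward (_ : _ @^-1` _ = ((fun x => v ord0 ord0 + x) @^-1` B) `*`
  ((fun z => v' + z) @^-1` C)) ?product_measure1E//.
- by congr (_ * _)%E; [exact: lebesgue_measure_translate|exact: IH].
- exact: (measurable_preimageT mv0 mB).
- exact: (measurable_preimageT mv' mC).
Qed.

Definition cube n (k : nat) : set 'rV[R]_n :=
  [set v | forall i, `[- k%:R, k%:R]%classic (v ord0 i)].

Lemma measurable_cube n k : measurable (@cube n k).
Proof.
rewrite (_ : @cube n k = \bigcap_(i : 'I_n)
  (fun v : 'rV[R]_n => v ord0 i) @^-1` `[- k%:R, k%:R]%classic).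
  apply: fin_bigcap_measurable => // i _.
  by apply: measurable_preimageT => //; exact: rV_coord_measurable.
by apply/seteqP; split=> v h i => [_|]; exact: h.
Qed.

Lemma cube_finite n k : (lam (@cube n k) < +oo)%E.
Proof.
rewrite /cube (lebesgue_rV_rectangle (A := fun=> `[- k%:R, k%:R]%classic))//.
rewrite ltey_eq; apply/orP; left; elim/big_ind: _ => // [x y fx fy|i _].
  by rewrite fin_numM.
by rewrite /= lebesgue_measure_itv/=; case: ifP.
Qed.

Lemma ler_coord_norm n (v : 'rV[R]_n) i : `|v ord0 i| <= `|v|.
Proof.
rewrite [leRHS]mx_normrE.
exact: (@le_bigmax _ _ _ 0 (fun ij : 'I_1 * 'I_n => `|v ij.1 ij.2|) (ord0, i)).
Qed.

Lemma cube_cover n (v : 'rV[R]_n) : exists k, cube k v.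
Proof.
exists (Num.trunc `|v|).+1 => i; rewrite /= in_itv/= -ler_norml.
rewrite (le_trans _ (ltW (truncnS_gt _)))//.
exact: ler_coord_norm.
Qed.

Lemma cube_add n k l (u v : 'rV[R]_n) : cube k u -> cube l v -> cube (k + l) (u + v).
Proof.
move=> ku lv i; have := ku i; have := lv i; rewrite /= !in_itv/= mxE natrD.
by move=> /andP[? ?] /andP[? ?]; apply/andP; split; lra.
Qed.

End lebesgue_rV_facts.

Section hahn.
Context {R : realType} {d} {T : measurableType d}.
Local Open Scope ereal_scope.

Lemma hahn_two_measures (p q : {finite_measure set T -> \bar R}) :
  exists N, [/\ measurable N,
    forall A, measurable A -> A `<=` N -> p A <= q A &
    forall A, measurable A -> A `<=` ~` N -> q A <= p A].
Proof.
pose nu := cadd (charge_of_finite_measure p) (copp (charge_of_finite_measure q)).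
have nuE A : measurable A -> nu A = p A - q A by [].
have [A [B [[mA posA] [mB negB] AB AB0]]] := Hahn_decomposition nu.
exists B; split=> [//|C mC CB|C mC CB].
  by have : p C - q C <= 0 by [exact: negB]; rewrite sube_le0.
have : C `<=` A.
  move=> x Cx; have : (A `|` B) x by rewrite AB.
  by case=> // Bx; have := CB _ Cx.
move=> CA; have : 0 <= p C - q C by exact: posA.
by rewrite sube_ge0// fin_num_measure.
Qed.

End hahn.

Section minorization.
Context {R : realType} {n : nat}.
Local Notation lam := (@lebesgue_rV R n).

(** For every j and k, apply a Hahn decomposition to mu and to Lebesgue measure
    on a cube of size k divided by j + 1. If the part where mu is the larger
    one were always null, then mu would vanish off the union of these parts,
    since there it would be below arbitrarily small multiples of Lebesgue
    measure; so mu would be singular. *)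
Lemma ac_component_minorized (mu : {finite_measure set 'rV[R]_n -> \bar R}) :
  has_ac_component mu -> exists (e : R) (E : set 'rV[R]_n) (k : nat),
  [/\ 0 < e, measurable E, E `<=` cube k, (0 < lam E)%E &
    forall A, measurable A -> (e%:E * lam (A `&` E) <= mu A)%E].
Proof.
move=> ac; apply: contrapT => H; apply: ac.
pose lamk k : {finite_measure set 'rV[R]_n -> \bar R} :=
  mfrestr (@measurable_cube R n k) (@cube_finite R n k).
have lamkE k A : lamk k A = lam (A `&` cube k) by [].
have j0 (j : nat) : 0 <= (j.+1%:R : R)^-1 by rewrite invr_ge0.
pose q j k : {finite_measure set 'rV[R]_n -> \bar R} := mscale (NngNum (j0 j)) (lamk k).
have qE j k A : q j k A = ((j.+1%:R)^-1%:E * lam (A `&` cube k))%E by [].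
have /choice[N NP] : forall jk : nat * nat, exists N, [/\ measurable N,
    forall A, measurable A -> A `<=` N -> (mu A <= q jk.1 jk.2 A)%E &
    forall A, measurable A -> A `<=` ~` N -> (q jk.1 jk.2 A <= mu A)%E].
  by move=> jk; exact: hahn_two_measures.
have mE jk : measurable (~` N jk `&` cube jk.2).
  apply: measurableI; last exact: measurable_cube.
  by apply: measurableC; have [] := NP jk.
have E0 jk : lam (~` N jk `&` cube jk.2) = 0%E.
  apply/eqP; rewrite eq_le measure_ge0 andbT leNgt; apply/negP => E0.
  apply: H; exists (jk.1.+1%:R)^-1, (~` N jk `&` cube jk.2), jk.2; split => //.
  move=> A mA; have [mN _ qmu] := NP jk.
  have mAN : measurable (A `&` ~` N jk) by apply: measurableI => //; exact: measurableC.
  apply: (@le_trans _ _ (mu (A `&` ~` N jk))).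
    by rewrite setIA -qE; apply: qmu.
  by apply: le_measure; rewrite ?inE.
pose Z := \bigcup_j \bigcup_k (~` N (j, k) `&` cube k).
have mZ : measurable Z by do 2! (apply: bigcupT_measurable => ?); exact: (mE (_, _)).
exists Z; split=> //; last first.
  apply/negligibleP => //; do 2! (apply: negligible_bigcup => ?).
  by apply/negligibleP; [exact: (mE (_, _))|exact: (E0 (_, _))].
have mnZ : measurable (~` Z) by exact: measurableC.
apply/negligibleP => //.
have -> : ~` Z = \bigcup_k (~` Z `&` cube k).
  apply/seteqP; split=> [v nZ|v [k _ []]//].
  by have [k kv] := cube_cover v; exists k.
apply: negligible_bigcup => k.
have mA : measurable (~` Z `&` cube k) by apply: measurableI => //; exact: measurable_cube.
apply/negligibleP => //.
have muA j : (mu (~` Z `&` cube k) <= (j.+1%:R^-1)%:E * lam (cube k))%E.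
  have [_ muq _] := NP (j, k); apply: (le_trans (muq _ mA _)).
    move=> v [nZ kv]; apply: contrapT => nN; apply: nZ.
    by exists j => //; exists k.
  rewrite qE; apply: lee_wpmul2l; first by rewrite lee_fin.
  by apply: le_measure; rewrite ?inE//; [apply: measurableI => //|];
    exact: measurable_cube.
have mufin : mu (~` Z `&` cube k) \is a fin_num by exact: fin_num_measure.
have lamfin : lam (cube k) \is a fin_num by rewrite ge0_fin_numE// cube_finite.
move: muA; rewrite -(fineK mufin) -(fineK lamfin) => muA.
rewrite -[LHS](fineK mufin) (_ : fine _ = 0)//; apply/eqP.
rewrite eq_le fine_ge0// andbT leNgt; apply/negP => r0.
set r := fine _ in r0 muA; set L := fine _ in muA.
have L0 : 0 <= L by exact: fine_ge0.
have := muA (Num.trunc (L / r)); rewrite -EFinM lee_fin mulrC ler_pdivlMr//.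
rewrite leNgt => /negP; apply; rewrite mulrC -ltr_pdivrMr//.
exact: truncnS_gt.
Qed.

(** Translates that overlap in null sets only have an infinite total measure,
    but they all lie in one cube. *)
Lemma overlapping_translates (E : set 'rV[R]_n) K (c : nat -> 'rV[R]_n) :
  measurable E -> (0 < lam E)%E ->
  (forall i, (fun z => - c i + z) @^-1` E `<=` cube K) ->
  exists i j, (i < j)%N /\
    (0 < lam (E `&` (fun z => (c i - c j) + z)%R @^-1` E))%E.
Proof.
move=> mE E0 EK; apply: contrapT => H.
pose F i := (fun z : 'rV[R]_n => - c i + z) @^-1` E.
have mF i : measurable (F i).
  have mc : measurable_fun setT (fun z : 'rV[R]_n => - c i + z).
    exact: measurable_rVD.
  exact: (measurable_preimageT mc mE).
have lamF i : lam (F i) = lam E by exact: lebesgue_rV_translate.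
have FF i j : (i < j)%N -> lam (F j `&` F i) = 0%E.
  move=> ij; apply/eqP; rewrite eq_le measure_ge0 andbT leNgt; apply/negP => ji.
  apply: H; exists i, j; split => //; apply: (lt_le_trans ji).
  rewrite -(lebesgue_rV_translate (c i)); last exact: measurableI.
  rewrite le_eqVlt; apply/orP; left; apply/eqP; congr (lam _).
  apply/seteqP; split=> z /=; rewrite /F/= addKr addrA [- c j + _]addrC.
    by move=> [].
  by move=> [].
pose U k := \big[setU/set0]_(i < k) F i.
have mU k : measurable (U k) by apply: bigsetU_measurable.
have FU k m : (k <= m)%N -> lam (F m `&` U k) = 0%E.
  elim: k => [_|k IH km]; first by rewrite /U big_ord0 setI0 measure0.
  apply/eqP; rewrite eq_le measure_ge0 andbT /U big_ord_recr/= setIUr.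
  apply: (le_trans (measureU2 _ (measurableI _ _ (mF m) (mU k))
    (measurableI _ _ (mF m) (mF k)))).
  rewrite le_eqVlt; apply/orP; left; apply/eqP; transitivity (0 + 0 : \bar R)%E.
    by congr (_ + _)%E; [exact: IH (ltnW km)|exact: FF].
  exact: adde0.
have Usum k : lam (U k) = (k%:R%:E * lam E)%E.
  elim: k => [|k IH]; first by rewrite /U big_ord0 measure0 mul0e.
  have -> : U k.+1 = U k `|` (F k `\` U k).
    by rewrite setUDr setDv setD0 /U big_ord_recr.
  rewrite measureU//; last 2 first.
  - exact: measurableD.
  - by apply/seteqP; split=> z //= [Uz [_ /(_ Uz)]].
  have lamD : lam (F k `\` U k) = lam E.
    rewrite -(lamF k); apply/esym.
    rewrite (measureDI (@lebesgue_rV R n) (mF k) (mU k)) -[RHS]adde0.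
    by congr (_ + _)%E; exact: FU.
  transitivity (lam (U k) + lam (F k `\` U k))%E; first by [].
  by rewrite IH lamD -[k.+1]addn1 natrD EFinD ge0_muleDl// ?mul1e.
have UK k : (lam (U k) <= lam (cube K))%E.
  apply: le_measure; rewrite ?inE//; first exact: measurable_cube.
  by move=> v; rewrite /U -bigcup_mkord => -[i _ /EK].
have lamfin : lam (cube K) \is a fin_num by rewrite ge0_fin_numE// cube_finite.
have Efin : lam E \is a fin_num.
  rewrite ge0_fin_numE//; have := UK 1%N; rewrite Usum mul1e => h.
  by rewrite (le_lt_trans h)// cube_finite.
have r0 : 0 < fine (lam E) by rewrite fine_gt0// E0 ltey_eq Efin.
pose L := fine (lam (cube K)); pose r := fine (lam E).
have := UK (Num.trunc (L / r)).+1.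
have -> : lam (cube K) = L%:E by rewrite fineK.
rewrite Usum (_ : lam E = r%:E); last by rewrite fineK.
rewrite -EFinM lee_fin leNgt => /negP; apply.
rewrite -ltr_pdivrMr//; exact: truncnS_gt.
Qed.

End minorization.

(** * Decay of the transition probabilities *)

Section decay_group.
Context {R : realType} {d : nat}.
Variable m : probability 'rV[R]_d R.
Local Notation T := (conv_op m).
Local Notation lam := (@lebesgue_rV R d).

(** The translations by which the starting point can be moved at a cost of
    order 1 / sqrt n after n steps. They form a group. *)
Definition decays (h : 'rV[R]_d) := exists2 C : R, 0 <= C &
  forall n (f : 'rV[R]_d -> R) x, measurable_fun setT f -> (forall y : 'rV[R]_d, `|f y| <= 1) ->
    `|iter n T f x - iter n T f (x + h)| <= C / Num.sqrt n.+1%:R.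

Lemma decaysD h1 h2 : decays h1 -> decays h2 -> decays (h1 + h2).
Proof.
move=> [C1 C10 H1] [C2 C20 H2]; exists (C1 + C2); first exact: addr_ge0.
move=> n f x mf f1.
rewrite (_ : _ - _ = (iter n T f x - iter n T f (x + h1)) +
  (iter n T f (x + h1) - iter n T f ((x + h1) + h2))); last by rewrite addrA; ring.
by rewrite (le_trans (ler_normD _ _))// mulrDl lerD ?H1 ?H2.
Qed.

Lemma decays0 : decays 0.
Proof.
exists 0 => // n f x _ _; by rewrite addr0 subrr normr0 mul0r.
Qed.

Lemma decaysN h : decays h -> decays (- h).
Proof.
move=> [C C0 H]; exists C => // n f x mf f1.
by have := H n f (x - h) mf f1; rewrite subrK distrC.
Qed.

Lemma decaysMn h k : decays h -> decays (h *+ k).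
Proof.
by move=> dh; elim: k => [|k IH]; [exact: decays0|rewrite mulrS; exact: decaysD].
Qed.

Section overlap.
Variables (e : R) (E : set 'rV[R]_d) (k : nat).
Hypotheses (e0 : 0 < e) (mE : measurable E) (Ek : E `<=` cube k)
  (lamE : (0 < lam E)%E).
Hypothesis Em : forall A, measurable A -> (e%:E * lam (A `&` E) <= m A)%E.

(** Restrict e times Lebesgue measure to the overlap F and halve it. Together
    with its translate by h, which also lives on E, it stays below m. *)
Lemma overlap_decays h : (0 < lam (E `&` (fun z => h + z)%R @^-1` E))%E -> decays h.
Proof.
move=> lamF.
have mh : measurable_fun setT (fun z : 'rV[R]_d => h + z) by exact: measurable_rVD.
have mNh : measurable_fun setT (fun z : 'rV[R]_d => - h + z) by exact: measurable_rVD.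
pose F := E `&` (fun z => h + z) @^-1` E.
have mF : measurable F.
  by apply: measurableI => //; exact: (measurable_preimageT mh mE).
pose F' := (fun z => - h + z) @^-1` F.
have mF' : measurable F' by exact: (measurable_preimageT mNh mF).
have FE A : measurable A -> A `&` F `<=` A `&` E.
  by move=> mA z [Az []].
have Fle A : measurable A -> (lam (A `&` F) <= lam (A `&` E))%E.
  move=> mA; apply: le_measure; rewrite ?inE; [exact: measurableI..|exact: FE].
have F'le A : measurable A -> (lam (A `&` F') <= lam (A `&` E))%E.
  move=> mA; apply: le_measure; rewrite ?inE; [exact: measurableI..|].
  by move=> z [Az [_ /=]]; rewrite addNKr.
have lamE_fin : (lam E < +oo)%E.
  apply: (@le_lt_trans _ _ (lam (cube k))); last exact: cube_finite.
  by apply: le_measure; rewrite ?inE//; exact: measurable_cube.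
have lamF_fin : (lam F < +oo)%E.
  by apply: le_lt_trans lamE_fin; rewrite -[F]setTI -[E in leRHS]setTI; exact: Fle.
have lamF'_fin : (lam F' < +oo)%E.
  by apply: le_lt_trans lamE_fin; rewrite -[F']setTI -[E in leRHS]setTI; exact: F'le.
have e20 : 0 <= e / 2 by rewrite divr_ge0// ltW.
pose a : {finite_measure set 'rV[R]_d -> \bar R} :=
  mscale (NngNum e20) (mfrestr mF lamF_fin).
pose b : {finite_measure set 'rV[R]_d -> \bar R} :=
  mscale (NngNum e20) (mfrestr mF' lamF'_fin).
have aE A : a A = ((e / 2)%:E * lam (A `&` F))%E by [].
have bE' A : b A = ((e / 2)%:E * lam (A `&` F'))%E by [].
have bE A : measurable A -> b A = a ((fun z => z + h) @^-1` A).
  move=> mA; rewrite aE bE'; congr (_ * _)%E.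
  rewrite -(lebesgue_rV_translate h); last exact: measurableI.
  by congr (lam _); apply/seteqP; split=> z /=; rewrite /F'/= addKr [z + h]addrC.
have abm A : measurable A -> (a A + b A <= m A)%E.
  move=> mA; apply: le_trans (Em mA); rewrite aE bE'.
  rewrite [in leRHS](_ : e = e / 2 + e / 2); last by field.
  rewrite EFinD ge0_muleDl ?lee_fin//.
  by apply: leeD; apply: lee_wpmul2l; rewrite ?lee_fin//; [exact: Fle|exact: F'le].
have m1 : m setT = 1%E by exact: probability_setT.
have /andP[p0 p1] := overlap_mass01 m1 bE abm.
set p := 2 * fine (a setT) in p0 p1.
have {}p0 : 0 < p.
  rewrite /p mulr_gt0// fine_gt0// ltey_eq fin_num_measure// aE setTI.
  by rewrite andbT mule_gt0// lte_fin divr_gt0.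
exists (2 / Num.sqrt (p / 2)); first by rewrite divr_ge0// sqrtr_ge0.
move=> n f x mf f1.
have H : `|iter n T f x - iter n T f (x + h)| <=
    2 * 1 * 2 ^+ 0 / Num.sqrt (1%:R + n%:R * (p / 2)).
  exact: (walk_decay m1 bE abm n 0 x mf f1).
apply: (le_trans H).
have -> : 2 / Num.sqrt (p / 2) / Num.sqrt n.+1%:R =
    2 * (Num.sqrt (p / 2) * Num.sqrt n.+1%:R)^-1 by rewrite invfM mulrA.
rewrite expr0 !mulr1 ler_pM2l//.
have s0 : 0 < Num.sqrt (p / 2) * Num.sqrt n.+1%:R.
  by rewrite mulr_gt0 ?sqrtr_gt0// divr_gt0.
rewrite lef_pV2 ?posrE// ?sqrtr_gt0; last first.
  by rewrite ltr_wpDr// mulr_ge0// divr_ge0// ltW.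
rewrite -sqrtrM ?divr_ge0 ?(ltW p0)// ler_wsqrtr//.
by rewrite -/p -[n.+1]addn1 natrD mulrDr mulr1 addrC [p / 2 * _]mulrC lerD2r; lra.
Qed.

(** Among the bounded translations v / q ^ i, two give overlapping translates
    of E; multiplying their difference by q ^ j clears the denominators. *)
Lemma decays_power (q : nat) (v : 'rV[R]_d) : (1 < q)%N ->
  exists2 j, (0 < j)%N & decays (v *+ (q ^ j - 1)).
Proof.
move=> q1; pose c i : 'rV[R]_d := (q%:R^-1 ^+ i) *: v.
have q0 : 0 < q%:R :> R by rewrite ltr0n (ltn_trans _ q1).
have [l lv] := cube_cover v.
have cE i : (fun z => - c i + z) @^-1` E `<=` cube (k + l).
  move=> z /= /Ek kz.
  have -> : z = (- c i + z) + c i by rewrite addrAC addNr add0r.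
  apply: cube_add => //.
  move=> j; rewrite /= in_itv/= -ler_norml mxE normrM.
  have := lv j; rewrite /= in_itv/= -ler_norml => vj.
  have qi0 : 0 <= q%:R^-1 :> R by rewrite invr_ge0 ltW.
  have qi1 : q%:R^-1 <= 1 :> R by rewrite invf_le1// ler1n ltnW.
  have ci : `|q%:R^-1 ^+ i| <= 1 :> R by rewrite normrX ger0_norm// exprn_ile1.
  by rewrite (le_trans (ler_wpM2r (normr_ge0 _) ci))// mul1r.
have [i [j [ij lamij]]] := overlapping_translates mE lamE cE.
exists (j - i)%N; first by rewrite subn_gt0.
have := decaysMn (q ^ j) (overlap_decays lamij).
suff -> : (c i - c j) *+ q ^ j = v *+ (q ^ (j - i) - 1) by [].
have qj : (q ^ j)%:R = q%:R ^+ (j - i) * q%:R ^+ i :> R.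
  by rewrite -exprD subnK ?natrX// ltnW.
rewrite -scaler_nat -[in RHS]scaler_nat /c -scalerBl scalerA; congr (_ *: _).
rewrite natrB ?expn_gt0 ?(ltn_trans _ q1)// mulrBr.
rewrite -natrX in qj.
rewrite {1}natrX {1}(_ : j = (j - i) + i)%N; last by rewrite subnK// ltnW.
rewrite exprD -mulrA -exprMn mulfV ?gt_eqF// expr1n mulr1.
by rewrite natrX -exprMn mulfV ?gt_eqF// expr1n natrX.
Qed.

(** With q = 2 ^ j - 1 the multiple q v decays, hence so does q ^ i v, and
    [decays_power] for this q gives (q ^ i - 1) v; subtract. The case q = 1 is
    immediate. *)
Lemma decays_all (v : 'rV[R]_d) : decays v.
Proof.
have [j j0 dj] := @decays_power 2 v isT.
set q := (2 ^ j - 1)%N in dj.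
have q0 : (0 < q)%N by rewrite subn_gt0 -{1}(expn0 2) ltn_exp2l.
move: q0; rewrite leq_eqVlt => /predU1P[q1|q1].
  by move: dj; rewrite -q1 mulr1n.
have [i i0 di] := decays_power v q1.
(* q ^ i - (q ^ i - 1) = 1 *)
have := decaysD (decaysMn (q ^ i.-1) dj) (decaysN di).
rewrite -mulrnA -expnS prednK// -mulrnBr ?leq_subr//.
by rewrite subKn ?mulr1n// expn_gt0 (ltn_trans _ q1).
Qed.

End overlap.

Lemma ac_component_decays v : has_ac_component m -> decays v.
Proof.
move=> /ac_component_minorized[e [E [k [e0 mE Ek lamE Em]]]].
exact: decays_all e0 mE Ek lamE Em v.
Qed.

End decay_group.

Section levy_decay.
Context {R : realType} {d : nat} {d0 : measure_display} {Om : measurableType d0}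
  {P : probability Om R}.
Variable X : R -> {RV P >-> 'rV[R]_d}.
Hypothesis hX : levy_process X.
Hypothesis hX0 : {ae P, forall w, X 0 w = 0}.
Local Notation Q := (levy_transition X).

Definition levy_law (t : R) : probability 'rV[R]_d R := distribution P (X t).

Lemma levy_lawE t x A : Q t x A = levy_law t ((fun z => x + z) @^-1` A).
Proof. by []. Qed.

(** Freeze X_s in X_(s + t) = X_s + (X_(s + t) - X_s). *)
Lemma levy_law_convolution s t A : 0 <= s -> 0 <= t -> measurable A ->
  levy_law (s + t) A = (levy_law s \x levy_law t)%E [set p | A (p.1 + p.2)].
Proof.
move=> s0 t0 mA.
have mS : measurable [set p : 'rV[R]_d * 'rV[R]_d | A (p.1 + p.2)].
  have mD : measurable_fun setT (fun p : 'rV[R]_d * 'rV[R]_d => p.1 + p.2).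
    exact: measurable_rVD.
  exact: (measurable_preimageT mD mA).
have mc : @measurable_fun _ _ (g_sigma_algebraType (past_gen (centered_RV X) s))
    'rV[R]_d setT (centered X s).
  move=> _ C mC; apply: sub_sigma_algebra; exists s; last by exists C.
  by rewrite /= in_itv/= s0 lexx.
have := @indep_markov _ _ _ _ P _ (centered X s) (increment X s (s + t))
  (@past_gen_measurable _ _ _ _ _ (centered_RV X) s) (measurable_increment X s (s + t))
  (fun C B mC sB => past_increment_indep hX s0 t0 mC sB) mc A setT mA
  (@measurableT _ (g_sigma_algebraType (past_gen (centered_RV X) s))).
rewrite setTI (_ : (fun w => centered X s w + _) = (fun w => 0 + centered X (s + t) w)); last first.
  by apply/funext => w; rewrite add0r /centered/increment [LHS]addrC subrKA.
rewrite transition_centered// levy_lawE.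
rewrite (_ : _ @^-1` A = A); last by apply/seteqP; split=> z /=; rewrite add0r.
move=> ->; rewrite /product_measure1.
rewrite ge0_integral_distribution//; last exact: measurable_fun_xsection.
apply: ae_eq_integral => //.
- under eq_fun do rewrite transition_increment//.
  apply: (measurableT_comp (measurable_transition (P := P) X t mA)).
  exact: measurable_increment.
- have mx : measurable_fun setT (levy_law t \o xsection [set p | A (p.1 + p.2)]).
    exact: measurable_fun_xsection.
  exact: (measurableT_comp mx).
apply: filterS hX0 => w Xw _ /=; rewrite transition_increment//.
rewrite /centered/increment Xw subr0 levy_lawE; congr (levy_law _ _).
by apply/seteqP; split=> z /=; rewrite /xsection/= inE.
Qed.

Lemma conv_op_levy_law s t f : 0 <= s -> 0 <= t -> bounded_measurable f ->
  conv_op (levy_law (s + t)) f = conv_op (levy_law s) (conv_op (levy_law t) f).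
Proof.
move=> s0 t0 bf; apply/funext => x.
have [mf [M fM]] := bf.
have mD : measurable_fun setT (fun p : 'rV[R]_d * 'rV[R]_d => p.1 + p.2).
  exact: measurable_rVD.
pose m := image_measure
  (levy_law s \x levy_law t)%E mD.
rewrite {1}/conv_op /Rintegral (@eq_measure_integral _ _ _ _ m); last first.
  by move=> A mA _; exact: levy_law_convolution.
have mF : measurable_fun setT (fun p : 'rV[R]_d * 'rV[R]_d => f (x + (p.1 + p.2))).
  by apply: (measurableT_comp mf); exact: measurable_rVD.
have iF : (levy_law s \x levy_law t)%E.-integrable setT
    (fun p => (f (x + (p.1 + p.2)))%:E).
  pose st : probability _ R := (levy_law s \x levy_law t)%E.
  by have := @bounded_integrable _ _ _ st (fun p => f (x + (p.1 + p.2))) M mF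
    (fun p => fM _).
rewrite integral_pushforward//=; last first.
  by apply/measurable_EFinP; exact: measurable_shift.
rewrite -integral12_prod_meas1//= /conv_op /Rintegral; congr fine.
apply: eq_integral => z _ /=; rewrite /fubini_F /=.
under eq_integral do rewrite addrA.
by rewrite fineK//; apply: integrable_fin_num => //; exact: conv_op_integrable.
Qed.

Lemma conv_op_levy_iter s n f r : 0 <= s -> 0 <= r -> bounded_measurable f ->
  conv_op (levy_law (s *+ n + r)) f =
  iter n (conv_op (levy_law s)) (conv_op (levy_law r) f).
Proof.
move=> s0 r0 bf; elim: n => [|n IH]; first by rewrite add0r.
by rewrite mulrS -addrA conv_op_levy_law//= ?IH// addr_ge0// mulrn_wge0.
Qed.

Lemma transition_integral t x f : bounded_measurable f ->
  (\int[levy_transition X t x]_z (f z)%:E)%E = (conv_op (levy_law t) f x)%:E.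
Proof.
move=> bf.
have mx : measurable_fun setT (fun w => x + X t w) by exact: measurable_rVD.
have -> : levy_transition X t x =
  image_measure P mx by [].
have bi := conv_op_integrable (levy_law t) x bf.
rewrite /conv_op /Rintegral fineK; last exact: integrable_fin_num.
have ib : P.-integrable setT (fun w => (f (x + X t w))%:E).
  case: bf => mf [M fM]; apply: (@bounded_integrable _ _ _ _ (fun w => f (x + X t w)) M) => //.
  exact: (measurableT_comp mf).
rewrite integral_pushforward//=; last by apply/measurable_EFinP; case: bf.
rewrite integral_distribution//.
by apply/measurable_EFinP; apply: measurable_shift; case: bf.
Qed.

(** For t = n t0 + r, the transition operator is that of the walk with the law
    of X_t0, iterated n times, applied to a function averaged over the
    remaining time r. *)
Lemma levy_var_decay t0 x y : 0 < t0 -> has_ac_component (levy_transition X t0 0) ->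
  exists2 C : R, 0 < C & forall t : R, 0 < t ->
    (var_dist (levy_transition X t x) (levy_transition X t y) <=
     (C / Num.sqrt t)%:E)%E.
Proof.
move=> t00 ac.
have acl : has_ac_component (levy_law t0).
  have E : levy_transition X t0 0 = levy_law t0.
    by apply/funext => A; rewrite levy_lawE; congr (levy_law _ _);
      apply/seteqP; split=> z /=; rewrite add0r.
  by move: ac; rewrite E.
have [C C0 H] := ac_component_decays (y - x) acl.
exists (C * Num.sqrt t0 + 1).
  by rewrite ltr_wpDl// mulr_ge0// sqrtr_ge0.
move=> t t_gt0; apply: ge_ereal_sup => _ [f /= f1 <-].
have bf : bounded_measurable f by split => //; exists 1.
rewrite !transition_integral// -EFinB abse_EFin lee_fin.
pose n := Num.trunc (t / t0); pose r := t - t0 *+ n.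
have tt0 : 0 <= t / t0 by rewrite divr_ge0// ltW.
have r0 : 0 <= r.
  rewrite subr_ge0 -[t0 *+ n]mulr_natl -ler_pdivlMr// truncn_le//.
have tE : t = t0 *+ n + r by rewrite addrC subrK.
rewrite {1 2}tE conv_op_levy_iter// ?(ltW t00)//.
have [mg _] := conv_op_bmf (levy_law r) bf.
have g1 z : `|conv_op (levy_law r) f z| <= 1.
  have := conv_op_bound (levy_law r) z (measurable_funP f) f1.
  rewrite mul1r (_ : fine _ = 1)//.
  exact: (congr1 fine (probability_setT (levy_law r))).
have := H n _ x mg g1; rewrite [x + _]addrC subrK => /le_trans; apply.
have st : 0 < Num.sqrt t by rewrite sqrtr_gt0.
have sn : 0 < Num.sqrt (n.+1%:R : R) by rewrite sqrtr_gt0.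
rewrite ler_pdivrMr// mulrAC ler_pdivlMr//.
apply: (@le_trans _ _ (C * (Num.sqrt t0 * Num.sqrt n.+1%:R))).
  apply: ler_wpM2l => //; rewrite -sqrtrM ?(ltW t00)// ler_wsqrtr//.
  by rewrite mulrC -ler_pdivrMr// ltW// truncnS_gt.
by rewrite mulrDl mul1r mulrA lerDl ltW.
Qed.

End levy_decay.

(** * Regularity of finite measures *)

Lemma exists_natinv {R : realType} (e : R) : 0 < e -> exists n : nat, n.+1%:R^-1 <= e.
Proof.
move=> e0; exists (Num.trunc e^-1).
rewrite -[leRHS]invrK lef_pV2 ?posrE ?invr_gt0//.
by rewrite ltW// truncnS_gt.
Qed.

Section regularity.
Context {R : realType} {n : nat}.
Variable m : {finite_measure set 'rV[R]_n -> \bar R}.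
Implicit Types A F U : set 'rV[R]_n.

Definition regular_set A := forall e : R, 0 < e -> exists F U,
  [/\ closed F, open U, F `<=` A, A `<=` U & (m (U `\` F) < e%:E)%E].

(** The points at distance at least 1 / (k + 1) from the complement of U:
    closed sets that exhaust an open one. *)
Definition inner_thickening (U : set 'rV[R]_n) (k : nat) : set 'rV[R]_n :=
  ~` (\bigcup_(y in ~` U) ball y k.+1%:R^-1).

Lemma closed_measurable_rV F : closed F -> measurable F.
Proof.
move=> cF; rewrite -[F]setCK; apply: measurableC; apply: open_measurable_rV.
exact: closed_openC.
Qed.

Lemma closed_inner_thickening U k : closed (inner_thickening U k).
Proof.
apply: open_closedC; apply: bigcup_open => y _; exact: ball_open.
Qed.

Lemma inner_thickening_sub U k : inner_thickening U k `<=` U.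
Proof.
move=> x h; apply: contrapT => Ux; apply: h; exists x => //.
by apply: ballxx; rewrite invr_gt0.
Qed.

Lemma nd_inner_thickening U : nondecreasing_seq (inner_thickening U).
Proof.
apply/nondecreasing_seqP => k; apply/subsetPset => x h [y Uy xy]; apply: h.
exists y => //; apply: le_ball xy.
by rewrite lef_pV2 ?posrE// ler_nat.
Qed.

Lemma bigcup_inner_thickening U : open U -> \bigcup_k inner_thickening U k = U.
Proof.
move=> oU; apply/seteqP; split=> [x [k _]|x Ux]; first exact: inner_thickening_sub.
have /nbhs_ballP[e /= e0 eU] := open_nbhs_nbhs (conj oU Ux).
have [k ke] := exists_natinv e0.
exists k => // -[y nUy xy]; apply: nUy; apply: eU.
exact: (le_ball ke (ball_sym xy)).
Qed.

Lemma exhausting_seq_lt (G : nat -> set 'rV[R]_n) (e : R) : 0 < e ->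
  (forall k, measurable (G k)) -> nondecreasing_seq G ->
  exists k, (m ((\bigcup_i G i) `\` G k) < e%:E)%E.
Proof.
move=> e0 mG ndG.
have mU : measurable (\bigcup_i G i) by exact: bigcupT_measurable.
pose H k := (\bigcup_i G i) `\` G k.
have mH k : measurable (H k) by exact: measurableD.
have HE : \bigcap_k H k = set0.
  apply/seteqP; split=> x //= h.
  by have [[i _ Gi] _] := h 0%N I; have [_ /(_ Gi)] := h i I.
have := @nonincreasing_cvg_mu _ _ _ m H; rewrite HE measure0 => /(_ _ mH measurable0).
have H0 : (m (H 0%N) < +oo)%E by rewrite ltey_eq fin_num_measure.
have niH : nonincreasing_seq H.
  by move=> i j ij; apply/subsetPset; apply: setDS; exact/subsetPset/ndG.
move=> /(_ H0 niH) cv.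
have : \forall k \near \oo, (m (H k) < e%:E)%E.
  by apply: (cv [set u | (u < e%:E)%E]); apply: open_ereal_lt'; rewrite lte_fin.
by move=> [k _ /(_ k (leqnn k))]; exists k.
Qed.

Lemma regular_open U : open U -> regular_set U.
Proof.
move=> oU e e0.
have [k] := @exhausting_seq_lt (inner_thickening U) e e0
  (fun k => closed_measurable_rV (@closed_inner_thickening U k)) (@nd_inner_thickening U).
rewrite bigcup_inner_thickening// => mk.
exists (inner_thickening U k), U; split => //; first exact: closed_inner_thickening.
exact: inner_thickening_sub.
Qed.

Lemma regular_setC A : regular_set A -> regular_set (~` A).
Proof.
move=> rA e /rA[F [U [cF oU FA AU mUF]]]; exists (~` U), (~` F); split.
- exact: open_closedC.
- exact: closed_openC.
- exact: subsetC.
- exact: subsetC.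
- by rewrite setDE setCK setIC -setDE.
Qed.

(** The open sets are united with errors e / 4 / 2 ^ (k + 1); on the closed
    side finitely many sets must do, and continuity of the measure provides
    them. *)
Lemma regular_bigcup (A : nat -> set 'rV[R]_n) :
  (forall k, regular_set (A k)) -> regular_set (\bigcup_k A k).
Proof.
move=> rA e e0; have e20 : 0 < e / 2 by rewrite divr_gt0.
have e40 : 0 < e / 4 by rewrite divr_gt0.
have /choice[FU FUP] : forall k, exists FU : set 'rV[R]_n * set 'rV[R]_n,
    [/\ closed FU.1, open FU.2, FU.1 `<=` A k, A k `<=` FU.2 &
      (m (FU.2 `\` FU.1) < (e / 4 / (2 ^ k.+1)%:R)%:E)%E].
  move=> k; have ek : 0 < e / 4 / (2 ^ k.+1)%:R by rewrite divr_gt0// ltr0n expn_gt0.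
  by have [F [U H]] := rA k _ ek; exists (F, U).
pose F k := (FU k).1; pose U k := (FU k).2.
pose G k := \big[setU/set0]_(i < k.+1) F i.
have mF k : measurable (F k) by apply: closed_measurable_rV; have [] := FUP k.
have mU k : measurable (U k) by apply: open_measurable_rV; have [] := FUP k.
have mG k : measurable (G k) by exact: bigsetU_measurable.
have ndG : nondecreasing_seq G.
  by move=> i j ij; apply/subsetPset; apply: subset_bigsetU.
have GF : \bigcup_k G k = \bigcup_k F k.
  apply/seteqP; split=> x [k _].
    by rewrite /G -bigcup_mkord => -[i _ Fi]; exists i.
  by move=> Fk; exists k => //; rewrite /G big_ord_recr/=; right.
have [k mk] := @exhausting_seq_lt G _ e20 mG ndG.
exists (G k), (\bigcup_k U k); split.
- rewrite /G -bigcup_mkord; apply: closed_bigcup => // i _; by have [] := FUP i.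
- by apply: bigcup_open => i _; have [] := FUP i.
- rewrite /G -bigcup_mkord => x [i _ Fi]; exists i => //.
  by have [_ _ FA _ _] := FUP i; exact: FA.
- by move=> x [i _ Ai]; exists i => //; have [_ _ _ AU _] := FUP i; exact: AU.
have mUF i : measurable (U i `\` F i) by exact: measurableD.
have mUU : measurable (\bigcup_i (U i `\` F i)) by exact: bigcupT_measurable.
have mGG : measurable (\bigcup_i G i `\` G k).
  by apply: measurableD => //; exact: bigcupT_measurable.
apply: (@le_lt_trans _ _ (m (\bigcup_i (U i `\` F i) `|` (\bigcup_i G i `\` G k)))).
  apply: le_measure; rewrite ?inE.
  - by apply: measurableD => //; exact: bigcupT_measurable.
  - exact: measurableU.
  move=> x [[i _ Ui] nGk]; have [Fi|nFi] := pselect (F i x); last by left; exists i.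
  by right; split => //; rewrite GF; exists i.
apply: (le_lt_trans (measureU2 _ mUU mGG)).
rewrite [X in (_ < X%:E)%E](splitr e) EFinD; apply: lee_ltD => //.
  by rewrite fin_num_measure.
apply: (le_trans (generalized_Boole_inequality _ mUF mUU)).
apply: (@le_trans _ _ (\sum_(i <oo) (e / 4 / (2 ^ i.+1)%:R)%:E)%E).
  by apply: lee_nneseries => // i _; apply: ltW; have [] := FUP i.
apply: (le_trans (epsilon_trick0 xpredT (ltW e40))).
by rewrite lee_fin; lra.
Qed.

(** The sets that can be approximated in this way form a sigma-algebra, which
    contains the open sets. *)
Lemma finite_measure_regular A : measurable A -> regular_set A.
Proof.
apply: smallest_sub; last by move=> U; exact: regular_open.
split => //.
- by apply: regular_open; exact: open0.
- by move=> B; rewrite setTD; exact: regular_setC.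
- exact: regular_bigcup.
Qed.

End regularity.

(** * A maximal inequality in continuous time *)

(** The lower limit of the events is an increasing union of sets each contained
    in some E k. *)
Lemma measure_bigcup_inter_le {R : realType} {d} {T : measurableType d}
    (P : {measure set T -> \bar R}) (E : nat -> set T) (c : \bar R) :
  (forall k, measurable (E k)) -> (forall k, P (E k) <= c)%E ->
  measurable (\bigcup_j \bigcap_(k in [set k | (j <= k)%N]) E k) /\
  (P (\bigcup_j \bigcap_(k in [set k | (j <= k)%N]) E k) <= c)%E.
Proof.
move=> mE Ec; pose C j := \bigcap_(k in [set k | (j <= k)%N]) E k.
have mC j : measurable (C j) by apply: bigcap_measurable => //; exists j => /=.
have mU : measurable (\bigcup_j C j) by exact: bigcupT_measurable.
split=> //; have ndC : nondecreasing_seq C.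
  move=> i j ij; apply/subsetPset => x h k /= jk; apply: h => /=.
  exact: leq_trans jk.
have cv := nondecreasing_cvg_mu mC mU ndC (mu := P).
apply: (cvge_le _ cv); apply: nearW => j /=.
apply: le_trans (Ec j); apply: le_measure; rewrite ?inE// => x h.
by apply: h => /=.
Qed.

Lemma cvg_seq_at_right {R : realType} (u : nat -> R) (p : R) :
  (forall n, p < u n) -> u @ \oo --> p -> u @ \oo --> p^'+.
Proof.
move=> pu up A pA; have [N _ HN] := up [set x | p < x -> A x] pA.
by exists N => // n Nn; exact: (HN n Nn (pu n)).
Qed.

Section semicontinuity.
Context {R : realType} {d : nat} {d0 : measure_display} {Om : measurableType d0}
  {P : probability Om R}.
Variable X : R -> {RV P >-> 'rV[R]_d}.
Hypothesis hX : levy_process X.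
Hypothesis hX0 : {ae P, forall w, X 0 w = 0}.
Local Notation Q := (levy_transition X).

(** By right-continuity of X at 0, y k + (X_(K - t) - X_(q k - t)) converges to
    x + (X_(K - t) - X_0) along each path. As V is open, the event that the
    limit is in V is contained in the lower limit of the events that the
    approximations are. *)
Lemma transition_lsc (V : set 'rV[R]_d) (K t : R) (q : nat -> R)
    (x : 'rV[R]_d) (y : nat -> 'rV[R]_d) (c : \bar R) :
  open V -> (forall k, t < q k <= K) -> q @ \oo --> t -> y @ \oo --> x ->
  (c < Q (K - t) x V)%E -> exists m, forall k, (m <= k)%N ->
  (c < Q (K - q k) (y k) V)%E.
Proof.
move=> oV qK qt yx cQ.
have mV := open_measurable_rV oV.
have tK : 0 <= K - t by have /andP[? ?] := qK 0%N; lra.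
pose E k : set Om := (fun w => y k + increment X (q k - t) (K - t) w) @^-1` V.
have mE k : measurable (E k).
  by apply: (measurable_shift_preimage _ _ mV); exact: measurable_increment.
have PE k : P (E k) = Q (K - q k) (y k) V.
  have /andP[tq qk] := qK k.
  rewrite -(@transition_increment _ _ _ _ _ _ hX hX0 (q k - t))//; [|lra..].
  by rewrite (_ : q k - t + (K - q k) = K - t)//; ring.
pose C j := \bigcap_(k in [set k | (j <= k)%N]) E k.
have mC j : measurable (C j) by apply: bigcap_measurable => //; exists j => /=.
have mU : measurable (\bigcup_j C j) by exact: bigcupT_measurable.
have ndC : nondecreasing_seq C.
  move=> i j ij; apply/subsetPset => w h k /= jk; apply: h => /=.
  exact: leq_trans jk.
have sub : (fun w => x + increment X 0 (K - t) w) @^-1` V `<=` \bigcup_j C j.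
  move=> w /= Vw.
  have q0 : (q k - t) @[k --> \oo] --> (0:R)^'+.
    apply: cvg_seq_at_right; first by move=> k; have /andP[? _] := qK k; rewrite subr_gt0.
    by rewrite -(subrr t); apply: cvgB => //; exact: cvg_cst.
  have Xq : X (q k - t) w @[k --> \oo] --> X 0 w.
    by have [r _] := levy_cadlag hX w; exact: (cvg_comp _ _ q0 (r 0 (lexx 0))).
  have : y k + increment X (q k - t) (K - t) w @[k --> \oo] -->
      x + increment X 0 (K - t) w.
    by apply: cvgD => //; apply: cvgB => //; exact: cvg_cst.
  move=> /(_ V)[]; first exact: open_nbhs_nbhs.
  by move=> j _ jV; exists j => // k /= jk; exact: jV.
have cU : (c < P (\bigcup_j C j))%E.
  apply: lt_le_trans cQ _.
  rewrite -(@transition_increment _ _ _ _ _ _ hX hX0 0)// add0r.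
  apply: le_measure; rewrite ?inE//.
  by apply: (measurable_shift_preimage _ _ mV); exact: measurable_increment.
have cv := nondecreasing_cvg_mu mC mU ndC (mu := P).
have : \forall k \near \oo, (c < P (C k))%E.
  by apply: (cv [set u | (c < u)%E]); exact: open_ereal_gt'.
move=> [m _ /(_ m (leqnn m)) cm]; exists m => k mk.
apply: (lt_le_trans cm); rewrite -PE; apply: le_measure; rewrite ?inE//.
by move=> w h; exact: h.
Qed.

End semicontinuity.

Section maximal_inequality.
Context {R : realType} {d : nat} {d1 : measure_display} {T : measurableType d1}
  {P : probability T R}.
Variables (Q : R -> 'rV[R]_d -> set 'rV[R]_d -> \bar R) (Y : R -> {RV P >-> 'rV[R]_d}).
Hypothesis mQ : forall t A, measurable A -> measurable_fun setT (fun x => Q t x A).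
Hypothesis mY : markov_process Q Y.

(** The inequality of Doob for the martingale Q_(K - t_j)(Y_(t_j), V):
    decompose according to the first j at which it exceeds c, and use the
    Markov property at t_j. *)
Lemma markov_maximal (K c : R) (V : set 'rV[R]_d) (t : nat -> R) :
  0 <= c -> measurable V -> (forall j, 0 <= t j <= K) -> {homo t : i j / (i <= j)%N >-> i <= j} ->
  let E := \bigcup_j [set w | (c%:E < Q (K - t j) (Y (t j) w) V)%E] in
  measurable E /\ (c%:E * P E <= P (Y K @^-1` V))%E.
Proof.
move=> c0 mV tK tmono E.
pose A j : set T := [set w | (c%:E < Q (K - t j) (Y (t j) w) V)%E].
have mB j : measurable [set x : 'rV[R]_d | (c%:E < Q (K - t j) x V)%E].
  rewrite -[X in measurable X]setTI.
  by apply: emeasurable_fun_o_infty => //; exact: mQ.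
have mA j : measurable (A j) by exact: (measurable_preimageT (measurable_funP (Y (t j))) (mB j)).
have mD j : measurable (seqDU A j).
  by apply: measurableD => //; exact: bigsetU_measurable.
have mE : measurable E by exact: bigcupT_measurable.
split=> //; rewrite /E seqDU_bigcup_eq measure_bigcup; last 2 first.
- by move=> j _; exact: mD.
- exact: trivIset_seqDU.
have mYV : measurable (Y K @^-1` V) by exact: measurable_preimageT.
have mDV j : measurable (seqDU A j `&` Y K @^-1` V) by exact: measurableI.
apply: (@le_trans _ _ (P (\bigcup_j (seqDU A j `&` Y K @^-1` V)))); last first.
  apply: le_measure; rewrite ?inE//; first exact: bigcupT_measurable.
  by move=> w [j _ []].
rewrite measure_bigcup//; last first.
  apply/trivIsetP => i j _ _ ij.
  have /trivIsetP/(_ i j I I ij) h := @trivIset_seqDU _ A.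
  apply/seteqP; split=> w //= [[Di _] [Dj _]].
  by have : (seqDU A i `&` seqDU A j) w by []; rewrite h.
rewrite -nneseriesZl//.
apply: lee_nneseries => [j _ _|j _]; first by rewrite mule_ge0.
have /andP[t0 tk] := tK j.
have pD : past_events Y (t j) (seqDU A j).
  pose TG := g_sigma_algebraType (past_gen Y (t j)).
  have pA i : (i <= j)%N -> @measurable _ TG (A i).
    move=> ij; apply: sub_sigma_algebra; exists (t i).
      by rewrite /= in_itv/= tmono//; have /andP[-> _] := tK i.
    by exists [set x | (c%:E < Q (K - t i) x V)%E]; rewrite ?setTI.
  apply: (@measurableD _ TG); first exact: pA.
  by apply: (@bigsetU_measurable _ TG) => i _; apply: pA; exact: ltnW.
have tk0 : 0 <= K - t j by rewrite subr_ge0.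
have := mY; move=> /(_ _ _ _ _ t0 tk0 mV pD) E1; rewrite [t j + _]addrC subrK in E1.
apply: (@le_trans _ _ (\int[P]_(w in seqDU A j) Q (K - t j) (Y (t j) w) V)%E); last first.
  by rewrite le_eqVlt; apply/orP; left; apply/eqP; exact/esym.
rewrite -integral_cst//; apply: ge0_le_integral => //; last by move=> w [/ltW].
by apply: measurable_funTS; exact: (measurableT_comp (mQ (K - t j) mV)).
Qed.

End maximal_inequality.

Section grid.
Context {R : realType}.

(** The first multiple of K / (n + 1) that is strictly after t. *)
Definition next_grid (K : R) (n : nat) (t : R) : R :=
  K * (Num.trunc (t / K * n.+1%:R)).+1%:R / n.+1%:R.

Lemma next_grid_gt K n t : 0 < K -> 0 <= t -> t < next_grid K n t.
Proof.
move=> K0 t0; rewrite /next_grid ltr_pdivlMr// mulrC -ltr_pdivrMl// mulrC.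
by rewrite mulrA [K^-1 * t]mulrC; exact: truncnS_gt.
Qed.

Lemma next_grid_le_add K n t : 0 < K -> 0 <= t -> next_grid K n t <= t + K / n.+1%:R.
Proof.
move=> K0 t0; rewrite /next_grid ler_pdivrMr// mulrDl divfK ?gt_eqF//.
rewrite -[in leLHS]addn1 natrD mulrDr mulr1 lerD2r mulrC -ler_pdivlMr//.
by rewrite mulrAC truncn_le// !mulr_ge0// invr_ge0 ltW.
Qed.

Lemma next_grid_le K n t : 0 < K -> 0 <= t < K -> next_grid K n t <= K.
Proof.
move=> K0 /andP[t0 tK]; rewrite /next_grid ler_pdivrMr// ler_pM2l// ler_nat.
rewrite truncn_lt_nat ?mulr_ge0 ?invr_ge0 ?(ltW K0)//.
by rewrite gtr_pMl// ltr_pdivrMr// mul1r.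
Qed.

Lemma next_grid_cvg K t : 0 < K -> 0 <= t -> next_grid K n t @[n --> \oo] --> t.
Proof.
move=> K0 t0; apply: (@squeeze_cvgr _ _ _ _ (cst t) (fun n => t + K / n.+1%:R)).
- by apply: nearW => n; rewrite (ltW (next_grid_gt _ _ _))// next_grid_le_add.
- exact: cvg_cst.
rewrite -[X in _ --> X]addr0; apply: cvgD; first exact: cvg_cst.
by rewrite -(mulr0 K); apply: cvgM; [exact: cvg_cst|exact: cvg_harmonic].
Qed.

Definition grid_time (K : R) (n j : nat) : R := Num.min K (K * j.+1%:R / n.+1%:R).

Lemma next_gridE K n t : 0 < K -> 0 <= t < K ->
  next_grid K n t = grid_time K n (Num.trunc (t / K * n.+1%:R)).
Proof. by move=> K0 tK; rewrite /grid_time min_r//; exact: next_grid_le. Qed.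

Lemma grid_time_itv K n j : 0 < K -> 0 <= grid_time K n j <= K.
Proof.
move=> K0; rewrite /grid_time ge_min lexx/= andbT le_min ltW//=.
by rewrite !mulr_ge0// ltW.
Qed.

Lemma grid_time_homo K n : 0 < K -> {homo grid_time K n : i j / (i <= j)%N >-> i <= j}.
Proof.
move=> K0 i j ij; rewrite /grid_time le_min ge_min lexx/= ge_min.
by rewrite ler_pM2r ?invr_gt0// ler_pM2l// ler_nat ltnS ij orbT.
Qed.

End grid.

Section hitting.
Context {R : realType} {d : nat} {d0 : measure_display} {Om : measurableType d0}
  {P : probability Om R}.
Variable X : R -> {RV P >-> 'rV[R]_d}.
Hypothesis hX : levy_process X.
Hypothesis hX0 : {ae P, forall w, X 0 w = 0}.
Local Notation Q := (levy_transition X).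
Context {d1 : measure_display} {T : measurableType d1} {P' : probability T R}.

(** If the martingale exceeds 1/3 at a time t, then by [transition_lsc] it does
    so at the next point of every fine enough grid. So the event is contained
    in a lower limit of events to which [markov_maximal] applies, and only
    countably many times have been used. *)
Lemma exceedance_bound (Y : R -> {RV P' >-> 'rV[R]_d}) (K e : R) (V : set 'rV[R]_d) :
  markov_process Q Y -> (forall w, cadlag (Y ^~ w)) -> 0 < K -> open V ->
  (P' (Y K @^-1` V) <= e%:E)%E ->
  exists B, [/\ measurable B, (P' B <= (3 * e)%:E)%E &
    forall w t, 0 <= t < K -> (3^-1%:E < Q (K - t) (Y t w) V)%E -> B w].
Proof.
move=> mY cY K0 oV PV; have mV := open_measurable_rV oV.
pose E n := \bigcup_j [set w |
  (3^-1%:E < Q (K - grid_time K n j) (Y (grid_time K n j) w) V)%E].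
have mQ t A : measurable A -> measurable_fun setT (fun x => Q t x A).
  exact: measurable_transition.
have HE n : measurable (E n) /\ (3^-1%:E * P' (E n) <= P' (Y K @^-1` V))%E.
  apply: (markov_maximal mQ mY _ mV); first by rewrite invr_ge0.
    by move=> j; exact: grid_time_itv.
  exact: grid_time_homo.
have mE n : measurable (E n) by have [] := HE n.
have PE n : (P' (E n) <= (3 * e)%:E)%E.
  have [_ h] := HE n.
  rewrite EFinM -lee_pdivrMl//; exact: (le_trans h).
have [mB PB] := measure_bigcup_inter_le mE PE.
exists (\bigcup_j \bigcap_(k in [set k | (j <= k)%N]) E k); split => //.
move=> w t tK cQ; have /andP[t0 tK'] := tK.
have [m Hm] : exists m, forall k, (m <= k)%N ->
    (3^-1%:E < Q (K - next_grid K k t) (Y (next_grid K k t) w) V)%E.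
  apply: (@transition_lsc _ _ _ _ _ _ hX hX0 V K t
    (fun k => next_grid K k t) (Y t w)) => //.
  - by move=> k; rewrite next_grid_gt// next_grid_le.
  - exact: next_grid_cvg.
  - have [r _] := cY w; apply: (cvg_comp _ _ _ (r t t0)).
    apply: cvg_seq_at_right; last exact: next_grid_cvg.
    by move=> k; exact: next_grid_gt.
exists m => // k /= mk; rewrite /E.
by exists (Num.trunc (t / K * k.+1%:R)) => //=; rewrite -next_gridE//; exact: Hm.
Qed.

End hitting.

(** * A successful coupling yields an absolutely continuous component *)

Section coupling_implies_ac.
Context {R : realType} {d : nat} {d0 : measure_display} {Om : measurableType d0}
  {P : probability Om R}.
Variable X : R -> {RV P >-> 'rV[R]_d}.
Hypothesis hX : levy_process X.
Hypothesis hX0 : {ae P, forall w, X 0 w = 0}.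
Local Notation Q := (levy_transition X).
Local Notation lam := (@lebesgue_rV R d).

Lemma markov_law {d1} {T : measurableType d1} {P' : probability T R}
    (Y : R -> {RV P' >-> 'rV[R]_d}) (mu : probability 'rV[R]_d R) t A :
  markov_process Q Y -> initial_distribution Y mu -> 0 <= t -> measurable A ->
  (P' (Y t @^-1` A) = \int[mu]_x Q t x A)%E.
Proof.
move=> mY iY t0 mA.
have pT : past_events Y 0 setT.
  exact: (@measurableT _ (g_sigma_algebraType (past_gen Y 0))).
have := mY 0 t A setT (lexx 0) t0 mA pT; rewrite setTI add0r => ->.
have mQA := measurable_transition (P := P) X t mA.
rewrite -[LHS](@ge0_integral_distribution _ _ _ _ _ P' (Y 0) (fun x => Q t x A))//.
by apply: eq_measure_integral => B mB _; exact: iY.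
Qed.

(** An absolutely continuous law stays so after the addition of an independent
    variable: integrate over the starting point first. *)
Lemma transition_subset0 (mu : probability 'rV[R]_d R) t N : measurable N -> lam N = 0%E ->
  (forall A, measurable A -> lam A = 0%E -> mu A = 0%E) ->
  (\int[mu]_x Q t x N = 0)%E.
Proof.
move=> mN lN mul.
pose S : set ('rV[R]_d * 'rV[R]_d) := [set p | N (p.1 + p.2)].
have mS : measurable S.
  have mD : measurable_fun setT (fun p : 'rV[R]_d * 'rV[R]_d => p.1 + p.2).
    exact: measurable_rVD.
  exact: (measurable_preimageT mD mN).
have -> : (\int[mu]_x Q t x N = (mu \x levy_law X t) S)%E.
  apply: eq_integral => x _ /=; rewrite levy_lawE; congr (levy_law X t _).
  by apply/seteqP; split=> z /=; rewrite /xsection/= inE.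
have -> : ((mu \x levy_law X t) S = (mu \x^ levy_law X t) S)%E.
  apply: product_measure_unique => // A B mA mB; exact: product_measure2E.
rewrite /product_measure2; apply: integral0_eq => u _ /=.
apply: mul; first exact: measurable_ysection.
rewrite -[RHS]lN -(lebesgue_rV_translate u mN); congr (lam _).
by apply/seteqP; split=> z /=; rewrite /ysection/= inE /S/= addrC.
Qed.

(** The bound 1/3 in [exceedance_bound] serves here: U and the complement of F
    cover the space, so from a common position one of the two is reached with
    probability at least 1/2. *)
Lemma no_hitting {d1} {T : measurableType d1} {P' : probability T R}
    (Y Z : R -> {RV P' >-> 'rV[R]_d}) (K e : R) (N : set 'rV[R]_d) :
  markov_process Q Y -> markov_process Q Z ->
  (forall w, cadlag (Y ^~ w)) -> (forall w, cadlag (Z ^~ w)) ->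
  0 < K -> 0 < e -> measurable N ->
  P' (Y K @^-1` (~` N)) = 0%E -> P' (Z K @^-1` N) = 0%E ->
  exists B, [/\ measurable B, (P' B <= e%:E)%E &
    forall w t, 0 <= t < K -> Y t w = Z t w -> B w].
Proof.
move=> mY mZ cY cZ K0 e0 mN YN ZN.
(* each exceptional event will have probability at most 3 * (e / 6) *)
have e60 : 0 < e / 6 by rewrite divr_gt0.
have [F [U1 [cF oU1 FN NU1 mF]]] :=
  @finite_measure_regular _ _ (distribution P' (Y K)) N mN _ e60.
have [F2 [U [cF2 oU F2N NU mU]]] :=
  @finite_measure_regular _ _ (distribution P' (Z K)) N mN _ e60.
have mnF : measurable (~` F) by apply: measurableC; exact: closed_measurable_rV.
have mUo : measurable U by exact: open_measurable_rV.
have mU1 : measurable (U1 `\` F).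
  by apply: measurableD; [exact: open_measurable_rV|exact: closed_measurable_rV].
have mU2 : measurable (U `\` F2) by apply: measurableD => //; exact: closed_measurable_rV.
have YF : (P' (Y K @^-1` (~` F)) <= (e / 6)%:E)%E.
  change (distribution P' (Y K) (~` F) <= (e / 6)%:E)%E.
  apply: (@le_trans _ _ (distribution P' (Y K) (~` N `|` (U1 `\` F)))).
    apply: le_measure; rewrite ?inE//; first by apply: measurableU => //; exact: measurableC.
    by move=> z nF; have [Nz|] := pselect (N z); [right; split => //; exact: NU1|left].
  apply: (le_trans (measureU2 _ (measurableC mN) mU1)).
  rewrite -[leRHS]add0e; apply: leeD; last exact: ltW.
  by rewrite le_eqVlt; apply/orP; left; apply/eqP.
have ZU : (P' (Z K @^-1` U) <= (e / 6)%:E)%E.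
  change (distribution P' (Z K) U <= (e / 6)%:E)%E.
  apply: (@le_trans _ _ (distribution P' (Z K) (N `|` (U `\` F2)))).
    apply: le_measure; rewrite ?inE//; first exact: measurableU.
    move=> z Uz; have [Nz|nN] := pselect (N z); [by left|right; split => //].
    by move=> /F2N.
  apply: (le_trans (measureU2 _ mN mU2)).
  rewrite -[leRHS]add0e; apply: leeD; last exact: ltW.
  by rewrite le_eqVlt; apply/orP; left; apply/eqP.
have [B1 [mB1 PB1 HB1]] := exceedance_bound hX hX0 mY cY K0 (closed_openC cF) YF.
have [B2 [mB2 PB2 HB2]] := exceedance_bound hX hX0 mZ cZ K0 oU ZU.
exists (B1 `|` B2); split; first exact: measurableU.
  apply: (le_trans (measureU2 _ mB1 mB2)); apply: (le_trans (leeD PB1 PB2)).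
  by rewrite -EFinD lee_fin; lra.
move=> w t tK YZ; apply: contrapT => nB.
have Q1 : (Q (K - t) (Y t w) (~` F) <= 3^-1%:E)%E.
  by rewrite leNgt; apply/negP => /(HB1 _ _ tK) ?; apply: nB; left.
have Q2 : (Q (K - t) (Y t w) U <= 3^-1%:E)%E.
  by rewrite YZ leNgt; apply/negP => /(HB2 _ _ tK) ?; apply: nB; right.
have mx : measurable_fun setT (fun z => Y t w + z) by exact: measurable_rVD.
(* F is contained in U, so U and the complement of F cover the space *)
have : (levy_law X (K - t) setT <= 3^-1%:E + 3^-1%:E)%E.
  apply: (@le_trans _ _ (levy_law X (K - t) ((fun z => Y t w + z) @^-1` (~` F) `|`
     (fun z => Y t w + z) @^-1` U))).
    apply: le_measure; rewrite ?inE//.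
      by apply: measurableU; exact: (measurable_preimageT mx).
    move=> z _; have [Fz|] := pselect (F (Y t w + z)); last by left.
    by right; apply: NU; exact: FN.
  apply: (le_trans (measureU2 _ (measurable_preimageT mx mnF) (measurable_preimageT mx mUo))).
  exact: leeD Q1 Q2.
have -> : levy_law X (K - t) setT = 1%E by exact: probability_setT.
by rewrite -EFinD lee_fin; lra.
Qed.

Definition unit_cube : set 'rV[R]_d := [set v | forall i, `[0, 1]%classic (v ord0 i)].

Lemma measurable_unit_cube : measurable unit_cube.
Proof.
rewrite (_ : unit_cube =
  \bigcap_(i : 'I_d) (fun v : 'rV[R]_d => v ord0 i) @^-1` `[0, 1]%classic).
  apply: fin_bigcap_measurable => // i _.
  by apply: measurable_preimageT => //; exact: rV_coord_measurable.
by apply/seteqP; split=> v h i => [_|]; exact: h.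
Qed.

Definition unit_cube_law : set 'rV[R]_d -> \bar R := mrestr lam measurable_unit_cube.

HB.instance Definition _ := Measure.on unit_cube_law.

Let unit_cube_lawT : unit_cube_law setT = 1%E.
Proof.
rewrite /unit_cube_law /mrestr setTI.
rewrite (lebesgue_rV_rectangle (A := fun=> `[0, 1]%classic))//.
by rewrite big1// => i _; rewrite /= lebesgue_measure_itv/= lte01 sube0.
Qed.

HB.instance Definition _ := Measure_isProbability.Build _ _ _ unit_cube_law unit_cube_lawT.

Lemma unit_cube_law_ac A : measurable A -> lam A = 0%E -> unit_cube_law A = 0%E.
Proof.
move=> mA lA; apply/eqP; rewrite eq_le measure_ge0 andbT -lA.
apply: le_measure; rewrite ?inE//; apply: measurableI => //.
exact: measurable_unit_cube.
Qed.

(** If all laws were singular, [no_hitting] on [0, K[ would hold for every K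
    and with an arbitrarily small exceptional event, so the two processes would
    almost surely never meet. *)
Lemma ac_component_of_coupling : coupling_property Q ->
  exists2 t0 : R, 0 < t0 & has_ac_component (levy_law X t0).
Proof.
move=> cp; apply: contrapT => H.
have sing K : 0 < K -> mutually_singular (levy_law X K) lam.
  by move=> K0; apply: contrapT => ns; apply: H; exists K.
have [d1 [T [P' [Y [Z [[mY mZ cY cZ] iY iZ suc]]]]]] := cp \d_(0 : 'rV[R]_d) unit_cube_law.
have /choice[B HB] : forall kj : nat * nat, exists B, [/\ measurable B,
    (P' B <= (kj.2.+1%:R^-1)%:E)%E &
    forall w t, 0 <= t < kj.1.+1%:R -> Y t w = Z t w -> B w].
  move=> [k j]; have K0 : 0 < k.+1%:R :> R by [].
  have [N [mN lN lamN]] := sing _ K0.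
  have mnN : measurable (~` N) by exact: measurableC.
  apply: (no_hitting (N := N)) => //.
  - rewrite (markov_law mY iY)// integral_dirac//; last exact: measurable_transition.
    rewrite diracT mul1e levy_lawE -[RHS]lN; congr (levy_law X _ _).
    by apply/seteqP; split=> z /=; rewrite add0r.
  - rewrite (markov_law mZ iZ)//; apply: transition_subset0 => //.
    exact: unit_cube_law_ac.
have [N0 [mN0 PN0 sN0]] := suc.
pose C k := \bigcap_j B (k, j).
have mC k : measurable (C k) by apply: bigcapT_measurable => j; have [] := HB (k, j).
have C0 k : P' (C k) = 0%E.
  apply/eqP; rewrite eq_le measure_ge0 andbT; apply/lee_addgt0Pr => e e0.
  have [j je] := exists_natinv e0.
  have [mB PB _] := HB (k, j).
  rewrite add0e; apply: (@le_trans _ _ (P' (B (k, j)))).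
    by apply: le_measure; rewrite ?inE// => w; exact.
  by apply: (le_trans PB); rewrite lee_fin.
have : P'.-negligible setT.
  apply: (@negligibleS _ _ _ _ (N0 `|` \bigcup_k C k)); last first.
    apply: negligibleU; first by apply/negligibleP => //; exact: PN0.
    by apply: negligible_bigcup => k; apply/negligibleP => //; exact: C0.
  move=> w _; have [|nN0] := pselect (N0 w); [by left|right].
  have : (coupling_time Y Z w < +oo)%E.
    by apply: contrapT => h; apply: nN0; exact: sN0.
  move=> /ereal_inf_lt[_ [t [t0 YZ] <-] _].
  exists (Num.trunc t) => // j _.
  have [_ _] := HB (Num.trunc t, j); apply; last exact: YZ.
  by rewrite t0/=; exact: truncnS_gt.
move=> /(negligibleP _ measurableT) PT.
have : (1 : \bar R)%E = 0%E by rewrite -PT; apply/esym; exact: probability_setT.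
by move/eqP; rewrite onee_eq0.
Qed.

(** If a null set carried Q_t(x, .), then for almost every displacement u made
    during the first t - t0 units of time, a translate of it would carry the
    law of X_t0. *)
Lemma ac_component_later t0 t x : 0 <= t0 <= t -> has_ac_component (levy_law X t0) ->
  has_ac_component (Q t x).
Proof.
move=> /andP[t00 tt0] ac [N [mN QN lN]]; apply: ac.
have mnN : measurable (~` N) by exact: measurableC.
have mx : measurable_fun setT (fun z : 'rV[R]_d => x + z) by exact: measurable_rVD.
have mA : measurable ((fun z => x + z) @^-1` (~` N)).
  exact: (measurable_preimageT mx mnN).
have s0 : 0 <= t - t0 by rewrite subr_ge0.
move: QN; rewrite levy_lawE -[t in levy_law X t](subrK t0).
rewrite (levy_law_convolution hX hX0 s0 t00 mA) /product_measure1.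
set S := [set p | _]; set f := (_ \o _).
have mS : measurable S.
  have mD : measurable_fun setT (fun p : 'rV[R]_d * 'rV[R]_d => p.1 + p.2).
    exact: measurable_rVD.
  exact: (measurable_preimageT mD mA).
have mf : measurable_fun setT f by exact: measurable_fun_xsection.
move=> int0.
have [u fu0] : exists u, f u = 0%E.
  apply: contrapT => nf.
  have f0 u : (0 <= f u)%E by rewrite /f/=; exact: measure_ge0.
  have : (\int[levy_law X (t - t0)]_u `|f u| = 0)%E.
    by rewrite -[RHS]int0; apply: eq_integral => u _; rewrite gee0_abs.
  move=> /(ae_eq_integral_abs _ measurableT mf)[Z [mZ Z0 fZ]].
  have : (levy_law X (t - t0) setT <= levy_law X (t - t0) Z)%E.
    apply: le_measure; rewrite ?inE// => v _; apply: fZ => /= fv.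
    by apply: nf; exists v; exact: fv.
  have lT : levy_law X (t - t0) setT = 1%E by exact: probability_setT.
  have lZ : levy_law X (t - t0) Z = 0%E by exact: Z0.
  by rewrite lT lZ lee_fin ler10.
exists ((fun z => (x + u) + z) @^-1` N).
have mxu : measurable_fun setT (fun z : 'rV[R]_d => x + u + z) by exact: measurable_rVD.
have mN' : measurable ((fun z => (x + u) + z) @^-1` N).
  exact: (measurable_preimageT mxu mN).
split => //; last by rewrite lebesgue_rV_translate.
rewrite -fu0; congr (levy_law X t0 _).
by apply/seteqP; split=> z /=; rewrite /xsection/= inE /S/= addrA.
Qed.

End coupling_implies_ac.

(** * Cadlag paths from their values at rational times *)

Section path_regularization.
Context {R : realType} {d : nat}.
Implicit Types (x : rat -> 'rV[R]_d) (t : R).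

(** On short rational intervals, two consecutive oscillations are never both
    large. This holds for restrictions of cadlag paths and forces the existence
    of one-sided limits, while it only quantifies over countable sets and so is
    a measurable condition. *)
Definition rat_modulus x := forall e N : nat, exists j : nat, forall p q r : rat,
  [/\ 0 <= p, p < q, q < r, r <= N%:R & r - p < j.+1%:R^-1] ->
  `|x q - x p| <= e.+1%:R^-1 \/ `|x r - x q| <= e.+1%:R^-1.

(** The rational form of [next_grid] with K = 1; the division by 1 keeps the
    two formulas alike. *)
Definition rat_grid (n : nat) t : rat := (Num.trunc (t / 1 * n.+1%:R)).+1%:R / n.+1%:R.

Lemma rat_gridE n t : ratr (rat_grid n t) = next_grid 1 n t.
Proof. by rewrite /rat_grid /next_grid mul1r rmorphM/= fmorphV/= !ratr_nat. Qed.

Lemma rat_grid_cvg t : 0 <= t -> ratr (rat_grid n t) @[n --> \oo] --> t.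
Proof. by move=> t0; under eq_fun do rewrite rat_gridE; exact: next_grid_cvg. Qed.

Lemma rat_grid_gt n t : 0 <= t -> t < ratr (rat_grid n t).
Proof. by move=> t0; rewrite rat_gridE next_grid_gt. Qed.

Lemma rat_modulusP x : rat_modulus x -> forall (e : R) (N : nat), 0 < e ->
  exists2 dl : R, 0 < dl & forall p q r : rat,
  [/\ 0 <= p, p < q, q < r, r <= N%:R & ratr r - ratr p < dl] ->
  `|x q - x p| <= e \/ `|x r - x q| <= e.
Proof.
move=> xm e N e0; have [k ke] := exists_natinv e0.
have [j jP] := xm k N; exists j.+1%:R^-1; first by rewrite invr_gt0.
move=> p q r [p0 pq qr rN rp].
have rp' : r - p < j.+1%:R^-1.
  by rewrite -(@ltr_rat R) rmorphB/= fmorphV/= ratr_nat.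
have [h|h] := jP p q r (And5 p0 pq qr rN rp').
  by left; exact: le_trans ke.
by right; exact: le_trans ke.
Qed.

(** Whatever the reference value a, one of two values far apart is far from a. *)
Lemma far_from_one (u v a : 'rV[R]_d) (e : R) : e < `|u - v| ->
  e / 2 < `|u - a| \/ e / 2 < `|v - a|.
Proof.
move=> euv; apply: contrapT => /not_orP[/negP + /negP]; rewrite -!leNgt => ua va.
move: euv; rewrite ltNge => /negP; apply.
by rewrite (le_trans (ler_distD a _ _))// [`|a - v|]distrC; lra.
Qed.

(** Otherwise there would be oscillations of size e arbitrarily close to t on
    its right; two of them, the second closer to t than the first, yield two
    consecutive large oscillations. *)
Lemma rat_modulus_right x t (e : R) : rat_modulus x -> 0 <= t -> 0 < e ->
  exists2 dl : R, 0 < dl & forall p q : rat,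
  t < ratr p < t + dl -> t < ratr q < t + dl -> `|x p - x q| <= e.
Proof.
move=> xm t0 e0; have e20 : 0 < e / 2 by rewrite divr_gt0.
have [dl dl0 H] := rat_modulusP xm (Num.trunc t).+2 e20.
have dm0 : 0 < Num.min 1 dl by rewrite lt_min ltr01 dl0.
apply: contrapT => nH.
(* oscillations of size e occur in every right neighbourhood of t *)
have osc (s : R) : 0 < s -> exists p q : rat, [/\ t < ratr p < t + s,
    t < ratr q < t + s, p < q & e < `|x p - x q|].
  move=> s0; apply: contrapT => nE; apply: nH; exists s => // p q tp tq.
  rewrite leNgt; apply/negP => epq; apply: nE.
  have [pq|qp|pq] := ltgtP p q.
  - by exists p, q.
  - by exists q, p; rewrite distrC.
  - by move: epq; rewrite pq subrr normr0 ltNge ltW.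
have [a [b [/andP[ta _] /andP[tb bd] ab eab]]] := osc _ dm0.
have at0 : 0 < ratr a - t by rewrite subr_gt0.
have [u [v [/andP[tu ua] /andP[tv va] uv euv]]] := osc _ at0.
have [w [tw wa ew]] : exists w : rat, [/\ t < ratr w, ratr w < ratr a :> R
    & e / 2 < `|x w - x a|].
  rewrite addrC subrK in ua va.
  by have [h|h] := far_from_one (x a) euv; [exists u|exists v].
have w0 : 0 <= w by rewrite -(@ler0q R) (le_trans t0)// ltW.
rewrite ltr_rat in wa.
have tt : t < (Num.trunc t).+1%:R by exact: truncnS_gt.
have bN : b <= (Num.trunc t).+2%:R.
  rewrite -(@ler_rat R) ratr_nat (le_trans (ltW bd))//.
  rewrite -[(Num.trunc t).+2]addn1 natrD lerD//; first exact: ltW.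
  by rewrite ge_min lexx.
have bw : ratr b - ratr w < dl.
  have : Num.min 1 dl <= dl by rewrite ge_min lexx orbT.
  by move: bd tw; clear; lra.
have [h|h] := H w a b (And5 w0 wa ab bN bw).
  by move: ew; rewrite distrC ltNge h.
by move: eab; rewrite distrC ltNge (le_trans h)//; lra.
Qed.

(** The mirror image of [rat_modulus_right]. *)
Lemma rat_modulus_left x t (e : R) : rat_modulus x -> 0 < t -> 0 < e ->
  exists2 dl : R, 0 < dl <= t & forall p q : rat,
  t - dl < ratr p < t -> t - dl < ratr q < t -> `|x p - x q| <= e.
Proof.
move=> xm t0 e0; have e20 : 0 < e / 2 by rewrite divr_gt0.
have [dl dl0 H] := rat_modulusP xm (Num.trunc t).+1 e20.
have dm0 : 0 < Num.min t dl by rewrite lt_min t0 dl0.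
apply: contrapT => nH.
have osc (s : R) : 0 < s -> s <= t -> exists p q : rat, [/\ t - s < ratr p < t,
    t - s < ratr q < t, p < q & e < `|x p - x q|].
  move=> s0 st; apply: contrapT => nE; apply: nH; exists s; first by rewrite s0.
  move=> p q tp tq.
  rewrite leNgt; apply/negP => epq; apply: nE.
  have [pq|qp|pq] := ltgtP p q.
  - by exists p, q.
  - by exists q, p; rewrite distrC.
  - by move: epq; rewrite pq subrr normr0 ltNge ltW.
have mt : Num.min t dl <= t by rewrite ge_min lexx.
have md : Num.min t dl <= dl by rewrite ge_min lexx orbT.
have [a [b [/andP[ta _] /andP[tb bt] ab eab]]] := osc _ dm0 mt.
have at0 : 0 < t - ratr b by rewrite subr_gt0.
have b0 : t - ratr b <= t by move: tb mt; clear; lra.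
have [u [v [/andP[tu ut] /andP[tv vt] uv euv]]] := osc _ at0 b0.
have [w [bw wt ew]] : exists w : rat, [/\ ratr b < ratr w :> R, ratr w < t
    & e / 2 < `|x w - x b|].
  rewrite opprB addrC subrK in tu tv.
  by have [h|h] := far_from_one (x b) euv; [exists u|exists v].
have a0 : 0 <= a.
  by rewrite -(@ler0q R); move: ta mt; clear; lra.
rewrite ltr_rat in bw.
have wN : w <= (Num.trunc t).+1%:R.
  by rewrite -(@ler_rat R) ratr_nat (le_trans (ltW wt))// ltW// truncnS_gt.
have wa : ratr w - ratr a < dl by move: ta wt md; clear; lra.
have [h|h] := H a b w (And5 a0 ab bw wN wa).
  by move: eab; rewrite distrC ltNge (le_trans h)//; lra.
by move: ew; rewrite ltNge h.
Qed.

(** Approaching t from the right along rational times makes the path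
    right-continuous. *)
Definition path_of x t : 'rV[R]_d := lim (x (rat_grid n t) @[n --> \oo]).

Lemma dist_lim_le (u : nat -> 'rV[R]_d) (l a : 'rV[R]_d) (e : R) :
  u @ \oo --> l -> (\forall n \near \oo, `|a - u n| <= e) -> `|a - l| <= e.
Proof.
move=> ul ue.
have h : `|a - u n| @[n --> \oo] --> `|a - l|.
  by apply: cvg_norm; apply: cvgB => //; exact: cvg_cst.
exact: (cvgr_to_le h ue).
Qed.

Lemma near_rat_grid t (dl : R) : 0 <= t -> 0 < dl ->
  \forall n \near \oo, t < ratr (rat_grid n t) < t + dl.
Proof.
move=> t0 dl0; have /cvgrPdist_lt/(_ _ dl0) := rat_grid_cvg t0.
apply: filterS => n; rewrite distrC ger0_norm; last by rewrite subr_ge0 ltW// rat_grid_gt.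
by rewrite rat_grid_gt//= ltrBlDl.
Qed.

Lemma path_of_cvg x t : rat_modulus x -> 0 <= t ->
  x (rat_grid n t) @[n --> \oo] --> path_of x t.
Proof.
move=> xm t0; apply: cauchy_cvg; apply: cauchy_exP => e e0.
have e20 : 0 < e / 2 by rewrite divr_gt0.
have [dl dl0 H] := rat_modulus_right xm t0 e20.
have nr := near_rat_grid t0 dl0; have [n _ Hn] := nr.
exists (x (rat_grid n t)); apply: filterS nr => k tk; rewrite -ball_normE /=.
by rewrite (le_lt_trans (H _ _ (Hn n (leqnn n)) tk))//; lra.
Qed.

Lemma path_of_right x t (e : R) : rat_modulus x -> 0 <= t -> 0 < e ->
  exists2 dl : R, 0 < dl &
  forall u, t <= u < t + dl -> `|path_of x t - path_of x u| <= e.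
Proof.
move=> xm t0 e0; have [dl dl0 H] := rat_modulus_right xm t0 e0.
exists dl => // u /andP[tu udl]; have u0 : 0 <= u by exact: le_trans tu.
have ud0 : 0 < t + dl - u by rewrite subr_gt0.
apply: (dist_lim_le (path_of_cvg xm u0)).
have nu := near_rat_grid u0 ud0; apply: filterS nu => k /andP[uk kd].
rewrite distrC; apply: (dist_lim_le (path_of_cvg xm t0)).
have nt := near_rat_grid t0 dl0; apply: filterS nt => m tm.
apply: H => //; rewrite (le_lt_trans tu uk)/=.
by move: kd; rewrite addrC subrK.
Qed.

Lemma path_of_left x t (e : R) : rat_modulus x -> 0 < t -> 0 < e ->
  exists2 dl : R, 0 < dl &
  forall u v, t - dl < u < t -> t - dl < v < t -> `|path_of x u - path_of x v| <= e.
Proof.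
move=> xm t0 e0; have [dl /andP[dl0 dlt] H] := rat_modulus_left xm t0 e0.
exists dl => // u v /andP[tu ut] /andP[tv vt].
have u0 : 0 <= u by move: tu dlt; clear; lra.
have v0 : 0 <= v by move: tv dlt; clear; lra.
have ut0 : 0 < t - u by rewrite subr_gt0.
have vt0 : 0 < t - v by rewrite subr_gt0.
apply: (dist_lim_le (path_of_cvg xm v0)).
have nv := near_rat_grid v0 vt0; apply: filterS nv => k /andP[vk kt].
rewrite distrC; apply: (dist_lim_le (path_of_cvg xm u0)).
have nu := near_rat_grid u0 ut0; apply: filterS nu => m /andP[um mt].
by apply: H; apply/andP; split; move: tu tv vk kt um mt; clear; lra.
Qed.

Lemma path_of_cadlag x : rat_modulus x -> cadlag (path_of x).
Proof.
move=> xm; split=> t t0.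
  apply/cvgrPdist_le => e e0; have [dl dl0 H] := path_of_right xm t0 e0.
  have : \forall u \near t^'+, u < t + dl by apply: nbhs_right_lt; rewrite ltrDl.
  have : \forall u \near t^'+, t < u by exact: nbhs_right_gt.
  by apply: filterS2 => u tu ut; apply: H; rewrite ltW.
apply: cauchy_cvg; apply: cauchy_exP => e e0.
have e20 : 0 < e / 2 by rewrite divr_gt0.
have [dl dl0 H] := path_of_left xm t0 e20.
exists (path_of x (t - dl / 2)).
have : \forall u \near t^'-, u < t by exact: nbhs_left_lt.
have : \forall u \near t^'-, t - dl < u by apply: nbhs_left_gt; rewrite ltrBlDr ltrDl.
apply: filterS2 => u tu ut; rewrite -ball_normE/=.
rewrite (@le_lt_trans _ _ (e / 2))//; last by move: e0; clear; lra.
by apply: H; apply/andP; split => //; move: dl0; clear; lra.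
Qed.

Lemma path_of_restriction (z : R -> 'rV[R]_d) t : cadlag z -> 0 <= t ->
  path_of (fun q => z (ratr q)) t = z t.
Proof.
move=> [zr _] t0; apply: cvg_lim => //.
apply: (cvg_comp (fun n => ratr (rat_grid n t)) z); last exact: zr.
by apply: cvg_seq_at_right; [move=> n; exact: rat_grid_gt|exact: rat_grid_cvg].
Qed.

(** Near a given t the path varies little on either side of t, so of two
    consecutive oscillations only one, the one across t, can be large.
    Compactness of [0, N] makes the scale uniform. *)
Lemma cadlag_rat_modulus (z : R -> 'rV[R]_d) : cadlag z ->
  rat_modulus (fun q => z (ratr q)).
Proof.
move=> [zr zl] e N.
have e0 : 0 < e.+1%:R^-1 :> R by rewrite invr_gt0.
have e20 : 0 < e.+1%:R^-1 / 2 :> R by rewrite divr_gt0.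
set E : R := e.+1%:R^-1 in e0 e20 *.
(* the modulus at scale 1 / (j + 1) for pairs of intervals with common end s *)
pose Pr (j : nat) (s : R) := forall p r : R, 0 <= p -> p < s -> s < r ->
  r - p < j.+1%:R^-1 -> `|z s - z p| <= E \/ `|z r - z s| <= E.
have : \forall j \near \oo, `[0, N%:R]%classic `<=` Pr j.
  apply: (compact_near_coveringP _).1 => [|t]; first exact: segment_compact.
  rewrite /= in_itv/= => /andP[t0 _].
  have [dr dr0 Hr] : exists2 dr : R, 0 < dr & forall u v,
      t <= u < t + dr -> t <= v < t + dr -> `|z u - z v| <= E.
    have /cvgrPdist_le/(_ _ e20) := zr t t0.
    rewrite near_withinE => /nbhs_ballP[dr /= dr0 Hdr].
    exists dr => // u v.
    have Hu w : t <= w < t + dr -> `|z t - z w| <= E / 2.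
      move=> /andP[]; rewrite le_eqVlt => /predU1P[<- _|tw wd].
        by rewrite subrr normr0 ltW.
      by apply: Hdr => //=; rewrite /ball/= distrC ger0_norm; lra.
    move=> /Hu hu /Hu hv; rewrite (le_trans (ler_distD (z t) _ _))//.
    by rewrite [`|z u - z t|]distrC; move: hu hv; clear; lra.
  have [dl dl0 Hl] : exists2 dl : R, 0 < dl & forall u v, 0 <= u -> 0 <= v ->
      t - dl < u < t -> t - dl < v < t -> `|z u - z v| <= E.
    have [<-|tn0] := eqVneq 0 t.
      by exists 1 => // u v u0 v0 /andP[_]; rewrite ltNge u0.
    have tp : 0 < t by rewrite lt_neqAle tn0.
    have /cvg_ex[l /cvgrPdist_le/(_ _ e20)] := zl t tp.
    rewrite near_withinE => /nbhs_ballP[dl /= dl0 Hdl].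
    exists dl => // u v _ _.
    have Hu w : t - dl < w < t -> `|l - z w| <= E / 2.
      by move=> /andP[tw wt]; apply: Hdl => //=; rewrite /ball/= ger0_norm; lra.
    move=> /Hu hu /Hu hv; rewrite (le_trans (ler_distD l _ _))//.
    by rewrite [`|z u - l|]distrC; move: hu hv; clear; lra.
  have dm0 : 0 < Num.min dl dr / 2 by rewrite divr_gt0// lt_min dl0.
  have [k kd] := exists_natinv dm0.
  have ml : Num.min dl dr <= dl by rewrite ge_min lexx.
  have mr : Num.min dl dr <= dr by rewrite ge_min lexx orbT.
  exists (ball t (Num.min dl dr / 2), [set j | (k <= j)%N]) => /=.
    by split; [exact: nbhsx_ballx|exists k].
  move=> [s j] /= [ts kj] p r p0 ps sr rp.
  have jk : j.+1%:R^-1 <= Num.min dl dr / 2.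
    by apply: le_trans kd; rewrite lef_pV2 ?posrE// ler_nat.
  move: ts; rewrite /ball/= ltr_distlC => /andP[ts st].
  set iv : R := j.+1%:R^-1 in rp jk.
  set m := Num.min dl dr in ml mr jk ts st dm0.
  have [st'|ts'] := ltP s t.
    have t0' : t - dl < p by move: sr rp jk ml ts st dm0; clear; lra.
    have s0 : 0 <= s by rewrite (le_trans p0)// ltW.
    left; apply: Hl => //; rewrite ?t0' ?(lt_trans ps)//= st' andbT.
    exact: lt_trans ps.
  have rt : r < t + dr by move: ps rp jk mr ts st dm0; clear; lra.
  right; apply: Hr; rewrite ?rt ?andbT; first by rewrite (le_trans ts')// ltW.
  by rewrite ts'/= (lt_trans sr).
move=> [j _ Hj]; exists j => p q r [p0 pq qr rN rp].
have [] := Hj j (leqnn j) (ratr q) _ (ratr p) (ratr r).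
- rewrite /= in_itv/= ler0q (le_trans p0 (ltW pq))/=.
  by rewrite -(ratr_nat R) ler_rat (le_trans (ltW qr)).
- by rewrite ler0q.
- by rewrite ltr_rat.
- by rewrite ltr_rat.
- by rewrite -rmorphB/= -(ratr_nat R) -fmorphV/= ltr_rat.
- by left.
- by right.
Qed.

End path_regularization.

(** * Coding a path by a real number *)

Section ternary.
Context {R : realType}.
Implicit Types (b : nat -> bool) (r : R).
Local Open Scope ereal_scope.

(** With digits 0 and 2 only, the digits of an expansion in base 3 can be read
    off from its sum. The tail from k on is the value obtained after k
    applications of [ternary_shift]. *)
Definition ternary_tail b (k : nat) : \bar R :=
  \sum_(0 <= n <oo) ((b (n + k)%N)%:R * 2 / 3 ^+ n.+1)%R%:E.

Definition ternary_code b : R := fine (ternary_tail b 0).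

Definition ternary_shift r : R := (3 * r - 2 * (2 / 3 <= r)%R%:R)%R.

Definition ternary_digit (k : nat) r : bool := (2 / 3 <= iter k ternary_shift r)%R.

Lemma ternary_tail_ge0 b k : 0 <= ternary_tail b k.
Proof.
by apply: nneseries_ge0 => n _ _; rewrite lee_fin divr_ge0// ?mulr_ge0// exprn_ge0.
Qed.

Lemma ternary_tail_le1 b k : ternary_tail b k <= 1.
Proof.
apply: lime_le.
  by apply: is_cvg_nneseries => n _ _; rewrite lee_fin divr_ge0// ?mulr_ge0// exprn_ge0.
apply: nearW => n; rewrite sumEFin lee_fin.
apply: (@le_trans _ _ (1 - (3 ^+ n)^-1)%R); last by rewrite gerBl invr_ge0 exprn_ge0.
elim: n => [|n IH]; first by rewrite big_geq// expr0 invr1 subrr.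
rewrite big_nat_recr//=; apply: (le_trans (lerD IH (_ : _ <= 2 / 3 ^+ n.+1)%R)).
  by rewrite ler_pM2r ?invr_gt0 ?exprn_gt0//; case: (b _); rewrite ?mul1r ?mul0r.
have p0 : (3 ^+ n != 0 :> R)%R by rewrite expf_neq0.
by rewrite le_eqVlt; apply/orP; left; apply/eqP; rewrite exprS; field.
Qed.

Lemma ternary_tail_fin b k : ternary_tail b k \is a fin_num.
Proof.
by rewrite ge0_fin_numE ?ternary_tail_ge0// (le_lt_trans (ternary_tail_le1 _ _))// ltry.
Qed.

Lemma ternary_tailS b k :
  (fine (ternary_tail b k) = ((b k)%:R * 2 + fine (ternary_tail b k.+1)) / 3)%R.
Proof.
have T0 j n : 0 <= ((b (n + j)%N)%:R * 2 / 3 ^+ n.+1 : R)%R%:E.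
  by rewrite lee_fin divr_ge0// ?mulr_ge0// exprn_ge0.
apply: EFin_inj; rewrite fineK ?ternary_tail_fin// mulrDl EFinD.
rewrite /ternary_tail nneseries_recl//.
rewrite add0n (_ : (3 ^+ 1 = 3 :> R)%R)//; congr (_ + _).
rewrite mulrC EFinM fineK ?ternary_tail_fin//.
rewrite -(nneseries_addn (f := fun n => ((b (n + k)%N)%:R * 2 / 3 ^+ n.+1)%R%:E))//.
rewrite -nneseriesZl; last by move=> n _; exact: T0.
apply: eq_eseriesr => n _; rewrite -EFinM; congr EFin.
have p0 : (3 ^+ n != 0 :> R)%R by rewrite expf_neq0.
by rewrite addn1 addSnnS !exprS; field.
Qed.

(** The first digit of an expansion is 2 exactly when its value is at least
    2/3; otherwise the value is at most 1/3. *)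
Lemma ternary_tail_bit b k : (2 / 3 <= fine (ternary_tail b k))%R = b k.
Proof.
have f0 : (0 <= fine (ternary_tail b k.+1))%R by rewrite fine_ge0// ternary_tail_ge0.
have f1 : (fine (ternary_tail b k.+1) <= 1)%R.
  by rewrite -lee_fin fineK ?ternary_tail_fin// ternary_tail_le1.
rewrite ternary_tailS; case: (b k); rewrite ?mul1r ?mul0r ?add0r.
  by apply/idP; move: f0; clear; lra.
by apply/negbTE; rewrite -ltNge; move: f1; clear; lra.
Qed.

Lemma ternary_digitK b k : ternary_digit k (ternary_code b) = b k.
Proof.
rewrite /ternary_digit (_ : iter k _ _ = fine (ternary_tail b k)) ?ternary_tail_bit//.
elim: k => [//|k IH]; rewrite iterS IH /ternary_shift ternary_tail_bit.
by rewrite ternary_tailS; field.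
Qed.

Lemma measurable_ternary_code {d} {T : measurableType d} (b : T -> nat -> bool) :
  (forall n, measurable_fun setT (fun w => b w n)) ->
  measurable_fun setT (fun w => ternary_code (b w)).
Proof.
move=> mb; apply: measurableT_comp => //; apply: ge0_emeasurable_sum.
  by move=> k x _ _; rewrite lee_fin divr_ge0// ?mulr_ge0// exprn_ge0.
move=> k _; apply/measurable_EFinP; apply: measurable_funM => //.
apply: measurable_funM => //.
rewrite (_ : (fun _ => _) = fun w => if b w (k + 0)%N then 1%R else 0%R); last first.
  by apply/funext => w; case: (b w _).
exact: measurable_fun_ifT.
Qed.

Lemma measurable_ternary_digit k : measurable_fun setT (ternary_digit k).
Proof.
have ms : measurable_fun setT ternary_shift.
  apply: measurable_funB; first exact: measurable_funM.
  apply: measurable_funM => //.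
  rewrite (_ : (fun _ => _) = fun r => if (2 / 3 <= r)%R then 1%R else 0%R); last first.
    by apply/funext => w; case: (_ <= w)%R.
  by apply: measurable_fun_ifT => //; apply: measurable_fun_ler.
apply: measurable_fun_ler => //.
elim: k => [|k IH]; first exact: measurable_id.
exact: (measurableT_comp ms IH).
Qed.

End ternary.

Section countable_measurability.
Context {R : realType} {d} {T : measurableType d} {J : countType}.

Lemma measurable_forall (A : J -> T -> Prop) :
  (forall i, measurable [set x | A i x]) -> measurable [set x | forall i, A i x].
Proof.
move=> mA; rewrite -[X in measurable X]setCK; apply: measurableC.
rewrite (_ : ~` _ = \bigcup_i ~` [set x | A i x]).
  by apply: countable_bigcupT_measurable => // i; exact: measurableC.
by apply/seteqP; split=> [x /= /existsNP[i nA]|x [i _ /= nA] h]; [exists i|exact/nA/h].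
Qed.

Lemma measurable_exists (A : J -> T -> Prop) :
  (forall i, measurable [set x | A i x]) -> measurable [set x | exists i, A i x].
Proof.
move=> mA; rewrite (_ : [set x | _] = \bigcup_i [set x | A i x]).
  exact: countable_bigcupT_measurable.
by apply/seteqP; split=> [x [i Ai]|x [i _ Ai]]; exists i.
Qed.

Lemma measurable_countable_sup (f : J -> T -> \bar R) :
  (forall i, measurable_fun setT (f i)) ->
  measurable_fun setT (fun x => ereal_sup (range (f ^~ x))).
Proof.
move=> mf; apply: (measurability _ (ErealGenOInfty.measurableE R)) => //.
move=> _ [_ [r ->] <-]; rewrite setTI.
rewrite (_ : _ @^-1` _ = [set x | exists i, r%:E < f i x]%E).
  apply: measurable_exists => i.
  rewrite (_ : [set x | _] = f i @^-1` `]r%:E, +oo[).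
    by apply: (measurable_preimageT (mf i)); exact: emeasurable_itv.
  by apply/seteqP; split=> x /=; rewrite in_itv/= andbT.
apply/seteqP; split=> x /=; rewrite in_itv/= andbT.
  by move=> /ereal_sup_gt[_ [i _ <-] ri]; exists i.
by move=> [i ri]; apply: (lt_le_trans ri); apply: ereal_sup_ubound; exists i.
Qed.

End countable_measurability.

Section path_code.
Context {R : realType} {d : nat}.

(** Half-spaces bounded by rational coordinate hyperplanes determine the
    positions, and there are countably many of them. *)
Definition path_bits (z : rat -> 'rV[R]_d) (n : nat) : bool :=
  if @unpickle (rat * 'I_d * rat)%type n is Some (q, i, r)
  then ratr r < z q ord0 i else false.

(** Each coordinate is the supremum of the rationals below it. *)
Definition decoded_rat (c : R) (q : rat) : 'rV[R]_d :=
  \row_i fine (ereal_sup (range (fun r : rat =>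
    if ternary_digit (pickle (q, i, r)) c then (ratr r)%:E else -oo%E))).

Definition path_code z : R := ternary_code (path_bits z).

Lemma decoded_ratK z : decoded_rat (path_code z) = z.
Proof.
apply/funext => q; apply/rowP => i; rewrite mxE.
apply: EFin_inj; set S := ereal_sup _.
suff -> : S = (z q ord0 i)%:E by [].
apply/eqP; rewrite eq_le; apply/andP; split.
  apply: ge_ereal_sup => _ [r _ <-]; rewrite ternary_digitK /path_bits pickleK.
  by case: ifPn => [/ltW|_]; rewrite ?lee_fin ?leNye.
apply/lee_subgt0Pr => e e0.
have [r rE] := @rat_in_itvoo R (z q ord0 i - e) (z q ord0 i) ltac:(by rewrite gtrBl).
move: rE; rewrite in_itv/= => /andP[er rz].
rewrite -EFinB (@le_trans _ _ (ratr r)%:E)//; first by rewrite lee_fin ltW.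
apply: ereal_sup_ubound; exists r => //.
by rewrite ternary_digitK /path_bits pickleK rz.
Qed.

Lemma measurable_decoded_rat q : measurable_fun setT (decoded_rat ^~ q).
Proof.
apply/rV_measurable_funP => i; under eq_fun do rewrite mxE.
apply: measurableT_comp => //; apply: measurable_countable_sup => r.
by apply: measurable_fun_ifT => //; exact: measurable_ternary_digit.
Qed.

Lemma measurable_good_code : measurable [set c | rat_modulus (decoded_rat c)].
Proof.
apply: measurable_forall => e; apply: measurable_forall => N.
apply: measurable_exists => j; apply: measurable_forall => p.
apply: measurable_forall => q; apply: measurable_forall => r.
have [H|nH] := pselect [/\ 0 <= p, p < q, q < r, r <= N%:R & r - p < j.+1%:R^-1];
  last first.
  by rewrite (_ : [set x | _] = setT); [exact: measurableT|apply/seteqP; split => // c _ /nH].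
have mle (a b : rat) : measurable
    [set c | `|decoded_rat c a - decoded_rat c b| <= e.+1%:R^-1].
  have mB : measurable_fun setT (fun c => decoded_rat c a - decoded_rat c b).
    by apply: measurable_rVB; exact: measurable_decoded_rat.
  suff mN : measurable [set v : 'rV[R]_d | `|v| <= e.+1%:R^-1].
    exact: (measurable_preimageT mB mN).
  apply: closed_measurable_rV.
  apply: (closed_comp (f := fun v : 'rV[R]_d => `|v|) (D := [set x | x <= e.+1%:R^-1])).
    by move=> v _; exact: norm_continuous.
  exact: closed_le.
rewrite (_ : [set x | _] = [set c | `|decoded_rat c q - decoded_rat c p| <= e.+1%:R^-1]
   `|` [set c | `|decoded_rat c r - decoded_rat c q| <= e.+1%:R^-1]).
  exact: measurableU.
by apply/seteqP; split=> [c /(_ H)|c h _].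
Qed.

(** Reals that do not code a regular path decode to the constant path 0, so
    that every decoded path is cadlag. *)
Definition decoded_path (t : R) (c : R) : 'rV[R]_d :=
  if `[< rat_modulus (decoded_rat c) >] then path_of (decoded_rat c) t else 0.

(** At negative times the decoded path is constant, hence measurable in the
    code at these times too. *)
Lemma rat_grid_le0 (t : R) n : t <= 0 -> rat_grid n t = rat_grid n (0 : R).
Proof.
move=> t0; rewrite /rat_grid !divr1 mul0r; congr (_.+1%:R / _).
rewrite truncn0; apply/truncn0Pn; rewrite -ltNge.
by rewrite (le_lt_trans _ ltr01)// mulr_le0_ge0.
Qed.

Lemma path_of_cvgT (x : rat -> 'rV[R]_d) (t : R) : rat_modulus x ->
  x (rat_grid n t) @[n --> \oo] --> path_of x t.
Proof.
move=> xm; have [t0|t0] := leP 0 t; first exact: path_of_cvg.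
rewrite /path_of; under eq_fun do rewrite (rat_grid_le0 _ (ltW t0)).
exact: path_of_cvg.
Qed.

Lemma measurable_decoded_path t : measurable_fun setT (decoded_path t).
Proof.
apply/rV_measurable_funP => i.
pose g n (c : R) : R := if `[< rat_modulus (decoded_rat c) >]
  then decoded_rat c (rat_grid n t) ord0 i else 0.
apply: (measurable_fun_cvg (h := g)) => [n|c _].
  apply: measurable_fun_ifT => //.
  - apply: (measurable_fun_bool true); rewrite setTI.
    rewrite (_ : _ @^-1` _ = [set c | rat_modulus (decoded_rat c)]).
      exact: measurable_good_code.
    by apply/seteqP; split=> c /=; [move=> /asboolP|move=> h; exact/asboolP].
  - have /rV_measurable_funP := measurable_decoded_rat (rat_grid n t); exact.
rewrite /g /decoded_path; case: asboolP => [xm|_].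
  have h := path_of_cvgT (t := t) xm.
  exact: (cvg_comp _ _ h (@coord_continuous _ _ _ ord0 i (path_of (decoded_rat c) t))).
by rewrite mxE; exact: cvg_cst.
Qed.

Lemma decoded_path_cadlag c : cadlag (decoded_path ^~ c).
Proof.
rewrite /decoded_path; case: asboolP => [xm|_]; first exact: path_of_cadlag.
by split=> t t0; [exact: cvg_cst|exact: is_cvg_cst].
Qed.

Lemma decoded_pathK (z : R -> 'rV[R]_d) t : cadlag z -> 0 <= t ->
  decoded_path t (path_code (fun q => z (ratr q))) = z t.
Proof.
move=> cz t0; rewrite /decoded_path decoded_ratK asboolT; last exact: cadlag_rat_modulus.
exact: path_of_restriction.
Qed.

Lemma measurable_path_code {d1} {T : measurableType d1} (Z : R -> T -> 'rV[R]_d) :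
  (forall t, measurable_fun setT (Z t)) ->
  measurable_fun setT (fun w => path_code (fun q => Z (ratr q) w)).
Proof.
move=> mZ; apply: measurable_ternary_code => n; rewrite /path_bits.
case: (unpickle n) => [[[q i] r]|//].
apply: measurable_fun_ltr => //.
by have /rV_measurable_funP := mZ (ratr q); exact.
Qed.

End path_code.

(** * Densities and common parts of measures *)

Section weights.
Context {R : realType} {d} {T : measurableType d}.
Local Open Scope ereal_scope.

(** Densities of parts of a measure. *)
Definition weight (f : T -> R) : Prop :=
  measurable_fun setT f /\ forall x, (0 <= f x <= 1)%R.

Lemma weight_ge0 f x : weight f -> 0 <= (f x)%:E.
Proof. by move=> [_ /(_ x)/andP[]]; rewrite lee_fin. Qed.

Lemma weight_le1 f x : weight f -> (f x)%:E <= 1.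
Proof. by move=> [_ /(_ x)/andP[]]; rewrite lee_fin. Qed.

Lemma weight_measurable f : weight f -> measurable_fun setT (EFin \o f).
Proof. by move=> [mf _]; exact/measurable_EFinP. Qed.

Lemma weight_max (f g : T -> R) : weight f -> weight g ->
  weight (fun x => Num.max (f x) (g x)).
Proof.
move=> [mf f01] [mg g01]; split; first exact: measurable_maxr.
move=> x; have /andP[f0 f1] := f01 x; have /andP[g0 g1] := g01 x.
by rewrite le_max ge_max f0 f1 g1.
Qed.

Lemma weight0 : weight (cst 0%R).
Proof. by split => // x; rewrite lexx ler01. Qed.

Lemma measurable_ltr_set (f g : T -> R) : measurable_fun setT f -> measurable_fun setT g ->
  measurable [set x | (f x < g x)%R].
Proof.
move=> mf mg; rewrite -[X in measurable X]setTI.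
have mh : measurable_fun setT (fun x => f x < g x)%R by exact: measurable_fun_ltr.
exact: (mh measurableT [set true]).
Qed.

Lemma ge0_integral_split (m : {measure set T -> \bar R}) (f : T -> \bar R) A N :
  measurable A -> measurable N -> measurable_fun setT f -> (forall x, 0 <= f x) ->
  \int[m]_(x in A) f x = \int[m]_(x in A `&` N) f x + \int[m]_(x in A `&` ~` N) f x.
Proof.
move=> mA mN mf f0; rewrite -ge0_integral_setU//.
- by rewrite -setIUr setUv setIT.
- exact: measurableI.
- by apply: measurableI => //; exact: measurableC.
- exact: measurable_funTS.
- by apply/disj_setPS => x [[_ ?] [_]].
Qed.

Lemma weight_integral_le (m : {measure set T -> \bar R}) f A : weight f ->
  measurable A -> \int[m]_(x in A) (f x)%:E <= m A.
Proof.
move=> wf mA; rewrite -[leRHS]mul1e -(integral_cst m mA).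
apply: ge0_le_integral => //.
- by move=> x _; exact: weight_ge0.
- by apply: measurable_funTS; exact: weight_measurable.
- by move=> x _; exact: weight_le1.
Qed.

(** Cutting a Radon-Nikodym density of a at the value 1 changes nothing: where
    it exceeds 1, the masses of a and m must coincide. *)
Lemma density01 (a m : {finite_measure set T -> \bar R}) :
  (forall A, measurable A -> a A <= m A) ->
  exists2 f : T -> R, weight f &
    forall A, measurable A -> a A = \int[m]_(x in A) (f x)%:E.
Proof.
move=> am.
have dom : a `<< m.
  apply/null_content_dominatesP => A mA mA0; apply/eqP; rewrite eq_le measure_ge0 andbT.
  by rewrite (le_trans (am _ mA))//= mA0.
have [f [f0 ff fi fE]] := radon_nikodym_sigma_finite dom.
have mf : measurable_fun setT f by exact: measurable_int fi.
pose g x := fine (mine (f x) 1).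
have gE x : (g x)%:E = mine (f x) 1.
  by rewrite /g fineK// /mine; case: ifP.
have mg : measurable_fun setT (EFin \o g).
  rewrite (_ : EFin \o g = fun x => mine (f x) 1); last by apply/funext => x; exact: gE.
  exact: measurable_mine.
have g01 x : (0 <= g x <= 1)%R.
  by rewrite -!lee_fin gE le_min f0 lee01 ge_min lexx orbT.
have wg : weight g by split => //; exact/measurable_EFinP.
exists g => // A mA.
pose N := [set x | 1 < f x].
have mN : measurable N.
  rewrite -[X in measurable X]setTI; exact: emeasurable_fun_lt.
have mAN : measurable (A `&` N) by exact: measurableI.
have mAN' : measurable (A `&` ~` N) by apply: measurableI => //; exact: measurableC.
rewrite fE// (ge0_integral_split m mA mN mf f0).
rewrite (ge0_integral_split m mA mN mg); last by move=> x; exact: weight_ge0.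
congr (_ + _); last first.
  apply: eq_integral => x /[!inE] -[_ /negP]; rewrite -leNgt => fx.
  by rewrite /= gE; apply/esym/min_idPl.
rewrite [RHS](_ : _ = m (A `&` N)); last first.
  rewrite -[RHS]mul1e -(integral_cst m mAN); apply: eq_integral => x /[!inE] -[_ fx].
  by rewrite /= gE; apply/min_idPr/ltW.
apply/eqP; rewrite eq_le; apply/andP; split; first by rewrite -fE// am.
rewrite -[leLHS]mul1e -(integral_cst m mAN); apply: ge0_le_integral => //.
- exact: measurable_funTS.
- by move=> x [_ /ltW].
Qed.

Section density_measure.
Variables (mu : {finite_measure set T -> \bar R}) (h : T -> R).
Hypothesis wh : weight h.

Definition density_fun (A : set T) : \bar R := \int[mu]_(x in A) (h x)%:E.

Let m0 : density_fun set0 = 0. Proof. by rewrite /density_fun integral_set0. Qed.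

Let mge0 A : 0 <= density_fun A.
Proof. by apply: integral_ge0 => x _; exact: weight_ge0. Qed.

Let madd : semi_sigma_additive density_fun.
Proof.
apply: semi_sigma_additive_nng_induced; first exact: weight_measurable.
by move=> x; exact: weight_ge0.
Qed.

HB.instance Definition _ := isMeasure.Build _ _ _ density_fun m0 mge0 madd.

Let mfin : fin_num_fun density_fun.
Proof.
move=> A mA; rewrite ge0_fin_numE//.
by rewrite (le_lt_trans (weight_integral_le mu wh mA))// ltey_eq fin_num_measure.
Qed.

HB.instance Definition _ := Measure_isFinite.Build _ _ _ density_fun mfin.

(** The Radon-Nikodym derivative of [density_fun] equals h almost everywhere. *)
Lemma density_change (g : T -> \bar R) D : measurable D -> measurable_fun setT g ->
  (forall x, 0 <= g x) ->
  \int[density_fun]_(x in D) g x = \int[mu]_(x in D) ((h x)%:E * g x).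
Proof.
move=> mD mg g0.
have dom : density_fun `<< mu.
  apply/null_content_dominatesP => A mA mA0; apply/eqP; rewrite eq_le mge0 andbT.
  by rewrite (le_trans (weight_integral_le mu wh mA))//= mA0.
rewrite -(Radon_Nikodym_SigmaFinite.change_of_variables dom)//; last exact: measurable_funTS.
have fi := Radon_Nikodym_SigmaFinite.f_integrable dom.
have mf := measurable_int _ fi.
apply: ge0_ae_eq_integral => //.
- apply: measurable_funTS; exact: emeasurable_funM.
- apply: measurable_funTS; apply: emeasurable_funM => //; exact: weight_measurable.
- by move=> x _; rewrite mule_ge0//; exact: Radon_Nikodym_SigmaFinite.f_ge0.
- by move=> x _; rewrite mule_ge0//; exact: weight_ge0.
have := @integral_ae_eq _ _ _ mu setT measurableT (EFin \o h) _ fi.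
move=> /(_ (weight_measurable wh)) H.
have : ae_eq mu setT (Radon_Nikodym_SigmaFinite.f density_fun mu) (EFin \o h).
  apply: H => E _ mE; rewrite -Radon_Nikodym_SigmaFinite.f_integral//.
by apply: filterS => x /= hx _; rewrite hx// muleC.
Qed.

Definition density_measure : {finite_measure set T -> \bar R} := density_fun.

End density_measure.

Section finite_copy.
Variables (m : {measure set T -> \bar R}) (mfin : m setT < +oo).

Definition finite_copy (A : set T) : \bar R := m A.

Let m0 : finite_copy set0 = 0. Proof. exact: measure0. Qed.
Let mge0 A : 0 <= finite_copy A. Proof. exact: measure_ge0. Qed.
Let madd : semi_sigma_additive finite_copy.
Proof. exact: measure_semi_sigma_additive. Qed.

HB.instance Definition _ := isMeasure.Build _ _ _ finite_copy m0 mge0 madd.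

Let mfin' : fin_num_fun finite_copy.
Proof.
move=> A mA; rewrite ge0_fin_numE//; apply: le_lt_trans mfin.
by apply: le_measure; rewrite ?inE.
Qed.

HB.instance Definition _ := Measure_isFinite.Build _ _ _ finite_copy mfin'.

Definition finite_measure_of : {finite_measure set T -> \bar R} := finite_copy.

End finite_copy.

End weights.

Section weighted_law.
Context {R : realType} {d1} {Om : measurableType d1} {d} {T : measurableType d}.
Local Open Scope ereal_scope.

Lemma weighted_law (P : {finite_measure set Om -> \bar R}) (V : Om -> R) (Y : Om -> T) :
  weight V -> measurable_fun setT Y ->
  exists m : {finite_measure set T -> \bar R},
    (forall A, measurable A -> m A = \int[P]_(w in Y @^-1` A) (V w)%:E) /\
    (forall (g : T -> \bar R) D, measurable D -> measurable_fun setT g ->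
      (forall x, 0 <= g x) ->
      \int[m]_(x in D) g x = \int[P]_(w in Y @^-1` D) ((V w)%:E * g (Y w))).
Proof.
move=> wV mY; pose mu := density_measure P wV.
pose m' := image_measure mu mY.
have fin : m' setT < +oo.
  by change (mu setT < +oo); rewrite ltey_eq fin_num_measure.
exists (finite_measure_of fin); split=> // g D mD mg g0.
transitivity (\int[m']_(x in D) g x); first by apply: eq_measure_integral.
rewrite ge0_integral_pushforward//; last exact: measurable_funTS.
have mgY : measurable_fun setT (g \o Y) by exact: (measurableT_comp mg mY).
exact: (density_change P wV (measurable_preimageT mY mD) mgY (fun w => g0 (Y w))).
Qed.

End weighted_law.

Section finite_meet.
Context {R : realType} {d} {T : measurableType d}.
Variables (p q : {finite_measure set T -> \bar R}).
Local Open Scope ereal_scope.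

(** The common part of p and q equals p on the set where p <= q and q on its
    complement N; g1 and g2 are its densities. The last equation says that the
    mass of p left over is p N - q N. *)
Lemma measure_meet : exists (g1 g2 : T -> R) (N : set T),
  [/\ weight g1, weight g2, measurable N,
      forall A, measurable A -> \int[p]_(x in A) (g1 x)%:E = \int[q]_(x in A) (g2 x)%:E &
      p setT + q N = \int[p]_x (g1 x)%:E + p N].
Proof.
have [N [mN pq qp]] := hahn_two_measures p q.
have mN' : measurable (~` N) by exact: measurableC.
have pN : p N < +oo by rewrite ltey_eq fin_num_measure.
have qN : q (~` N) < +oo by rewrite ltey_eq fin_num_measure.
pose a0 := measure_add (mfrestr mN pN) (mfrestr mN' qN).
have aE A : a0 A = p (A `&` N) + q (A `&` ~` N) by rewrite /a0 measure_addE.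
have afin : a0 setT < +oo by rewrite aE !setTI lte_add_pinfty.
have split_ (m : {finite_measure set T -> \bar R}) A : measurable A ->
    m A = m (A `&` N) + m (A `&` ~` N).
  by move=> mA; rewrite (measureDI m mA mN) addeC setDE.
have mI A : measurable A -> measurable (A `&` N) by move=> mA; exact: measurableI.
have mI' A : measurable A -> measurable (A `&` ~` N) by move=> mA; exact: measurableI.
have [g1 w1 g1E] : exists2 g, weight g & forall A, measurable A ->
    finite_measure_of afin A = \int[p]_(x in A) (g x)%:E.
  apply: density01 => A mA; change (a0 A <= p A).
  rewrite aE (split_ p A mA); apply: leeD => //; apply: qp; first exact: mI'.
  by move=> x [].
have [g2 w2 g2E] : exists2 g, weight g & forall A, measurable A ->
    finite_measure_of afin A = \int[q]_(x in A) (g x)%:E.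
  apply: density01 => A mA; change (a0 A <= q A).
  rewrite aE (split_ q A mA); apply: leeD => //; apply: pq; first exact: mI.
  by move=> x [].
exists g1, g2, (~` N); split => //; first by move=> A mA; rewrite -g1E// -g2E.
rewrite -g1E//; change (p setT + q (~` N) = a0 setT + p (~` N)).
by rewrite aE (split_ p setT measurableT) !setTI addeAC.
Qed.

End finite_meet.

(** * Conditional distribution functions *)

Section disintegration.
Context {R : realType} {d} {T : measurableType d}.
Variables (m : {finite_measure set T -> \bar R}).
Variable a : R -> {finite_measure set T -> \bar R}.
Local Open Scope ereal_scope.
Hypothesis a_le : forall s A, measurable A -> a s A <= m A.
Hypothesis a_mono : forall r s A, (r <= s)%R -> measurable A -> a r A <= a s A.
Hypothesis a_left : forall s A e, (0 < e)%R -> measurable A ->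
  exists2 r : rat, (ratr r < s)%R & a s A <= a (ratr r) A + e%:E.

(** With [running_max], this enumerates the supremum of F r over rationals r <
    s by finite maxima. *)
Definition rat_term (F : rat -> T -> R) (s : R) (n : nat) (x : T) : R :=
  if @unpickle rat n is Some r then if (ratr r < s)%R then F r x else 0%R else 0%R.

Fixpoint running_max (F : rat -> T -> R) (s : R) (n : nat) (x : T) : R :=
  if n is n'.+1 then Num.max (running_max F s n' x) (rat_term F s n' x) else 0%R.

Lemma weight_rat_term F s n : (forall r, weight (F r)) -> weight (rat_term F s n).
Proof.
rewrite /rat_term => wF; case: unpickle => [r|]; last exact: weight0.
by case: ltP => _; [exact: wF|exact: weight0].
Qed.

Lemma weight_running_max F s n : (forall r, weight (F r)) -> weight (running_max F s n).
Proof.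
move=> wF; elim: n => [|n IH]; first exact: weight0.
by apply: weight_max => //; exact: weight_rat_term.
Qed.

Lemma running_max_nd F s n k x : (n <= k)%N ->
  (running_max F s n x <= running_max F s k x)%R.
Proof.
by move=> /subnK <-; elim: (k - n)%N => [|j IH] //=; rewrite le_max IH.
Qed.

(** F r is the density of a (ratr r). Densities of different measures are
    ordered only almost everywhere, so monotonicity in r is recovered by taking
    maxima: a finite maximum of densities of index below s integrates to at
    most a s, as one sees by splitting along the set where the last one is the
    largest. Left-continuity of a gives the converse in the limit. *)
Lemma disintegration : exists2 F : rat -> T -> R, forall r, weight (F r) &
  forall s A, measurable A ->
    \int[m]_(x in A) (running_max F s n x)%:E @[n --> \oo] --> a s A.
Proof.
have /choice[F FP] : forall r : rat, exists f : T -> R, weight f /\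
    forall A, measurable A -> a (ratr r) A = \int[m]_(x in A) (f x)%:E.
  move=> r; have [f wf fE] := @density01 _ _ _ (a (ratr r)) m (@a_le (ratr r)).
  by exists f.
have wF r : weight (F r) := (FP r).1.
exists F => // s A mA.
have wM n : weight (running_max F s n) by exact: weight_running_max.
have wt n : weight (rat_term F s n) by exact: weight_rat_term.
have termE n B : measurable B -> \int[m]_(x in B) (rat_term F s n x)%:E <= a s B.
  move=> mB; rewrite /rat_term; case: unpickle => [r|]; last by rewrite integral0.
  case: ltP => rs; last by rewrite integral0.
  by rewrite -(FP r).2//; exact/a_mono/mB/ltW.
have ub n B : measurable B -> \int[m]_(x in B) (running_max F s n x)%:E <= a s B.
  elim: n B => [|n IH] B mB /=; first by rewrite integral0.
  pose N := [set x | (running_max F s n x < rat_term F s n x)%R].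
  have mN : measurable N.
    by apply: measurable_ltr_set; [exact: (wM n).1|exact: (wt n).1].
  have mBN : measurable (B `&` N) by exact: measurableI.
  have mBN' : measurable (B `&` ~` N) by apply: measurableI => //; exact: measurableC.
  have wS := wM n.+1; rewrite (ge0_integral_split m mB mN); last 2 first.
  - exact: weight_measurable wS.
  - by move=> x; exact: (weight_ge0 x wS).
  rewrite -[in leRHS](setDUK (@subIsetl _ B N)) measureU//; last 2 first.
  - exact: measurableD.
  - by rewrite setDIK.
  apply: leeD.
    rewrite (eq_integral (fun x => (rat_term F s n x)%:E)); first exact: termE.
    by move=> x /[!inE] -[_ /= h]; rewrite max_r// ltW.
  rewrite (eq_integral (fun x => (running_max F s n x)%:E)); last first.
    by move=> x /[!inE] -[_ /negP]; rewrite -leNgt => h; rewrite max_l.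
  by rewrite setDE setCI setIUr setICr set0U; exact: IH.
have nd : {homo (fun n => \int[m]_(x in A) (running_max F s n x)%:E) : n k / (n <= k)%N >-> n <= k}.
  move=> n k nk; apply: ge0_le_integral => //.
  - by move=> x _; exact: (weight_ge0 x (wM n)).
  - by apply: measurable_funTS; exact: weight_measurable.
  - by apply: measurable_funTS; exact: weight_measurable.
  - by move=> x _; rewrite lee_fin running_max_nd.
have := ereal_nondecreasing_cvgn nd; set S := ereal_sup _.
suff -> : S = a s A by [].
apply/eqP; rewrite eq_le; apply/andP; split.
  by apply: ge_ereal_sup => _ [n _ <-]; exact: ub.
apply/lee_addgt0Pr => e e0.
have [r rs aE] := @a_left s A e e0 mA.
apply: (le_trans aE); apply: leeD => //.
apply: (@le_trans _ _ (\int[m]_(x in A) (running_max F s (pickle r).+1 x)%:E)); last first.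
  by apply: ereal_sup_ubound; exists (pickle r).+1.
rewrite (FP r).2//; apply: ge0_le_integral => //.
- by move=> x _; exact: (weight_ge0 x (wF r)).
- by apply: measurable_funTS; exact: weight_measurable.
- by apply: measurable_funTS; exact: (weight_measurable (wM (pickle r).+1)).
- by move=> x _; rewrite lee_fin /= le_max /rat_term pickleK rs lexx orbT.
Qed.

End disintegration.

(** * Matching two Markov processes *)

Section past_weights.
Context {R : realType} {d : nat} {d1} {Om : measurableType d1} {P : probability Om R}.
Variable Y : R -> {RV P >-> 'rV[R]_d}.
Local Open Scope ereal_scope.

(** The sigma-algebra of the past is put on a copy of the space, so that being
    determined by the past is ordinary measurability. *)
Definition past_weight (s : R) (V : Om -> R) : Prop :=
  @weight R _ (g_sigma_algebraType (past_gen Y s)) V.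

Lemma past_events_measurable s : past_events Y s `<=` measurable.
Proof.
apply: smallest_sub; first exact: sigma_algebra_measurable.
exact: past_gen_measurable.
Qed.

Lemma past_weight_weight s V : past_weight s V -> weight V.
Proof.
move=> [mV V01]; split => // _ B mB; rewrite setTI.
apply: past_events_measurable; have := mV measurableT B mB; rewrite setTI; exact.
Qed.

Lemma past_weight_mono s t V : (s <= t)%R -> past_weight s V -> past_weight t V.
Proof.
move=> st [mV V01]; split => // _ B mB; have := mV measurableT B mB.
apply: sub_sigma_algebra2 => C [u /=]; rewrite in_itv/= => /andP[u0 us] HC.
by exists u => //=; rewrite in_itv/= u0 (le_trans us).
Qed.

Lemma past_weight_value (g : 'rV[R]_d -> R) t : (0 <= t)%R -> weight g ->
  past_weight t (fun w => g (Y t w)).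
Proof.
move=> t0 [mg g01]; split; last by move=> w; exact: g01.
move=> _ B mB; rewrite setTI; apply: sub_sigma_algebra.
exists t; first by rewrite /= in_itv/= t0 lexx.
exists (g @^-1` B); first exact: (measurable_preimageT mg mB).
by rewrite setTI.
Qed.

Lemma weight_mix {d2} {T : measurableType d2} (V g : T -> R) : weight V -> weight g ->
  weight (fun w => V w + (1 - V w) * g w)%R.
Proof.
move=> [mV V01] [mg g01]; split.
  apply: measurable_funD => //; apply: measurable_funM => //.
  exact: measurable_funB.
move=> w; have /andP[V0 V1] := V01 w; have /andP[g0 g1] := g01 w; nra.
Qed.

(** The Markov property states that two measures agree on the events of the
    past; V may be integrated against both. *)
Lemma markov_weight (Q : R -> 'rV[R]_d -> set 'rV[R]_d -> \bar R) s t V A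
    (q : 'rV[R]_d -> R) :
  markov_process Q Y -> (0 <= s)%R -> (0 <= t)%R -> measurable A ->
  weight q -> (forall x, Q t x A = (q x)%:E) -> past_weight s V ->
  \int[P]_(w in Y (s + t)%R @^-1` A) (V w)%:E =
  \int[P]_w ((V w)%:E * (q (Y s w))%:E).
Proof.
move=> mY s0 t0 mA wq qE pV.
pose TG := g_sigma_algebraType (past_gen Y s).
pose idG (w : Om) : TG := w.
have midG : measurable_fun setT idG.
  by move=> _ B mB; rewrite setTI; exact: (@past_events_measurable s B mB).
have mYA : measurable (Y (s + t)%R @^-1` A) by exact: measurable_preimageT.
have w1 : weight (\1_(Y (s + t)%R @^-1` A) : Om -> R).
  split; first exact: measurable_indic.
  by move=> w; rewrite indicE; case: (_ \in _); rewrite ?lexx ?ler01.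
have w2 : weight (fun w => q (Y s w)).
  split; last by move=> w; have [_] := wq; exact.
  by have [mq _] := wq; exact: (measurableT_comp mq).
have wV := past_weight_weight pV.
have V0 w : 0 <= (V w)%:E by exact: weight_ge0.
have mV := weight_measurable wV.
have mVG := weight_measurable pV.
pose m1 := image_measure
  (density_measure P w1) midG.
pose m2 := image_measure
  (density_measure P w2) midG.
have m12 (B : set TG) : measurable B -> m1 B = m2 B.
  move=> mB; change (\int[P]_(w in B) (\1_(Y (s + t)%R @^-1` A) w)%:E =
    \int[P]_(w in B) (q (Y s w))%:E).
  have mB' : measurable (B : set Om) by exact: (@past_events_measurable s B mB).
  transitivity (P (B `&` Y (s + t)%R @^-1` A)); first by rewrite integral_indic// setIC.
  transitivity (\int[P]_(w in B) Q t (Y s w) A); first exact: mY.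
  by apply: eq_integral => w _; rewrite qE.
have chg m' (w' : weight m') : \int[image_measure
    (density_measure P w') midG]_x (V x)%:E = \int[P]_w ((m' w)%:E * (V w)%:E).
  rewrite (ge0_integral_pushforward midG)//.
  by rewrite preimage_setT density_change.
transitivity (\int[m1]_x (V x)%:E); last first.
  transitivity (\int[m2]_x (V x)%:E); first by apply: eq_measure_integral => B mB _; exact: m12.
  by rewrite (chg _ w2); apply: eq_integral => w _; rewrite muleC.
rewrite (chg _ w1) integral_mkcond; apply: eq_integral => w _.
by rewrite patchE indicE; case: ifP => wA; rewrite /= ?mul1e ?mul0e.
Qed.

End past_weights.

Section weight_complement.
Context {R : realType} {d} {T : measurableType d} (m : {measure set T -> \bar R}).
Implicit Types (V g : T -> R) (D : set T).
Local Open Scope ereal_scope.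

Lemma weight_neg V : weight V -> weight (fun w => 1 - V w)%R.
Proof.
move=> [mV V01]; split; first exact: measurable_funB.
by move=> w; have := V01 w; lra.
Qed.

Lemma weight_mul V g : weight V -> weight g -> weight (fun w => V w * g w)%R.
Proof.
move=> [mV V01] [mg g01]; split; first exact: measurable_funM.
by move=> w; have := V01 w; have := g01 w; nra.
Qed.

Lemma integral_mix V g D : weight V -> weight g -> measurable D ->
  \int[m]_(w in D) (V w + (1 - V w) * g w)%:E =
  \int[m]_(w in D) (V w)%:E + \int[m]_(w in D) ((1 - V w)%:E * (g w)%:E).
Proof.
move=> wV wg mD; have wn := weight_mul (weight_neg wV) wg.
under eq_integral do rewrite EFinD EFinM.
rewrite ge0_integralD//.
- by move=> w _; exact: weight_ge0.
- by apply: measurable_funTS; exact: weight_measurable.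
- by move=> w _; rewrite -EFinM; exact: (weight_ge0 w wn).
- by apply: measurable_funTS; exact: (weight_measurable wn).
Qed.

Lemma integral_neg V D : weight V -> measurable D ->
  \int[m]_(w in D) (V w)%:E + \int[m]_(w in D) (1 - V w)%:E = m D.
Proof.
move=> wV mD; have wn := weight_neg wV; rewrite -ge0_integralD//; last 4 first.
- by move=> w _; exact: weight_ge0.
- by apply: measurable_funTS; exact: weight_measurable.
- by move=> w _; exact: (weight_ge0 w wn).
- by apply: measurable_funTS; exact: (weight_measurable wn).
rewrite -[RHS]mul1e -(integral_cst m mD); apply: eq_integral => w _.
by rewrite -EFinD addrC subrK.
Qed.

End weight_complement.

Section greedy_matching.
Context {R : realType} {d : nat}.
Context {d1} {Om1 : measurableType d1} {P1 : probability Om1 R}.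
Context {d2} {Om2 : measurableType d2} {P2 : probability Om2 R}.
Variables (Y : R -> {RV P1 >-> 'rV[R]_d}) (Z : R -> {RV P2 >-> 'rV[R]_d}).
Variable Q : R -> 'rV[R]_d -> set 'rV[R]_d -> \bar R.
Local Open Scope ereal_scope.
Hypothesis Q_weight : forall t A, measurable A ->
  exists2 q : 'rV[R]_d -> R, weight q & forall x, Q t x A = (q x)%:E.
Hypothesis mY : markov_process Q Y.
Hypothesis mZ : markov_process Q Z.
Hypothesis close : forall (e t0 : R), (0 < e)%R -> exists2 t, (t0 <= t)%R &
  forall A, measurable A -> P1 (Y t @^-1` A) <= P2 (Z t @^-1` A) + e%:E.

(** [V1] and [V2] are the densities of the parts of the two probabilities that
    have been matched by time t. *)
Record matched (t : R) (V1 : Om1 -> R) (V2 : Om2 -> R) : Prop := {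
  matched_time : (0 <= t)%R ;
  matched_past1 : past_weight Y t V1 ;
  matched_past2 : past_weight Z t V2 ;
  matched_law : forall t' A, (t <= t')%R -> measurable A ->
    \int[P1]_(w in Y t' @^-1` A) (V1 w)%:E = \int[P2]_(w in Z t' @^-1` A) (V2 w)%:E }.

Lemma matched0 : matched 0 (cst 0%R) (cst 0%R).
Proof.
split=> //; [exact: weight0|exact: weight0|].
by move=> t A t0 mA; rewrite !integral0.
Qed.

(** By the Markov property, equal laws at time t propagate to later times. *)
Lemma matched_from t V1 V2 : (0 <= t)%R -> past_weight Y t V1 -> past_weight Z t V2 ->
  (forall A, measurable A -> \int[P1]_(w in Y t @^-1` A) (V1 w)%:E =
    \int[P2]_(w in Z t @^-1` A) (V2 w)%:E) ->
  matched t V1 V2.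
Proof.
move=> t0 p1 p2 VE; split => // t' A tt' mA.
have tt'0 : (0 <= t' - t)%R by rewrite subr_ge0.
have [q wq qE] := Q_weight (t' - t) mA.
rewrite (_ : t' = t + (t' - t))%R; last by rewrite addrC subrK.
rewrite (markov_weight mY t0 tt'0 mA wq qE p1) (markov_weight mZ t0 tt'0 mA wq qE p2).
have [m1 [m1E m1I]] := weighted_law P1 (past_weight_weight p1) (measurable_funP (Y t)).
have [m2 [m2E m2I]] := weighted_law P2 (past_weight_weight p2) (measurable_funP (Z t)).
have q0 x : 0 <= (q x)%:E by exact: weight_ge0.
have mq := weight_measurable wq.
have := m1I _ _ measurableT mq q0; have := m2I _ _ measurableT mq q0.
rewrite !preimage_setT => <- <-; apply: eq_measure_integral => B mB _.
exact: etrans (m1E B mB) (etrans (VE B mB) (esym (m2E B mB))).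
Qed.

(** Apply [measure_meet] to the laws, at a late time s, of the two unmatched
    parts. As the matched parts have equal laws, the unmatched laws differ as
    much as the full laws do, which is at most by e; this bounds the mass that
    remains unmatched. *)
Lemma matched_step t V1 V2 (e : R) : matched t V1 V2 -> (0 < e)%R ->
  exists t' V1' V2', [/\ matched t' V1' V2',
    (forall w, (V1 w <= V1' w)%R), (forall w, (V2 w <= V2' w)%R),
    (t <= t')%R & 1 <= \int[P1]_w (V1' w)%:E + e%:E].
Proof.
move=> [tge p1 p2 VE] e0; have [s ts sP] := close t e0.
have s0 : (0 <= s)%R by exact: le_trans ts.
have w1 := past_weight_weight p1; have w2 := past_weight_weight p2.
have [p [pE pI]] := weighted_law P1 (weight_neg w1) (measurable_funP (Y s)).
have [q [qE qI]] := weighted_law P2 (weight_neg w2) (measurable_funP (Z s)).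
have [g1 [g2 [N [wg1 wg2 mN g12 gN]]]] := measure_meet p q.
have wv1 := past_weight_weight (past_weight_value Y s0 wg1).
have wv2 := past_weight_weight (past_weight_value Z s0 wg2).
have mYA A : measurable A -> measurable (Y s @^-1` A) by move=> mA; exact: measurable_preimageT.
have mZA A : measurable A -> measurable (Z s @^-1` A) by move=> mA; exact: measurable_preimageT.
have E1 A : measurable A ->
    \int[P1]_(w in Y s @^-1` A) (V1 w + (1 - V1 w) * g1 (Y s w))%:E =
    \int[P1]_(w in Y s @^-1` A) (V1 w)%:E + \int[p]_(x in A) (g1 x)%:E.
  move=> mA; rewrite (integral_mix _ w1 wv1 (mYA A mA)); congr (_ + _).
  rewrite (pI (EFin \o g1) A mA); [by []|exact: weight_measurable|].
  by move=> x; exact: weight_ge0.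
have E2 A : measurable A ->
    \int[P2]_(w in Z s @^-1` A) (V2 w + (1 - V2 w) * g2 (Z s w))%:E =
    \int[P2]_(w in Z s @^-1` A) (V2 w)%:E + \int[q]_(x in A) (g2 x)%:E.
  move=> mA; rewrite (integral_mix _ w2 wv2 (mZA A mA)); congr (_ + _).
  rewrite (qI (EFin \o g2) A mA); [by []|exact: weight_measurable|].
  by move=> x; exact: weight_ge0.
exists s, (fun w => V1 w + (1 - V1 w) * g1 (Y s w))%R,
  (fun w => V2 w + (1 - V2 w) * g2 (Z s w))%R; split => //.
- apply: matched_from => //.
  + apply: weight_mix; [exact: past_weight_mono p1|exact: past_weight_value].
  + apply: weight_mix; [exact: past_weight_mono p2|exact: past_weight_value].
  + by move=> A mA; rewrite E1// E2// g12// VE.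
- move=> w; have [_ /(_ w)] := w1; have [_ /(_ (Y s w))] := wg1; nra.
- move=> w; have [_ /(_ w)] := w2; have [_ /(_ (Z s w))] := wg2; nra.
have fl1 A : measurable A -> \int[P1]_(w in Y s @^-1` A) (V1 w)%:E + p A = P1 (Y s @^-1` A).
  by move=> mA; rewrite (pE A mA); exact: integral_neg (mYA A mA).
have fl2 A : measurable A -> \int[P2]_(w in Z s @^-1` A) (V2 w)%:E + q A = P2 (Z s @^-1` A).
  by move=> mA; rewrite (qE A mA); exact: integral_neg (mZA A mA).
have VN : \int[P1]_(w in Y s @^-1` N) (V1 w)%:E \is a fin_num.
  rewrite ge0_fin_numE; last by apply: integral_ge0 => w _; exact: weight_ge0.
  rewrite (le_lt_trans (weight_integral_le P1 w1 (mYA N mN)))//.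
  by rewrite ltey_eq fin_num_measure//; exact: mYA.
(* adding the equal masses of the matched parts turns p and q into full laws *)
have pq : p N <= q N + e%:E.
  rewrite -(leeD2lE _ _ VN) addeA {2}VE//.
  by have := sP N mN; rewrite -fl1// -fl2.
have qf : q N \is a fin_num by exact: fin_num_measure.
have VT := E1 setT measurableT; rewrite !preimage_setT in VT; rewrite VT.
have VT' := fl1 setT measurableT; rewrite !preimage_setT in VT'.
have P1T : \int[P1]_w (V1 w)%:E + p setT = 1.
  by rewrite VT'; exact: probability_setT.
rewrite -(leeD2rE _ _ qf) -P1T.
have -> : \int[P1]_w (V1 w)%:E + p setT + q N =
    \int[P1]_w (V1 w)%:E + (\int[p]_x (g1 x)%:E + p N).
  by rewrite -addeA; congr (_ + _); exact: gN.
rewrite addeA -[leRHS]addeA (addeC e%:E).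
by apply: leeD.
Qed.

(** The tolerance at step k is 1 / (k + 1), so the whole mass is matched in the
    limit. *)
Lemma greedy_matching : exists (t : nat -> R) (V1 : nat -> Om1 -> R) (V2 : nat -> Om2 -> R),
  [/\ forall k, matched (t k) (V1 k) (V2 k),
      V1 0%N = cst 0%R /\ V2 0%N = cst 0%R,
      {homo t : n k / (n <= k)%N >-> (n <= k)%R} &
      [/\ forall w, {homo V1 ^~ w : n k / (n <= k)%N >-> (n <= k)%R},
          forall w, {homo V2 ^~ w : n k / (n <= k)%N >-> (n <= k)%R} &
          forall k, 1 <= \int[P1]_w (V1 k.+1 w)%:E + (k.+1%:R^-1)%:E]].
Proof.
pose S := (R * (Om1 -> R) * (Om2 -> R))%type.
pose ok (x : S) := matched x.1.1 x.1.2 x.2.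
have /choice[nxt nxtP] : forall xn : S * nat, exists y : S, ok xn.1 ->
    [/\ ok y, (forall w, (xn.1.1.2 w <= y.1.2 w)%R), (forall w, (xn.1.2 w <= y.2 w)%R),
    (xn.1.1.1 <= y.1.1)%R & 1 <= \int[P1]_w (y.1.2 w)%:E + (xn.2.+1%:R^-1)%:E].
  move=> [x n]; have [okx|nok] := pselect (ok x); last by exists x.
  have n0 : (0 < n.+1%:R^-1 :> R)%R by rewrite invr_gt0.
  have [t [V1 [V2 H]]] := matched_step okx n0.
  by exists (t, V1, V2).
pose fix st (n : nat) : S := if n is n'.+1 then nxt (st n', n')
  else (0%R, cst 0%R, cst 0%R).
have okst n : ok (st n).
  elim: n => [|n IH]; first exact: matched0.
  by have [] := nxtP (st n, n) IH.
have stS n := nxtP (st n, n) (okst n).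
exists (fun n => (st n).1.1), (fun n => (st n).1.2), (fun n => (st n).2); split.
- exact: okst.
- by [].
- by apply: homo_leq => [//|r s t| n]; [exact: le_trans|have [] := stS n].
split.
- by move=> w; apply: homo_leq => [//|r s t| n]; [exact: le_trans|have [_ /(_ w)] := stS n].
- by move=> w; apply: homo_leq => [//|r s t| n]; [exact: le_trans|have [_ _ /(_ w)] := stS n].
- by move=> k; have [] := stS k.
Qed.

End greedy_matching.

(** * Sampling a path with a uniform variable *)

Section uniform_slices.
Context {R : realType} {d1} {Om : measurableType d1} (P : probability Om R).
Local Open Scope ereal_scope.

Definition unif : probability (measurableTypeR R) R := uniform_prob (@ltr01 R).

Definition randomized : probability (Om * measurableTypeR R)%type R := P \x unif.

Lemma unif_interval (a b : R) : (0 <= a)%R -> (0 <= b)%R -> (a + b <= 1)%R ->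
  unif [set u | (a <= u < a + b)%R] = b%:E.
Proof.
move=> a0 b0 ab1; rewrite /unif/= /uniform_prob integral_uniform_pdf.
rewrite (_ : [set u : R | (a <= u < a + b)%R] = `[a, (a + b)%R[%classic); last first.
  by apply/seteqP; split=> u /=; rewrite in_itv.
rewrite setIidl; last first.
  move=> u /=; rewrite !in_itv/= => /andP[au uab]; rewrite (le_trans a0 au)/=.
  by rewrite (le_trans (ltW uab)).
rewrite (eq_integral (cst 1)); last first.
  move=> u; rewrite inE/= in_itv/= => /andP[au uab].
  by rewrite /uniform_pdf (le_trans a0 au) (le_trans (ltW uab))//= subr0 invr1.
rewrite integral_cst//= mul1e lebesgue_measure_itv/= lte_fin ltrDl.
case: ltP b0 => // b0' b0; first by rewrite -EFinB addrAC subrr add0r.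
by congr EFin; apply/eqP; rewrite eq_le b0.
Qed.

Definition slice (D : set Om) (a b : Om -> R) : set (Om * R) :=
  [set p | [/\ D p.1, (a p.1 <= p.2)%R & (p.2 < a p.1 + b p.1)%R]].

Lemma measurable_slice D (a b : Om -> R) : measurable D -> measurable_fun setT a ->
  measurable_fun setT b -> measurable (slice D a b).
Proof.
move=> mD ma mb.
have ma1 : measurable_fun setT (fun p : Om * R => a p.1).
  exact: (measurableT_comp ma measurable_fst).
have mb1 : measurable_fun setT (fun p : Om * R => b p.1).
  exact: (measurableT_comp mb measurable_fst).
rewrite (_ : slice D a b = (fst @^-1` D `&` ~` [set p | (p.2 < a p.1)%R]) `&`
  [set p | (p.2 < a p.1 + b p.1)%R]).
  apply: measurableI; last first.
    by apply: measurable_ltr_set; [exact: measurable_snd|exact: measurable_funD].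
  apply: measurableI; first exact: (measurable_preimageT measurable_fst mD).
  by apply: measurableC; apply: measurable_ltr_set => //; exact: measurable_snd.
apply/seteqP; split=> p /=.
  by move=> [? ? ?]; split => //; split => //; apply/negP; rewrite -leNgt.
by move=> [[? /negP]]; rewrite -leNgt.
Qed.

Lemma randomized_slice D (a b : Om -> R) : measurable D -> measurable_fun setT a ->
  measurable_fun setT b -> (forall w, 0 <= a w)%R -> (forall w, 0 <= b w)%R ->
  (forall w, a w + b w <= 1)%R ->
  randomized (slice D a b) = \int[P]_(w in D) (b w)%:E.
Proof.
move=> mD ma mb a0 b0 ab1; rewrite [RHS]integral_mkcond.
apply: eq_integral => w _; rewrite patchE.
case: ifPn => [/set_mem|/negP] Dw.
  rewrite -(unif_interval (a0 w) (b0 w) (ab1 w)) /=; congr (uniform_prob _ _).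
  apply/seteqP; split=> u; rewrite /xsection/= inE /slice/=; first by move=> [_ -> ->].
  by move=> /andP[].
rewrite /= (_ : xsection (slice D a b) w = set0); first exact: measure0.
apply/seteqP; split=> u //=; rewrite /xsection/= inE => -[/= Dw' _ _].
by apply: Dw; exact/mem_set.
Qed.

End uniform_slices.

Section randomized_gluing.
Context {R : realType} {d1} {Om1 : measurableType d1} (P1 : probability Om1 R).
Context {d2} {Om2 : measurableType d2} (P2 : probability Om2 R).
Context {d} {T : measurableType d}.
Variables (eta1 : nat -> Om1 -> T) (eta2 : nat -> Om2 -> T).
Variables (V1 : nat -> Om1 -> R) (V2 : nat -> Om2 -> R) (phi : Om2 -> R).
Local Open Scope ereal_scope.
Hypothesis meta1 : forall k, measurable_fun setT (eta1 k).
Hypothesis meta2 : forall k, measurable_fun setT (eta2 k).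
Hypothesis mphi : measurable_fun setT phi.
Hypothesis wV1 : forall k, weight (V1 k).
Hypothesis wV2 : forall k, weight (V2 k).
Hypothesis ndV1 : forall w, {homo V1 ^~ w : n k / (n <= k)%N >-> (n <= k)%R}.
Hypothesis ndV2 : forall w, {homo V2 ^~ w : n k / (n <= k)%N >-> (n <= k)%R}.
Hypothesis V10 : forall w, V1 0%N w = 0%R.
Hypothesis V20 : forall w, V2 0%N w = 0%R.
Hypothesis V12 : forall k A, measurable A ->
  \int[P1]_(w in eta1 k @^-1` A) (V1 k.+1 w - V1 k w)%:E =
  \int[P2]_(w in eta2 k @^-1` A) (V2 k.+1 w - V2 k w)%:E.
Hypothesis mass1 : forall k, 1 <= \int[P1]_w (V1 k.+1 w)%:E + (k.+1%:R^-1)%:E.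
Hypothesis mass2 : forall k, 1 <= \int[P2]_w (V2 k.+1 w)%:E + (k.+1%:R^-1)%:E.

Let v1 k w := (V1 k.+1 w - V1 k w)%R.
Let v2 k w := (V2 k.+1 w - V2 k w)%R.

Lemma weight_gap {d'} {S : measurableType d'} (V : nat -> S -> R) k :
  (forall k, weight (V k)) -> (forall w, {homo V ^~ w : n k / (n <= k)%N >-> (n <= k)%R}) ->
  weight (fun w => V k.+1 w - V k w)%R.
Proof.
move=> wV nd; split.
  by apply: measurable_funB; [have [] := wV k.+1|have [] := wV k].
move=> w; have [_ /(_ w)] := wV k; have [_ /(_ w)] := wV k.+1.
by have := nd w k k.+1 (leqnSn k); lra.
Qed.

Let wv1 k : weight (v1 k). Proof. exact: weight_gap. Qed.
Let wv2 k : weight (v2 k). Proof. exact: weight_gap. Qed.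

(** Successive stages occupy adjacent intervals, which fill [0, 1[ up to a null
    set. *)
Definition stage k : set (Om1 * R) := slice setT (V1 k) (v1 k).

Lemma measurable_stage k : measurable (stage k).
Proof. by apply: measurable_slice; [|have [] := wV1 k|have [] := wv1 k]. Qed.

Lemma stageE k p : stage k p <-> (V1 k p.1 <= p.2 < V1 k.+1 p.1)%R.
Proof.
by rewrite /stage /slice/= /v1 addrC subrK; split=> [[_ -> ->]|/andP[]].
Qed.

Lemma trivIset_stage : trivIset setT stage.
Proof.
apply: ltn_trivIset => n k nk; apply/seteqP; split=> p //=.
move=> [/stageE/andP[_ pk] /stageE/andP[np _]].
by move: pk; rewrite ltNge (le_trans (ndV1 _ nk) np).
Qed.

(** After k stages the mass left over is at most 1 / k. *)
Lemma stage_cover : randomized P1 (~` \bigcup_k stage k) = 0.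
Proof.
have mU : measurable (\bigcup_k stage k).
  by apply: bigcupT_measurable => k; exact: measurable_stage.
have sub n : slice setT (cst 0%R) (V1 n) `<=` \bigcup_k stage k.
  elim: n => [|n IH] p [_ /= p0]; rewrite add0r => pV.
    by move: pV; rewrite V10 ltNge p0.
  have [pn|np] := ltP p.2 (V1 n p.1); first by apply: IH; split => //=; rewrite add0r.
  by exists n => //; apply/stageE; rewrite np.
apply/eqP; rewrite eq_le measure_ge0 andbT; apply/lee_addgt0Pr => e e0.
have [k ke] := exists_natinv e0.
rewrite add0e (le_trans _ (_ : (k.+1%:R^-1)%:E <= e%:E))// ?lee_fin//.
have PU : randomized P1 (\bigcup_k stage k) \is a fin_num by exact: fin_num_measure.
have : randomized P1 (slice setT (cst 0%R) (V1 k.+1)) <= randomized P1 (\bigcup_k stage k).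
  apply: le_measure; rewrite ?inE//.
  by apply: measurable_slice => //; have [] := wV1 k.+1.
rewrite randomized_slice//; last 3 first.
- by have [] := wV1 k.+1.
- by move=> w; have [_ /(_ w)/andP[]] := wV1 k.+1.
- by move=> w; rewrite add0r; have [_ /(_ w)/andP[]] := wV1 k.+1.
move=> VU; have := le_trans (mass1 k) (leeD2r _ VU).
have -> : 1 = randomized P1 (\bigcup_k stage k) + randomized P1 (~` \bigcup_k stage k).
  rewrite -measureU//; first by rewrite setUv; apply/esym; exact: probability_setT.
  - exact: measurableC.
  - by rewrite setICr.
by rewrite leeD2lE.
Qed.

Let mZA k A : measurable A -> measurable (eta2 k @^-1` A).
Proof. by move=> mA; exact: (measurable_preimageT (meta2 k) mA). Qed.

Let mYA k A : measurable A -> measurable (eta1 k @^-1` A).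
Proof. by move=> mA; exact: (measurable_preimageT (meta1 k) mA). Qed.

Let below s : set Om2 := [set w | (phi w < s)%R].

Let mbelow s : measurable (below s).
Proof. by apply: measurable_ltr_set. Qed.

Lemma weight_indic {d'} {S : measurableType d'} (D : set S) : measurable D ->
  weight (\1_D : S -> R).
Proof.
move=> mD; split; first exact: measurable_indic.
by move=> w; rewrite indicE; case: (_ \in _); rewrite ?lexx ?ler01.
Qed.

(** Conditional distribution functions of the code [phi] given the place [eta2
    k], under the part of P2 matched at stage k. They are integrated along
    [eta1 k], which has the same law under the part of P1 matched at that
    stage. *)
Lemma stage_kernels : exists F : nat -> rat -> T -> R, (forall k r, weight (F k r)) /\
  forall k s A, measurable A ->
    \int[P1]_(w in eta1 k @^-1` A) (v1 k w * running_max (F k) s n (eta1 k w))%:E @[n --> \oo]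
      --> \int[P2]_(w in eta2 k @^-1` A `&` below s) (v2 k w)%:E.
Proof.
suff /choice[F FP] : forall k, exists F : rat -> T -> R, (forall r, weight (F r)) /\
  forall s A, measurable A ->
    \int[P1]_(w in eta1 k @^-1` A) (v1 k w * running_max F s n (eta1 k w))%:E @[n --> \oo]
      --> \int[P2]_(w in eta2 k @^-1` A `&` below s) (v2 k w)%:E.
  by exists F; split=> [k r|k s A mA]; have [] := FP k => // _ h; exact: h.
move=> k.
have [m [mE mI]] := weighted_law P1 (wv1 k) (meta1 k).
have /choice[a aP] : forall s, exists a : {finite_measure set T -> \bar R},
    forall A, measurable A -> a A = \int[P2]_(w in eta2 k @^-1` A `&` below s) (v2 k w)%:E.
  move=> s; have wI := weight_mul (wv2 k) (weight_indic (mbelow s)).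
  have [a [aE _]] := weighted_law P2 wI (meta2 k); exists a => A mA.
  rewrite aE// [RHS]integral_mkcondr; apply: eq_integral => w _.
  by rewrite patchE indicE; case: ifP => _; rewrite /= ?mulr1 ?mulr0.
have mono D D' : measurable D -> measurable D' -> D `<=` D' ->
    \int[P2]_(w in D) (v2 k w)%:E <= \int[P2]_(w in D') (v2 k w)%:E.
  move=> mD mD' DD'; apply: ge0_subset_integral => //.
    by apply: measurable_funTS; exact: weight_measurable.
  by move=> w _; exact: weight_ge0.
have mAs A s : measurable A -> measurable (eta2 k @^-1` A `&` below s).
  by move=> mA; apply: measurableI => //; exact: mZA.
have a_le s A : measurable A -> a s A <= m A.
  move=> mA; rewrite aP// mE// /v1 V12//; apply: mono; [exact: mAs|exact: mZA|].
  by move=> w [].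
have a_mono r s A : (r <= s)%R -> measurable A -> a r A <= a s A.
  move=> rs mA; rewrite !aP//; apply: mono; [exact: mAs..|].
  by move=> w [Aw wr]; split => //; exact: lt_le_trans rs.
have a_left s A e : (0 < e)%R -> measurable A ->
    exists2 r : rat, (ratr r < s)%R & a s A <= a (ratr r) A + e%:E.
  move=> e0 mA; pose G n := eta2 k @^-1` A `&` below (s - n.+1%:R^-1)%R.
  have mG n : measurable (G n) by exact: mAs.
  have UG : \bigcup_n G n = eta2 k @^-1` A `&` below s.
    apply/seteqP; split=> [w [n _ [Aw wn]]|w [Aw ws]].
      by split => //; rewrite /below/= (lt_le_trans wn)// gerBl.
    have sw : (0 < (s - phi w) / 2)%R by rewrite divr_gt0// subr_gt0.
    have [n nE] := exists_natinv sw; exists n => //; split => //.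
    have ws' : (phi w < s)%R by exact: ws.
    rewrite /below/=; move: nE ws'; move: (n.+1%:R^-1 : R)%R => z.
    by lra.
  have ndG : nondecreasing_seq G.
    move=> i j ij; apply/subsetPset => w [Aw wi]; split => //.
    rewrite /below/= (lt_le_trans wi)// lerD2l lerN2 lef_pV2 ?posrE//.
    by rewrite ler_nat.
  have := nondecreasing_cvg_mu (mu := density_measure P2 (wv2 k)) mG
    (bigcupT_measurable _ mG) ndG.
  rewrite UG => cv.
  have afin : a s A \is a fin_num by exact: fin_num_measure.
  have sE : density_measure P2 (wv2 k) (eta2 k @^-1` A `&` below s) = a s A by rewrite aP.
  have lt : a s A - e%:E < density_measure P2 (wv2 k) (eta2 k @^-1` A `&` below s).
    by rewrite sE lteBlDr// lteDl.
  have [N _ HN] := cv [set u | a s A - e%:E < u] (open_ereal_gt' lt).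
  have [r] := @rat_in_itvoo R (s - N.+1%:R^-1) s ltac:(by rewrite gtrBl).
  rewrite in_itv/= => /andP[Nr rs]; exists r => //.
  rewrite -leeBlDr//; apply: (le_trans (ltW (HN N (leqnn N)))).
  rewrite aP//; apply: mono; [exact: mG|exact: mAs|].
  by move=> w [Aw wN]; split => //; exact: lt_trans Nr.
have [F wF FE] := disintegration a_le a_mono a_left.
exists F; split => // s A mA; rewrite -aP//.
have E n : \int[P1]_(w in eta1 k @^-1` A) (v1 k w * running_max F s n (eta1 k w))%:E =
    \int[m]_(x in A) (running_max F s n x)%:E.
  have wm := weight_running_max s n wF.
  rewrite (mI (fun x => (running_max F s n x)%:E) A mA (weight_measurable wm)).
    by apply: eq_integral => w _; rewrite EFinM.
  by move=> x; exact: weight_ge0.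
by under eq_fun do rewrite E; exact: FE.
Qed.

Lemma running_max_gt (F : rat -> T -> R) (s : R) n x (c y : R) : (0 <= y)%R ->
  (y < c * running_max F s n x)%R -> exists2 r : rat, (ratr r < s)%R & (y < c * F r x)%R.
Proof.
move=> y0; elim: n => [|n IH] /=; first by rewrite mulr0 ltNge y0.
rewrite maxEle; case: ifP => _; last exact: IH.
rewrite /rat_term; case: unpickle => [r|]; last by rewrite mulr0 ltNge y0.
by case: ifPn => [rs|_]; [exists r|rewrite mulr0 ltNge y0].
Qed.

Lemma running_max_ge (F : rat -> T -> R) (s : R) (r : rat) x : (ratr r < s)%R ->
  (F r x <= running_max F s (pickle r).+1 x)%R.
Proof. by move=> rs; rewrite /= /rat_term pickleK rs le_max lexx orbT. Qed.

(** The quantile transform, performed on the interval of each stage: the code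
    is below s when, for some rational r < s, the uniform variable has not
    passed the fraction F k r of the interval. Comparing it with V1 k + (V1
    k.+1 - V1 k) * F k r makes a rescaling of the interval superfluous. *)
Lemma randomized_code : exists2 phi' : Om1 * measurableTypeR R -> \bar R,
  measurable_fun setT phi' & forall k A B, measurable A -> measurable B ->
    randomized P1 (stage k `&` (eta1 k \o fst) @^-1` A `&` phi' @^-1` B) =
    \int[P2]_(w in eta2 k @^-1` A `&` (EFin \o phi) @^-1` B) (v2 k w)%:E.
Proof.
have [F [wF FE]] := stage_kernels.
pose b k (f : T -> R) w := (v1 k w * f (eta1 k w))%R.
have wb k f : weight f -> weight (b k f).
  move=> wf; apply: weight_mul => //; split; last by move=> w; have [_] := wf; exact.
  by have [mf _] := wf; exact: (measurableT_comp mf (meta1 k)).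
have mV k : measurable_fun setT (V1 k) by have [] := wV1 k.
have bV k f w : weight f -> (V1 k w + b k f w <= V1 k.+1 w)%R.
  move=> [_ /(_ (eta1 k w))]; rewrite /b; have [_ /(_ w)] := wv1 k.
  by rewrite /v1; nra.
pose hit r := \bigcup_j slice setT (V1 j) (b j (F j r)).
pose phi' (p : Om1 * measurableTypeR R) : \bar R :=
  ereal_inf [set (ratr r)%:E | r in [set r | hit r p]].
have phi'E p (s : R) : phi' p < s%:E <-> exists2 r : rat, (ratr r < s)%R & hit r p.
  split=> [/ereal_inf_lt[_ [r hr <-]]|[r rs hr]].
    by rewrite lte_fin => rs; exists r.
  apply: (@le_lt_trans _ _ (ratr r)%:E); last by rewrite lte_fin.
  by apply: ereal_inf_lbound; exists r.
have msl k D f : measurable D -> weight f -> measurable (slice D (V1 k) (b k f)).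
  by move=> mD wf; apply: measurable_slice => //; have [] := wb k f wf.
have mhit r : measurable (hit r) by apply: bigcupT_measurable => j; exact: msl.
have mphi' : measurable_fun setT phi'.
  apply: (measurability _ (ErealGenInftyO.measurableE R)) => //.
  move=> _ [_ [s ->] <-]; rewrite setTI.
  rewrite (_ : _ @^-1` _ = [set p | exists r : rat, (ratr r < s)%R /\ hit r p]).
    apply: measurable_exists => r; have [rs|rs] := boolP (ratr r < s)%R.
      by rewrite (_ : [set p | _] = hit r); [exact: mhit|apply/seteqP; split=> p //= -[]].
    by rewrite (_ : [set p | _] = set0); [exact: measurable0|apply/seteqP; split=> p //= -[]].
  apply/seteqP; split=> p /=; rewrite in_itv/=.
    by move=> /phi'E[r rs hr]; exists r.
  by move=> [r [rs hr]]; apply/phi'E; exists r.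
exists phi' => // k A B mA mB.
have mK : measurable (stage k `&` (eta1 k \o fst) @^-1` A).
  apply: measurableI; first exact: measurable_stage.
  exact: (measurable_preimageT (measurableT_comp (meta1 k) measurable_fst) mA).
pose m1' := image_measure
  (mrestr (randomized P1) mK) mphi'.
have mphiE : measurable_fun setT (EFin \o phi) by exact/measurable_EFinP.
pose m2' := image_measure
  (mrestr (density_measure P2 (wv2 k)) (mZA k mA)) mphiE.
pose G := [set C : set (\bar R) | C = setT \/ exists s : R, C = `]-oo, s%:E[%classic].
have Gm : G `<=` measurable.
  by move=> _ [->|[s ->]]; [exact: measurableT|exact: emeasurable_itv].
have GI : setI_closed G.
  move=> _ _ [->|[s ->]] [->|[r ->]]; rewrite ?setTI ?setIT;
    [by left|by right; exists r|by right; exists s|].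
  right; exists (Num.min s r); apply/seteqP; split=> x /=; rewrite !in_itv/= EFin_min lt_min.
    by move=> [-> ->].
  by move=> /andP[].
have fin1 : m1' setT < +oo.
  change (randomized P1 (setT `&` (stage k `&` (eta1 k \o fst) @^-1` A)) < +oo).
  by rewrite setTI ltey_eq fin_num_measure.
have sB : <<s G >> B.
  have mB' : emeasurable (@ocitv R) B by exact: mB.
  rewrite ErealGenInftyO.measurableE in mB'.
  by move: mB'; apply: sub_sigma_algebra2 => _ [s ->]; right; exists s.
suff H C : G C -> m1' C = m2' C.
  have := finite_measure_eq Gm GI (or_introl erefl) fin1 H sB.
  change (randomized P1 (phi' @^-1` B `&` (stage k `&` (eta1 k \o fst) @^-1` A)) =
    \int[P2]_(w in (EFin \o phi) @^-1` B `&` eta2 k @^-1` A) (v2 k w)%:E ->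
    randomized P1 (stage k `&` (eta1 k \o fst) @^-1` A `&` phi' @^-1` B) =
    \int[P2]_(w in eta2 k @^-1` A `&` (EFin \o phi) @^-1` B) (v2 k w)%:E).
  by rewrite setIC => ->; rewrite setIC.
have slice_mass D f : measurable D -> weight f ->
    randomized P1 (slice D (V1 k) (b k f)) = \int[P1]_(w in D) (b k f w)%:E.
  move=> mD wf; apply: randomized_slice => //.
  - by have [] := wb k f wf.
  - by move=> w; have [_ /(_ w)/andP[]] := wV1 k.
  - by move=> w; have [_ /(_ w)/andP[]] := wb k f wf.
  - move=> w; apply: (le_trans (bV k f w wf)).
    by have [_ /(_ w)/andP[]] := wV1 k.+1.
move=> [->|[s ->]].
  change (randomized P1 (setT `&` (stage k `&` (eta1 k \o fst) @^-1` A)) =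
    \int[P2]_(w in setT `&` eta2 k @^-1` A) (v2 k w)%:E).
  rewrite !setTI -[RHS]V12//.
  have w1 : weight (fun _ : T => 1%R : R) by split => // x; rewrite ler01 lexx.
  rewrite (_ : _ `&` _ = slice (eta1 k @^-1` A) (V1 k) (b k (fun=> 1%R))).
    rewrite slice_mass//; last exact: mYA.
    by apply: eq_integral => w _; rewrite /b mulr1.
  apply/seteqP; split=> p; rewrite /slice/b/= mulr1.
    by move=> [[]].
  by move=> [? ? ?]; split.
change (randomized P1 (phi' @^-1` `]-oo, s%:E[ `&` (stage k `&` (eta1 k \o fst) @^-1` A)) =
  \int[P2]_(w in (EFin \o phi) @^-1` `]-oo, s%:E[ `&` eta2 k @^-1` A) (v2 k w)%:E).
pose E n := slice (eta1 k @^-1` A) (V1 k) (b k (running_max (F k) s n)).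
have wrm n : weight (running_max (F k) s n) by exact: weight_running_max.
have mE n : measurable (E n) by apply: msl => //; exact: mYA.
have ndE : nondecreasing_seq E.
  move=> i j ij; apply/subsetPset => p [pA Vp pV]; split => //.
  rewrite (lt_le_trans pV)// lerD2l ler_wpM2l//.
    by have [_ /(_ p.1)/andP[]] := wv1 k.
  exact: running_max_nd.
(* on stage k only the fractions of the interval of stage k matter, since the
   intervals of different stages are disjoint *)
have -> : phi' @^-1` `]-oo, s%:E[ `&` (stage k `&` (eta1 k \o fst) @^-1` A) = \bigcup_n E n.
  apply/seteqP; split=> p.
    move=> [/=]; rewrite in_itv/= => /phi'E[r rs [j _ [_ Vp pV]]] [pk pA].
    have pj : stage j p by apply/stageE; rewrite Vp (lt_le_trans pV)//; exact: bV.
    have jk : j = k by apply: (@trivIset_stage j k) => //; exists p.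
    exists (pickle r).+1 => //; rewrite jk in Vp pV; split => //.
    rewrite (lt_le_trans pV)// lerD2l ler_wpM2l//.
      by have [_ /(_ p.1)/andP[]] := wv1 k.
    exact: running_max_ge.
  move=> [n _ [pA Vp pV]].
  have y0 : (0 <= p.2 - V1 k p.1)%R by rewrite subr_ge0.
  have := pV; rewrite addrC -ltrBlDr => /(running_max_gt y0)[r rs pr].
  split; last split => //.
    rewrite /= in_itv/=; apply/phi'E; exists r => //; exists k => //; split => //.
    by rewrite addrC -ltrBlDr.
  by apply/stageE; rewrite Vp (lt_le_trans pV)//; exact: bV.
have cE := nondecreasing_cvg_mu (mu := randomized P1) mE (bigcupT_measurable _ mE) ndE.
have cF := FE k s A mA.
have EE : randomized P1 \o E = fun n =>
    \int[P1]_(w in eta1 k @^-1` A) (v1 k w * running_max (F k) s n (eta1 k w))%:E.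
  by apply/funext => n; apply: slice_mass => //; exact: mYA.
rewrite EE in cE.
by rewrite (cvg_unique _ cE cF)// setIC; congr (integral _ _ _); congr (_ `&` _).
Qed.

Lemma gap_sum {d'} {S : measurableType d'} (m : {measure set S -> \bar R}) (V : nat -> S -> R) D n :
  (forall k, weight (V k)) -> (forall w, {homo V ^~ w : n k / (n <= k)%N >-> (n <= k)%R}) ->
  (forall w, V 0%N w = 0%R) -> measurable D ->
  \sum_(0 <= k < n) \int[m]_(w in D) (V k.+1 w - V k w)%:E = \int[m]_(w in D) (V n w)%:E.
Proof.
move=> wV nd V0 mD; elim: n => [|n IH].
  by rewrite big_geq// (eq_integral (cst 0)) ?integral0// => w _; rewrite V0.
rewrite big_nat_recr//= IH; have wg := weight_gap n wV nd.
rewrite -ge0_integralD//; last 4 first.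
- by move=> w _; exact: weight_ge0.
- by apply: measurable_funTS; exact: weight_measurable.
- by move=> w _; exact: (weight_ge0 w wg).
- by apply: measurable_funTS; exact: (weight_measurable wg).
by apply: eq_integral => w _; rewrite -EFinD addrC subrK.
Qed.

Lemma sum_disjoint_le {d'} {S : measurableType d'} (m : {measure set S -> \bar R})
    (K : nat -> set S) (B : set S) n :
  (forall k, measurable (K k)) -> trivIset setT K -> measurable B ->
  \sum_(0 <= k < n) m (K k `&` B) <= m B.
Proof.
move=> mK tK mB; rewrite big_mkord.
have mKB k : measurable (K k `&` B) by exact: measurableI.
have tKB : trivIset setT (fun k => K k `&` B).
  by under eq_fun do rewrite setIC; exact: trivIset_setIl.
have <- : m (\big[setU/set0]_(k < n) (K k `&` B)) = \sum_(k < n) m (K k `&` B).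
  exact: (measure_bigsetU m mKB tKB).
apply: le_measure; rewrite ?inE//; first exact: bigsetU_measurable.
elim: n => [|n IH]; first by rewrite big_ord0.
by rewrite big_ord_recr/= subUset; split => //; exact: subIsetr.
Qed.

Lemma probability_eq_of_le {e1 e2} {S1 : measurableType e1} {S2 : measurableType e2}
    (m1 : probability S1 R) (m2 : probability S2 R) A1 A2 :
  measurable A1 -> measurable A2 -> m1 A1 <= m2 A2 -> m1 (~` A1) <= m2 (~` A2) ->
  m1 A1 = m2 A2.
Proof.
move=> mA1 mA2 le12; rewrite !probability_setC//.
have f1 : m1 A1 \is a fin_num by exact: fin_num_measure.
have f2 : m2 A2 \is a fin_num by exact: fin_num_measure.
move: le12; rewrite -(fineK f1) -(fineK f2) -!EFinB !lee_fin => h1 h2.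
by congr EFin; lra.
Qed.

Section law.
Variable phi' : Om1 * measurableTypeR R -> \bar R.
Hypothesis mphi' : measurable_fun setT phi'.
Hypothesis joint : forall k A B, measurable A -> measurable B ->
    randomized P1 (stage k `&` (eta1 k \o fst) @^-1` A `&` phi' @^-1` B) =
    \int[P2]_(w in eta2 k @^-1` A `&` (EFin \o phi) @^-1` B) (v2 k w)%:E.

Let mphiE : measurable_fun setT (EFin \o phi).
Proof. exact/measurable_EFinP. Qed.

(** The first n stages give to the right-hand side the part of the left-hand
    side that they match; the remaining part has mass at most 1 / n. *)
Lemma randomized_code_ge (B : set (\bar R)) : measurable B ->
  P2 ((EFin \o phi) @^-1` B) <= randomized P1 (phi' @^-1` B).
Proof.
move=> mB; have mp : measurable (phi' @^-1` B) by exact: (measurable_preimageT mphi' mB).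
have mf : measurable ((EFin \o phi) @^-1` B) by exact: (measurable_preimageT mphiE mB).
have Hk k : randomized P1 (stage k `&` phi' @^-1` B) =
    \int[P2]_(w in (EFin \o phi) @^-1` B) (v2 k w)%:E.
  by have := joint k measurableT mB; rewrite !preimage_setT setIT setTI.
have sub n := sum_disjoint_le (randomized P1) n measurable_stage trivIset_stage mp.
apply/lee_addgt0Pr => e e0; have [n ne] := exists_natinv e0.
have Vn := gap_sum P2 n.+1 wV2 ndV2 V20 mf.
apply: (@le_trans _ _ (\int[P2]_(w in (EFin \o phi) @^-1` B) (V2 n.+1 w)%:E + e%:E)); last first.
  apply: leeD => //; rewrite -Vn; under eq_bigr do rewrite -Hk.
  exact: sub.
rewrite -(integral_neg P2 (wV2 n.+1) mf); apply: leeD => //.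
apply: (@le_trans _ _ (\int[P2]_w (1 - V2 n.+1 w)%:E)).
  apply: ge0_subset_integral => //.
    exact: (weight_measurable (weight_neg (wV2 n.+1))).
  by move=> w _; exact: (weight_ge0 w (weight_neg (wV2 n.+1))).
apply: (@le_trans _ _ (n.+1%:R^-1)%:E); last by rewrite lee_fin.
have fV : \int[P2]_w (V2 n.+1 w)%:E \is a fin_num.
  rewrite ge0_fin_numE; last by apply: integral_ge0 => w _; exact: weight_ge0.
  by rewrite (le_lt_trans (weight_integral_le P2 (wV2 n.+1) measurableT))// ltey_eq fin_num_measure.
rewrite -(leeD2lE _ _ fV) (integral_neg P2 (wV2 n.+1) measurableT).
by rewrite (le_trans _ (mass2 n))// probability_le1.
Qed.

(** The inequality [randomized_code_ge] for an event and for its complement. *)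
Lemma randomized_code_law (B : set (\bar R)) : measurable B ->
  randomized P1 (phi' @^-1` B) = P2 ((EFin \o phi) @^-1` B).
Proof.
move=> mB; apply/esym; apply: probability_eq_of_le.
- exact: (measurable_preimageT mphiE mB).
- exact: (measurable_preimageT mphi' mB).
- exact: randomized_code_ge.
- exact: (randomized_code_ge (measurableC mB)).
Qed.

End law.

End randomized_gluing.

(** * The Markov property is a property of the law *)

Section markov_transfer.
Context {R : realType} {d : nat}.
Context {d1} {Om1 : measurableType d1} {P1 : probability Om1 R}.
Context {d2} {Om2 : measurableType d2} {P2 : probability Om2 R}.
Context {d3} {C : measurableType d3}.
Variables (Y1 : R -> {RV P1 >-> 'rV[R]_d}) (Y2 : R -> {RV P2 >-> 'rV[R]_d}).
Variables (D : R -> C -> 'rV[R]_d) (th1 : Om1 -> C) (th2 : Om2 -> C).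
Variable Q : R -> 'rV[R]_d -> set 'rV[R]_d -> \bar R.
Local Open Scope ereal_scope.
Hypothesis Q_weight : forall t A, measurable A ->
  exists2 q : 'rV[R]_d -> R, weight q & forall x, Q t x A = (q x)%:E.
Hypothesis mD : forall t, measurable_fun setT (D t).
Hypothesis mth1 : measurable_fun setT th1.
Hypothesis mth2 : measurable_fun setT th2.
Hypothesis th12 : forall A, measurable A -> P1 (th1 @^-1` A) = P2 (th2 @^-1` A).
Hypothesis Y1E : forall t w, (0 <= t)%R -> Y1 t w = D t (th1 w).
Hypothesis Y2E : forall t w, (0 <= t)%R -> Y2 t w = D t (th2 w).

Let code_past (s : R) : set (set C) :=
  \bigcup_(u in `[0%R, s]) preimage_set_system setT (D u) measurable.

Let pull s B : past_events Y2 s B ->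
  exists2 B', <<s code_past s >> B' & B = th2 @^-1` B'.
Proof.
move=> pB; suff : preimage_set_system setT th2 <<s code_past s >> B.
  by move=> [B' sB' <-]; exists B' => //; rewrite setTI.
move: B pB; apply: smallest_sub.
  by apply: sigma_algebra_preimage; exact: smallest_sigma_algebra.
move=> _ [u us [A mA <-]]; exists (D u @^-1` A).
  by apply: sub_sigma_algebra; exists u => //; exists A => //; rewrite setTI.
have u0 : (0 <= u)%R by move: us; rewrite /= in_itv/= => /andP[].
by rewrite !setTI; apply/seteqP; split=> w /=; rewrite Y2E.
Qed.

Let push s B : <<s code_past s >> B -> past_events Y1 s (th1 @^-1` B).
Proof.
suff : <<s code_past s >> `<=` image_set_system setT th1 (past_events Y1 s).
  by move=> /(_ B) h /h; rewrite /image_set_system/= setTI.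
apply: smallest_sub.
  by apply: sigma_algebra_image; exact: smallest_sigma_algebra.
move=> _ [u us [A mA <-]]; rewrite /image_set_system/= !setTI.
have u0 : (0 <= u)%R by move: us; rewrite /= in_itv/= => /andP[].
apply: sub_sigma_algebra; exists u => //; exists A => //.
by rewrite setTI; apply/seteqP; split=> w /=; rewrite Y1E.
Qed.

(** The past events of both processes are inverse images of the same events of
    C, and both sides of the Markov property are integrals against the common
    law of the code. *)
Lemma markov_transfer : markov_process Q Y1 -> markov_process Q Y2.
Proof.
move=> mY s t A B s0 t0 mA pB; have [B' sB' BE] := pull pB.
have [q wq qE] := Q_weight t mA.
have st0 : (0 <= s + t)%R by rewrite addr_ge0.
have mB' : measurable B'.
  move: sB'; apply: smallest_sub; first exact: sigma_algebra_measurable.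
  by move=> _ [u _ [E mE <-]]; rewrite setTI; exact: (measurable_preimageT (mD u) mE).
have mDA : measurable (D (s + t)%R @^-1` A) by exact: (measurable_preimageT (mD _) mA).
have := mY s t A (th1 @^-1` B') s0 t0 mA (push sB').
have -> : th1 @^-1` B' `&` Y1 (s + t)%R @^-1` A = th1 @^-1` (B' `&` D (s + t)%R @^-1` A).
  by apply/seteqP; split=> w /=; rewrite Y1E.
have -> : B `&` Y2 (s + t)%R @^-1` A = th2 @^-1` (B' `&` D (s + t)%R @^-1` A).
  by rewrite BE; apply/seteqP; split=> w /=; rewrite Y2E.
rewrite th12; last exact: measurableI.
move=> ->; rewrite BE.
pose m1 := image_measure P1 mth1.
pose m2 := image_measure P2 mth2.
have mq : measurable_fun setT (fun c => (q (D s c))%:E).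
  apply/measurable_EFinP; have [mq _] := wq; exact: (measurableT_comp mq (mD s)).
have q0 c : 0 <= (q (D s c))%:E by exact: weight_ge0.
transitivity (\int[m1]_(c in B') (q (D s c))%:E).
  rewrite (ge0_integral_pushforward mth1)//; last exact: measurable_funTS.
  by apply: eq_integral => w _; rewrite qE Y1E.
transitivity (\int[m2]_(c in B') (q (D s c))%:E).
  by apply: eq_measure_integral => E mE _; exact: th12.
rewrite (ge0_integral_pushforward mth2)//; last exact: measurable_funTS.
by apply: eq_integral => w _; rewrite qE Y2E.
Qed.

End markov_transfer.

(** * Laws at late times *)

Section mixing.
Context {R : realType} {d : nat} {d0 : measure_display} {Om : measurableType d0}
  {P : probability Om R}.
Variable X : R -> {RV P >-> 'rV[R]_d}.
Hypothesis hX : levy_process X.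
Hypothesis hX0 : {ae P, forall w, X 0 w = 0}.
Local Notation Q := (levy_transition X).
Local Open Scope ereal_scope.

Lemma transition_weight t A : measurable A ->
  exists2 q : 'rV[R]_d -> R, weight q & forall x, Q t x A = (q x)%:E.
Proof.
move=> mA; exists (fun x => fine (Q t x A)).
  split; first by apply: measurableT_comp => //; exact: (measurable_transition (P := P) X t mA).
  move=> x; rewrite levy_lawE; apply/andP; split; first exact/fine_ge0/measure_ge0.
  have mx : measurable ((fun z : 'rV[R]_d => x + z)%R @^-1` A).
    have mD : measurable_fun setT (fun z : 'rV[R]_d => x + z)%R by exact: measurable_rVD.
    exact: (measurable_preimageT mD mA).
  rewrite -lee_fin fineK; first exact: probability_le1.
  exact: fin_num_measure.
move=> x; rewrite fineK// levy_lawE fin_num_measure//.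
have mD : measurable_fun setT (fun z : 'rV[R]_d => x + z)%R by exact: measurable_rVD.
exact: (measurable_preimageT mD mA).
Qed.

Lemma var_dist_event t x y A : measurable A ->
  `|Q t x A - Q t y A| <= var_dist (Q t x) (Q t y).
Proof.
move=> mA; apply: ereal_sup_ubound; exists (indic_mfun A mA : {mfun _ >-> R}).
  move=> z; change (`|\1_A z : R| <= 1)%R; rewrite indicE.
  by case: (_ \in _); rewrite ?normr1 ?normr0.
have H z : \int[Q t z]_v (indic_mfun A mA v)%:E = Q t z A.
  have mx : measurable_fun setT (fun w => z + X t w)%R by exact: measurable_rVD.
  pose m := image_measure P mx.
  transitivity (m (A `&` setT)); last by rewrite setIT.
  exact: (integral_indic m measurableT mA).
by rewrite !H.
Qed.

(** Choose for each n an event that violates the bound, if there is one.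
    Dominated convergence along these events, with the pointwise bound of
    [levy_var_decay], shows that for large n there is none. *)
Lemma transition_mixing (t0 : R) (mu : probability 'rV[R]_d R) (e : R) :
  (0 < t0)%R -> has_ac_component (Q t0 0%R) -> (0 < e)%R ->
  \forall n \near \oo, forall A, measurable A ->
    \int[mu]_x (`|fine (Q n%:R x A) - fine (Q n%:R 0%R A)|)%:E <= e%:E.
Proof.
move=> t00 ac e0.
pose g (A : set 'rV[R]_d) (n : nat) x := `|fine (Q n%:R x A) - fine (Q n%:R 0%R A)|%R.
(* B n violates the bound at time n whenever some event does *)
have /choice[B BP] : forall n : nat, exists A : set 'rV[R]_d, measurable A /\
    ((exists A', measurable A' /\ ~ (\int[mu]_x (g A' n x)%:E <= e%:E)) ->
     ~ (\int[mu]_x (g A n x)%:E <= e%:E)).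
  move=> n; have [[A [mA h]]|no] := pselect (exists A', measurable A' /\
      ~ (\int[mu]_x (g A' n x)%:E <= e%:E)).
    by exists A.
  by exists setT.
have fQ n x A : measurable A -> Q n%:R x A = (fine (Q n%:R x A))%:E.
  by move=> mA; have [q _ qE] := transition_weight n%:R mA; rewrite qE.
have Q01 n x A : measurable A -> (0 <= fine (Q n%:R x A) <= 1)%R.
  move=> mA; have [q [_ q01] qE] := transition_weight n%:R mA; rewrite qE; exact: q01.
have mg n A : measurable A -> measurable_fun setT (g A n).
  move=> mA; apply: measurableT_comp => //; apply: measurable_funB => //.
  by apply: measurableT_comp => //; exact: (measurable_transition (P := P) X n%:R mA).
have fgE n x A : measurable A -> (g A n x)%:E = `|Q n%:R x A - Q n%:R 0%R A|.
  by move=> mA; rewrite (fQ n x A mA) (fQ n 0%R A mA).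
have gcvg x : g (B n) n x @[n --> \oo] --> (0 : R)%R.
  have [c c0 cP] := levy_var_decay hX hX0 x 0%R t00 ac.
  apply/cvgrPdist_le => e' e'0; exists (Num.trunc ((c / e') ^+ 2)).+1 => // n /= nN.
  have n0 : (0 < n%:R :> R)%R by rewrite ltr0n (leq_trans _ nN).
  rewrite sub0r normrN normr_id -lee_fin.
  change ((g (B n) n x)%:E <= e'%:E); rewrite fgE; last by have [] := BP n.
  have vd := @var_dist_event n%:R x 0%R (B n) (BP n).1.
  apply: (le_trans vd); apply: (le_trans (cP _ n0)); rewrite lee_fin.
  have sn0 : (0 < Num.sqrt n%:R :> R)%R by rewrite sqrtr_gt0.
  rewrite ler_pdivrMr// mulrC -ler_pdivrMr//.
  rewrite -[leLHS]ger0_norm; last by rewrite divr_ge0// ltW.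
  rewrite -sqrtr_sqr ler_wsqrtr// ltW// (lt_le_trans (truncnS_gt _))// ler_nat.
  exact: leq_trans nN.
have cvg0 : \int[mu]_x (g (B n) n x)%:E @[n --> \oo] --> \int[mu]_x (cst 0 x : \bar R).
  have [] := @dominated_convergence _ _ _ mu setT measurableT (fun n x => (g (B n) n x)%:E)
    (cst 0) (cst 1).
  - by move=> n; apply/measurable_EFinP; apply: mg; have [] := BP n.
  - exact: measurable_cst.
  - apply: aeW => x _; apply: cvg_EFin; [exact: nearW|exact: gcvg].
  - have c1 : mu.-integrable setT (EFin \o cst 1%R).
      by apply: (@bounded_integrable _ _ _ _ _ 1) => // x; rewrite normr1.
    exact: c1.
  - apply: aeW => x n _; rewrite abse_EFin lee_fin /g normr_id.
    have := Q01 n x (B n) (BP n).1; have := Q01 n 0%R (B n) (BP n).1.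
    by move=> h1 h2; apply/ler_normlP; split; lra.
  by [].
rewrite integral0 in cvg0.
have lt0 : 0 < e%:E by rewrite lte_fin.
have nb := cvg0 [set u | u < e%:E] (open_ereal_lt' lt0).
have [N _ HN] := nb; exists N => // n nN A mA; have nlt := HN n nN.
have [//|nle] := pselect (\int[mu]_x (g A n x)%:E <= e%:E).
by have [_ /(_ (ex_intro _ A (conj mA nle)))] := BP n; case; exact: ltW.
Qed.

(** Both laws are compared with Q_n(0, .). *)
Lemma marginals_close {e1 e2} {T1 : measurableType e1} {T2 : measurableType e2}
    {P1 : probability T1 R} {P2 : probability T2 R}
    (Y : R -> {RV P1 >-> 'rV[R]_d}) (Z : R -> {RV P2 >-> 'rV[R]_d})
    (mu1 mu2 : probability 'rV[R]_d R) t0 :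
  (0 < t0)%R -> has_ac_component (Q t0 0%R) ->
  markov_process Q Y -> markov_process Q Z ->
  initial_distribution Y mu1 -> initial_distribution Z mu2 ->
  forall (e s : R), (0 < e)%R -> exists2 t, (s <= t)%R &
    forall A, measurable A -> P1 (Y t @^-1` A) <= P2 (Z t @^-1` A) + e%:E.
Proof.
move=> t00 ac mY mZ iY iZ e s e0; have e20 : (0 < e / 2)%R by rewrite divr_gt0.
have near1 := transition_mixing mu1 t00 ac e20.
have near2 := transition_mixing mu2 t00 ac e20.
have [N _ HN] := filterI near1 near2.
pose n := maxn N (Num.trunc s).+1; exists n%:R.
  by rewrite ltW// (lt_le_trans (truncnS_gt s))// ler_nat leq_maxr.
move=> A mA; have n0 : (0 <= n%:R :> R)%R by [].
have [/(_ A mA) H1 /(_ A mA) H2] := HN n (leq_maxl _ _).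
rewrite (markov_law mY iY n0 mA) (markov_law mZ iZ n0 mA).
have [q [mq q01] qE] := transition_weight n%:R mA.
have q0 x : (0 <= q x)%R by have /andP[] := q01 x.
have up (mu : probability 'rV[R]_d R) :
    \int[mu]_x (`|fine (Q n%:R x A) - fine (Q n%:R 0%R A)|)%:E <= (e / 2)%:E ->
    \int[mu]_x (q x)%:E <= (q 0%R)%:E + (e / 2)%:E /\
    (q 0%R)%:E <= \int[mu]_x (q x)%:E + (e / 2)%:E.
  rewrite (eq_integral (fun x => (`|q x - q 0|)%:E)); last by move=> x _; rewrite !qE.
  have mqa : measurable_fun setT (fun x => (`|q x - q 0|)%:E).
    by apply/measurable_EFinP; apply: measurableT_comp => //; exact: measurable_funB.
  have mqE : measurable_fun setT (EFin \o q) by exact/measurable_EFinP.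
  have c0 : \int[mu]_x (q 0%R)%:E = (q 0%R)%:E.
    rewrite integral_cst//; rewrite -[RHS]mule1; congr (_ * _).
    exact: probability_setT.
  move=> H; split.
    apply: (@le_trans _ _ (\int[mu]_x ((q 0%R)%:E + (`|q x - q 0|)%:E))).
      apply: ge0_le_integral => //.
      - by move=> x _; rewrite lee_fin.
      - by apply: emeasurable_funD => //; exact: measurable_cst.
      - by move=> x _; rewrite -EFinD lee_fin -lerBlDl ler_norm.
    rewrite ge0_integralD//; last by move=> x _; rewrite lee_fin.
    by rewrite c0 leeD.
  rewrite -{1}c0; apply: (@le_trans _ _ (\int[mu]_x ((q x)%:E + (`|q x - q 0|)%:E))).
    apply: ge0_le_integral => //.
    - by move=> x _; rewrite lee_fin.
    - exact: emeasurable_funD.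
    - by move=> x _; rewrite -EFinD lee_fin -lerBlDl distrC ler_norm.
  rewrite ge0_integralD//; last by move=> x _; rewrite lee_fin.
  by rewrite leeD.
have [u1 _] := up mu1 H1; have [_ u2] := up mu2 H2.
under eq_integral do rewrite qE.
under [X in _ <= X + _]eq_integral do rewrite qE.
apply: (le_trans u1); apply: (le_trans (leeD2r _ u2)).
by rewrite -addeA -EFinD -splitr.
Qed.

End mixing.

(** * Successful couplings *)

Section separation.
Local Open Scope ereal_scope.

Lemma separating_rational {R : realType} {d} (x y : 'rV[R]_d) : x != y ->
  exists (i : 'I_d) (r : rat),
  (x ord0 i < ratr r <= y ord0 i)%R \/ (y ord0 i < ratr r <= x ord0 i)%R.
Proof.
move=> xy; have [i xyi] : exists i, x ord0 i != y ord0 i.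
  by apply: contra_notP (elimN eqP xy) => /forallNP h; apply/rowP => i; apply/eqP/negPn/negP/h.
exists i; have [lt|lt|eq] := ltgtP (x ord0 i) (y ord0 i); last by rewrite eq eqxx in xyi.
  have [r] := rat_in_itvoo lt; rewrite in_itv/= => /andP[xr ry].
  by exists r; left; rewrite xr ltW.
have [r] := rat_in_itvoo lt; rewrite in_itv/= => /andP[xr ry].
by exists r; right; rewrite xr ltW.
Qed.

Lemma integral_gap {R : realType} {e} {S : measurableType e} (m : {finite_measure set S -> \bar R})
    (V V' : S -> R) D : weight V -> weight V' -> measurable D ->
  \int[m]_(w in D) (V' w - V w)%:E =
  \int[m]_(w in D) (V' w)%:E - \int[m]_(w in D) (V w)%:E.
Proof.
move=> wV wV' mD.
have iw f : weight f -> m.-integrable D (EFin \o f).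
  move=> [mf f01]; apply: (integrableS measurableT) => //.
  apply: (@bounded_integrable _ _ _ _ _ 1) => // x.
  by have /andP[? ?] := f01 x; rewrite ger0_norm.
rewrite -(integralB _ (iw _ wV') (iw _ wV))//.
Qed.

Lemma negligible_exists {R : realType} {e} {S : measurableType e} (m : {measure set S -> \bar R})
    {J : countType} (F : J -> set S) :
  (forall j, m.-negligible (F j)) -> m.-negligible [set x | exists j, F j x].
Proof.
move=> F0; pose G n := if @unpickle J n is Some j then F j else set0.
apply: (@negligibleS _ _ _ _ (\bigcup_n G n)).
  by move=> x [j Fj]; exists (pickle j) => //; rewrite /G pickleK.
apply: negligible_bigcup => n; rewrite /G; case: unpickle => [j|]; first exact: F0.
exact: negligible_set0.
Qed.

End separation.

Section gluing.
Context {R : realType} {d : nat}.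
Variable Q : R -> 'rV[R]_d -> set 'rV[R]_d -> \bar R.
Local Open Scope ereal_scope.
Hypothesis Q_weight : forall t A, measurable A ->
  exists2 q : 'rV[R]_d -> R, weight q & forall x, Q t x A = (q x)%:E.
Context {e1} {Om1 : measurableType e1} {P1 : probability Om1 R}.
Context {e2} {Om2 : measurableType e2} {P2 : probability Om2 R}.
Variables (Y : R -> {RV P1 >-> 'rV[R]_d}) (Z : R -> {RV P2 >-> 'rV[R]_d}).
Variables mu1 mu2 : probability 'rV[R]_d R.
Hypothesis mY : markov_process Q Y.
Hypothesis mZ : markov_process Q Z.
Hypothesis cY : forall w, cadlag (Y ^~ w).
Hypothesis cZ : forall w, cadlag (Z ^~ w).
Hypothesis iY : initial_distribution Y mu1.
Hypothesis iZ : initial_distribution Z mu2.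
Hypothesis close : forall (e s : R), (0 < e)%R -> exists2 t, (s <= t)%R &
    forall A, measurable A -> P1 (Y t @^-1` A) <= P2 (Z t @^-1` A) + e%:E.

Section glued_processes.

Let M := randomized P1.

Let Om := (Om1 * measurableTypeR R)%type.

Let Yr (t : R) (p : Om) : 'rV[R]_d := Y t p.1.

Let mYr t : measurable_fun setT (Yr t).
Proof. exact: (measurableT_comp (measurable_funP (Y t)) measurable_fst). Qed.

HB.instance Definition _ t := isMeasurableFun.Build _ _ _ _ (Yr t) (mYr t).

Let Yt (t : R) : {RV M >-> 'rV[R]_d} := Yr t.

Let randomized_fst A : measurable A -> P1 (id @^-1` A) = M (fst @^-1` A).
Proof.
move=> mA; rewrite (_ : fst @^-1` A = A `*` setT); last first.
  by apply/seteqP; split=> p //= -[].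
rewrite /M/randomized/= product_measure1E// -[LHS]mule1; congr (_ * _).
by apply/esym; exact: probability_setT.
Qed.

Let markov_Yt : markov_process Q Yt.
Proof.
apply: (@markov_transfer _ _ _ _ P1 _ _ M _ Om1 Y Yt (fun t => Y t) id fst) => //.
Qed.

Let initial_Yt : initial_distribution Yt mu1.
Proof.
move=> A mA; rewrite -iY//.
have mYA : measurable (Y 0%R @^-1` A) by exact: measurable_preimageT.
exact: (esym (randomized_fst mYA)).
Qed.

Variable phi' : Om -> \bar R.
Hypothesis mphi' : measurable_fun setT phi'.
Let phi (w : Om2) : R := path_code (fun q => Z (ratr q) w).
Hypothesis law : forall B, measurable B -> M (phi' @^-1` B) = P2 ((EFin \o phi) @^-1` B).

Let dec (t : R) (c : \bar R) : 'rV[R]_d := decoded_path t (fine c).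

Let mdec t : measurable_fun setT (dec t).
Proof. exact: (measurableT_comp (measurable_decoded_path t)). Qed.

Let Zr (t : R) (p : Om) : 'rV[R]_d := dec t (phi' p).

Let mZr t : measurable_fun setT (Zr t).
Proof. exact: (measurableT_comp (mdec t) mphi'). Qed.

HB.instance Definition _ t := isMeasurableFun.Build _ _ _ _ (Zr t) (mZr t).

Let Zt (t : R) : {RV M >-> 'rV[R]_d} := Zr t.

Let decK t w : (0 <= t)%R -> Z t w = dec t (phi w)%:E.
Proof. by move=> t0; rewrite /dec/= /phi (decoded_pathK (z := Z ^~ w) (cZ w) t0). Qed.

Let mphiE : measurable_fun setT (EFin \o phi).
Proof.
apply/measurable_EFinP; apply: (measurable_path_code (Z := fun t => Z t)) => t.
exact: measurable_funP.
Qed.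

Let markov_Zt : markov_process Q Zt.
Proof.
apply: (@markov_transfer _ _ _ _ P2 _ _ M _ (\bar R) Z Zt dec (EFin \o phi) phi') => //.
by move=> A mA; rewrite -law.
Qed.

Let initial_Zt : initial_distribution Zt mu2.
Proof.
move=> A mA; rewrite -iZ//.
have mDA : measurable (dec 0%R @^-1` A) by exact: (measurable_preimageT (mdec 0%R) mA).
transitivity (M (phi' @^-1` (dec 0%R @^-1` A))); first by [].
rewrite law//; congr (P2 _).
by apply/seteqP; split=> w /=; rewrite decK.
Qed.

(** The second process decodes [phi'] at all times. It has the Markov property
    and the initial law of Z because [phi'] has the law of the code of Z. *)
Lemma glued_coupling : exists Y' Z' : R -> {RV M >-> 'rV[R]_d},
  [/\ coupling Q Y' Z', initial_distribution Y' mu1, initial_distribution Z' mu2 &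
   forall t p, Y' t p = Y t p.1 /\ Z' t p = decoded_path t (fine (phi' p))].
Proof.
exists Yt, Zt; split => //; split => //.
- by move=> p; exact: cY.
- by move=> p; exact: decoded_path_cadlag.
Qed.

End glued_processes.

(** If the two processes were at different places at the time of stage k, a
    rational half-space would separate these places. By the joint law of place
    and code, the probability of this is the mass of the same event for Z and
    its own code, and this event is empty. *)
Lemma successful_coupling :
  exists (d0 : measure_display) (Om : measurableType d0)
         (P : probability Om R) (Y' Z' : R -> {RV P >-> 'rV[R]_d}),
    [/\ coupling Q Y' Z', initial_distribution Y' mu1, initial_distribution Z' mu2
      & successful Y' Z'].
Proof.
have [t [V1 [V2 [match_ [V10 V20] tnd [nd1 nd2 mass]]]]] := greedy_matching Q_weight mY mZ close.
have w1 k : weight (V1 k) by apply: past_weight_weight; exact: matched_past1 (match_ k).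
have w2 k : weight (V2 k) by apply: past_weight_weight; exact: matched_past2 (match_ k).
pose eta1 k w := Y (t k.+1) w.
pose eta2 k w := Z (t k.+1) w.
have t0 k : (0 <= t k)%R by exact: matched_time (match_ k).
pose phi (w : Om2) : R := path_code (fun q => Z (ratr q) w).
have mphi : measurable_fun setT phi.
  by apply: (measurable_path_code (Z := fun t => Z t)) => s; exact: measurable_funP.
have V12 k A : measurable A ->
    \int[P1]_(w in eta1 k @^-1` A) (V1 k.+1 w - V1 k w)%:E =
    \int[P2]_(w in eta2 k @^-1` A) (V2 k.+1 w - V2 k w)%:E.
  move=> mA; have kk1 : (t k <= t k.+1)%R by apply: tnd.
  have mD1 : measurable (eta1 k @^-1` A) by exact: measurable_preimageT.
  have mD2 : measurable (eta2 k @^-1` A) by exact: measurable_preimageT.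
  rewrite (integral_gap P1 (w1 k) (w1 k.+1) mD1).
  rewrite (integral_gap P2 (w2 k) (w2 k.+1) mD2).
  congr (_ - _); first exact: (matched_law (match_ k.+1)).
  exact: (matched_law (match_ k)).
have mass2 k : 1 <= \int[P2]_w (V2 k.+1 w)%:E + (k.+1%:R^-1)%:E.
  have := mass k; have := matched_law (match_ k.+1) (lexx _) measurableT.
  by rewrite !preimage_setT => ->.
have meta1 k : measurable_fun setT (eta1 k) by exact: measurable_funP.
have meta2 k : measurable_fun setT (eta2 k) by exact: measurable_funP.
have V10' w : V1 0%N w = 0%R by rewrite V10.
have V20' w : V2 0%N w = 0%R by rewrite V20.
have [phi' mphi' joint] := randomized_code meta1 meta2 mphi w1 w2 nd1 nd2 V12.
have law := randomized_code_law mphi w1 w2 nd1 nd2 V20' mass2 mphi' joint.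
have [Y' [Z' [cpl iY' iZ' YZE]]] :=
  glued_coupling mphi' law.
exists _, _, (randomized P1), Y', Z'; split => //.
pose half (i : 'I_d) (r : rat) := [set v : 'rV[R]_d | (v ord0 i < ratr r)%R].
have mhalf i r : measurable (half i r).
  by apply: measurable_ltr_set => //; exact: rV_coord_measurable.
pose D k (c : \bar R) : 'rV[R]_d := decoded_path (t k.+1) (fine c).
have mD k : measurable_fun setT (D k).
  exact: (measurableT_comp (measurable_decoded_path (t k.+1))).
have DE k w : D k (phi w)%:E = eta2 k w.
  by rewrite /D /= /phi (decoded_pathK (z := Z ^~ w) (cZ w) (t0 k.+1)).
pose miss k A B := stage V1 k `&` (eta1 k \o fst) @^-1` A `&` phi' @^-1` (D k @^-1` B).
have miss0 k A B : measurable A -> measurable B -> A `&` B = set0 ->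
    (randomized P1).-negligible (miss k A B).
  move=> mA mB AB; have mDB : measurable (D k @^-1` B) by exact: (measurable_preimageT (mD k) mB).
  have mst := @measurable_stage R _ Om1 V1 w1 nd1 k.
  have me1 : measurable ((eta1 k \o fst) @^-1` A : set (Om1 * measurableTypeR R)).
    exact: (measurable_preimageT (measurableT_comp (meta1 k) measurable_fst) mA).
  have mp : measurable (phi' @^-1` (D k @^-1` B)) by exact: (measurable_preimageT mphi' mDB).
  exists (miss k A B); split => //.
    by apply: measurableI => //; exact: measurableI.
  rewrite /miss joint// (_ : _ `&` _ = set0) ?integral_set0//.
  apply/seteqP; split=> w //= [Aw]; rewrite DE => Bw.
  by have : (A `&` B) (eta2 k w) by []; rewrite AB.
pose bad := ~` (\bigcup_k stage V1 k) `|`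
  [set p | exists k i r, (miss k (half i r) (~` half i r) `|` miss k (~` half i r) (half i r)) p].
have bad0 : (randomized P1).-negligible bad.
  apply: negligibleU.
    exists (~` \bigcup_k stage V1 k); split => //.
      apply: measurableC; apply: bigcupT_measurable => k.
      exact: (@measurable_stage R _ Om1 V1 w1 nd1 k).
    exact: stage_cover w1 nd1 V10' mass.
  apply: negligible_exists => k; apply: negligible_exists => i; apply: negligible_exists => r.
  have mh := mhalf i r; have mh' := measurableC mh.
  by apply: negligibleU; apply: miss0 => //; rewrite ?setICr ?setICl.
apply: (negligibleS _ bad0) => p /= nsucc.
have [[k _ pk]|nst] := pselect ((\bigcup_k stage V1 k) p); last by left.
right; exists k; have [YZ|YZ] := eqVneq (Y' (t k.+1) p) (Z' (t k.+1) p).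
  exfalso; apply: nsucc; apply: (@le_lt_trans _ _ (t k.+1)%:E); last exact: ltry.
  by apply: ereal_inf_lbound; exists (t k.+1).
have [i [r h]] := separating_rational YZ; exists i, r.
have [YE ZE] := YZE (t k.+1) p.
case: h => /andP[h1 h2]; [left|right]; split.
- by split => //; rewrite /half /= /eta1 -YE.
- by rewrite /half /= /D -ZE; apply/negP; rewrite -leNgt.
- by split => //; rewrite /half /= /eta1 -YE; apply/negP; rewrite -leNgt.
- by rewrite /half /= /D -ZE.
Qed.

End gluing.

Section levy_coupling.
Context {R : realType} {d : nat} {d0 : measure_display} {Om : measurableType d0}
  {P : probability Om R}.
Variable X : R -> {RV P >-> 'rV[R]_d}.
Hypothesis hX : levy_process X.
Hypothesis hX0 : {ae P, forall w, X 0 w = 0}.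

Lemma coupling_of_ac_component t0 : 0 < t0 -> has_ac_component (levy_transition X t0 0) ->
  coupling_property (levy_transition X).
Proof.
move=> t00 ac mu1 mu2.
have mY : markov_process (levy_transition X) (started_RV X mu1) by exact: started_markov.
have mZ : markov_process (levy_transition X) (started_RV X mu2) by exact: started_markov.
have cY p : cadlag (started_RV X mu1 ^~ p) by exact: started_cadlag hX p.
have cZ p : cadlag (started_RV X mu2 ^~ p) by exact: started_cadlag hX p.
have iY : initial_distribution (started_RV X mu1) mu1 by exact: started_initial.
have iZ : initial_distribution (started_RV X mu2) mu2 by exact: started_initial.
have close := marginals_close hX hX0 t00 ac mY mZ iY iZ.
exact: (successful_coupling (transition_weight X) mY mZ cY cZ iY iZ close).
Qed.

End levy_coupling.

(** * The equivalence and the rate *)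

Theorem theorem4p1 (R : realType) (d : nat)
  (d0 : measure_display) (Om : measurableType d0) (P : probability Om R)
  (X : R -> {RV P >-> 'rV[R]_d})
  (hX : levy_process X)
  (hX0 : {ae P, forall w, X 0 w = 0})
  (nu : {measure set 'rV[R]_d -> \bar R})
  (hnu : levy_measure X nu)
  (hnu0 : nu [set: 'rV[R]_d] != 0%E) :
  let S1 := coupling_property (levy_transition X) in
  let S2 := exists2 t0 : R, 0 < t0 &
    forall t : R, t0 <= t -> forall x : 'rV[R]_d,
      has_ac_component (levy_transition X t x) in
  (S1 <-> S2) /\
  (S1 \/ S2 ->
   forall x y : 'rV[R]_d, exists2 C : R, 0 < C &
     forall t : R, 0 < t ->
       (var_dist (levy_transition X t x) (levy_transition X t y)
          <= (C / Num.sqrt t)%:E)%E).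
Proof.
move=> S1 S2.
have S12 : S1 -> S2.
  move=> /(ac_component_of_coupling hX hX0)[t0 t00 ac]; exists t0 => // t tt0 x.
  have t0t : 0 <= t0 <= t by rewrite (ltW t00).
  exact: (ac_component_later hX hX0 t0t ac).
have S21 : S2 -> S1.
  by move=> [t0 t00 ac]; exact: (coupling_of_ac_component hX hX0 t00 (ac _ (lexx _) 0)).
split=> // S x y.
have [t0 t00 ac] : S2 by case: S => // /S12.
exact: (levy_var_decay hX hX0 _ _ t00 (ac _ (lexx _) 0)).
Qed.
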